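(* Let $Q$ be a smooth manifold with $n:=\dim(Q)\ge1$, let $\mathbb{T}=\mathbb{Z}$ or $\mathbb{T}=\mathbb{R}$, and let $\Phi\colon Q\times\mathbb{T}\to Q$ be a $C^1$ dynamical system such that $Q$ is the basin of an attracting hyperbolic fixed point $x_0\in Q$. Fix $k\in\mathbb{N}_{\ge1}\cup\{+\infty\}$, $0\le\alpha\le1$ and $\mu\in\mathbb{C}$, and assume that the spectral radius $\rho(D_{x_0}\Phi^1)\in(0,1)$ satisfies $$|e^\mu|>\left(\rho(D_{x_0}\Phi^1)\right)^{k+\alpha}$$ (with the right-hand side understood as $0$ if $k=+\infty$). (Uniqueness of Koopman eigenvalues and principal eigenfunctions) Let $\psi_1\in C^{k,\alpha}_{\mathrm{loc}}(Q,\mathbb{C})$ be any Koopman eigenfunction with exponent $\mu$. 1. There exists $m=(m_1,\dots,m_n)\in\mathbb{N}_{\ge0}^n$ such that $e^\mu=e^{m\cdot\lambda}$, where $e^{\lambda_1},\dots,e^{\lambda_n}$ are the eigenvalues of $D_{x_0}\Phi^1$ repeated with multiplicities and $\lambda:=(\lambda_1,\dots,\lambda_n)$. 2. Assume that $\psi_1$ is a principal eigenfunction, so that $e^\mu\in\mathrm{spec}(D_{x_0}\Phi^1)$, and assume that $(e^\mu,D_{x_0}\Phi^1)$ is $k$-nonresonant. Then $\psi_1$ is uniquely determined by $D_{x_0}\psi_1$ (among $C^{k,\alpha}_{\mathrm{loc}}$ principal eigenfunctions with exponent $\mu$), and if $e^\mu$ and $D_{x_0}\psi_1$ are real, then $\psi_1\colon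 Q\to\mathbb{R}\subset\mathbb{C}$ is real. In particular, if $e^\mu$ is an algebraically simple eigenvalue of (the complexification of) $D_{x_0}\Phi^1$ and if $\psi_2\in C^{k,\alpha}_{\mathrm{loc}}(Q,\mathbb{C})$ is any other principal eigenfunction with the same exponent $\mu$, then there exists $c\in\mathbb{C}\setminus\{0\}$ such that $\psi_1=c\psi_2$. (Existence of principal eigenfunctions) Assume that $\Phi\in C^{k,\alpha}_{\mathrm{loc}}$ and that $(e^\mu,D_{x_0}\Phi^1)$ is $k$-nonresonant. Let $w\colon T_{x_0}Q\to\mathbb{C}$ be any left eigenvector of $D_{x_0}\Phi^1$ with eigenvalue $e^\mu$ such that $w\,D_{x_0}\Phi^t=e^{\mu t}w$ for all $t\in\mathbb{T}$. 1. Then there exists a unique principal eigenfunction $\psi\in C^{k,\alpha}_{\mathrm{loc}}(Q,\mathbb{C})$ with exponent $\mu$ satisfying $D_{x_0}\psi=w$. 2. In fact, if $P\in C^{k,\alpha}_{\mathrm{loc}}(Q,\mathbb{C})$ is any function satisfying $D_{x_0}P=w$ and $P\circ\Phi^1=e^\mu P+R$ with $D^i_{x_0}R=0$ for all integers $0\le i<k+\alpha$, then $$\psi=\lim_{t\to\infty}e^{-\mu t}P\circ\Phi^t$$ in the topology of $C^{k,\alpha}$-uniform convergence on compact subsets of $Q$ if $k<+\infty$, and in the topology of $C^{k'}$-uniform convergence on compact subsets of $Q$ for any $k'\in\mathbb{N}_{\ge1}$ if $k=+\infty$.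
   Context: A dynamical system $\Phi\colon Q\times\mathbb{T}\to Q$ satisfies $\Phi^0=\mathrm{id}_Q$ and $\Phi^{t+s}=\Phi^t\circ\Phi^s$ for all $t,s\in\mathbb{T}$, where $\Phi^t:=\Phi(\cdot,t)$; regularity refers to $\Phi$ as a map on $Q\times\mathbb{T}$. That $Q$ is the basin of an attracting hyperbolic fixed point $x_0$ means: $x_0$ is fixed by all $\Phi^t$, is asymptotically stable, every point of $Q$ converges to $x_0$ as $t\to+\infty$, and no eigenvalue of $D_{x_0}\Phi^1$ has modulus $1$ (so all have modulus $<1$). $D_xF$ denotes the derivative of $F$ at $x$; eigenvalues of real linear maps are those of the complexification. A Koopman eigenfunction with exponent $\mu\in\mathbb{C}$ is a function $\psi\colon Q\to\mathbb{C}$, not identically zero, with $\psi\circ\Phi^t=e^{\mu t}\psi$ for all $t\in\mathbb{T}$. A principal eigenfunction is a $C^1$ Koopman eigenfunction $\psi$ with $\psi(x_0)=0$ and $D_{x_0}\psi\ne0$. A left eigenvector of a linear map $Y\colon V\to V$ with eigenvalue $\lambda\in\mathbb{C}$ is a nonzero linear map $w\colon V\to\mathbb{C}$ with $wY=\lambda w$. $C^{k,\alpha}_{\mathrm{loc}}$: for finite $k$, a map $\psi\in C^k(M,N)$ between smooth manifolds is in $C^{k,\alpha}_{\mathrm{loc}}(M,N)$ if for every $x\in M$ there are charts around $x$ and $\psi(x)$ in which all $k$-th partial derivatives of $\psi$ are Hölder continuous with exponent $\alpha$; $C^{k,0}_{\mathrm{loc}}=C^k$, and $C^{+\infty,\alpha}_{\mathrm{loc}}:=C^\infty$.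 If $k=+\infty$, then $k+\alpha=+\infty$. ''$D^i_{x_0}R=0$ for all integers $0\le i<r$'' means that in local coordinates all partial derivatives of $R$ of order less than $r$ (including order $0$) vanish at $x_0$. $k$-nonresonance: $(e^\mu,D_{x_0}\Phi^1)$ is $k$-nonresonant if, with $\sigma_1,\dots,\sigma_n$ the eigenvalues of $D_{x_0}\Phi^1$ repeated with multiplicities, $e^\mu\ne\sigma_1^{m_1}\cdots\sigma_n^{m_n}$ for every $(m_1,\dots,m_n)\in\mathbb{N}_{\ge0}^n$ with $2\le m_1+\cdots+m_n<k+1$ (vacuous if $k=1$). $C^{k,\alpha}$-uniform convergence on compact subsets (finite $k$): identify $Q$ with $\mathbb{R}^n$ by a diffeomorphism ($Q$ is diffeomorphic to $\mathbb{R}^n$); $f_t\to f$ means $\|f_t-f\|_{k,\alpha}\to0$ on the closure of each precompact open set $U$, where $\|G\|_{k,\alpha}:=\sum_{i=0}^k\sup_{x\in U}\|D^i_xG\|+[D^kG]_\alpha$ with $[H]_\alpha:=\sup_{x\ne y\in U}\|H(x)-H(y)\|/\|x-y\|^\alpha$ for $\alpha>0$, and the Hölder term is omitted for $\alpha=0$. $C^{k'}$-uniform convergence is the case $(k',0)$. *)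

(* Defs.v *)
From HB Require Import structures.
From mathcomp Require Import all_boot all_order all_algebra.
From mathcomp Require Import complex.
From mathcomp Require Import all_classical all_reals all_analysis.

Set Implicit Arguments.
Unset Strict Implicit.
Unset Printing Implicit Defensive.

Import Order.TTheory GRing.Theory Num.Theory.
Import numFieldNormedType.Exports.
Import ComplexField.Normc.

Local Open Scope classical_set_scope.
Local Open Scope ring_scope.

(* Orders of differentiability k in N + {oo}. *)

Inductive regularity := Fin of nat | Infty.

Definition regularity_ge1 (k : regularity) : bool :=
  if k is Fin j then (1 <= j)%N else true.

(* i < k + a, where oo + a = oo *)
Definition below_order (R : realType) (i : nat) (k : regularity) (a : R) : bool :=
  if k is Fin j then i%:R < j%:R + a else true.

(* r ^ (k + a), where r ^ oo = 0; only used for 0 < r < 1 *)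
Definition pow_order (R : realType) (r : R) (k : regularity) (a : R) : R :=
  if k is Fin j then r `^ (j%:R + a) else 0.

Definition cexp (R : realType) (z : R[i]) : R[i] :=
  Complex (expR (complex.Re z) * cos (complex.Im z))
          (expR (complex.Re z) * sin (complex.Im z)).

(* Real linear maps are matrices acting on row vectors, as in [jacobian]:
   v |-> v *m A.  Their eigenvalues are those of the complexification. *)

Definition complexify (R : realType) (m n : nat) (A : 'M[R]_(m, n)) :
    'M[R[i]]_(m, n) := map_mx (real_complex R) A.

(* sigma_1, ..., sigma_n are the eigenvalues of A with algebraic multiplicity *)
Definition eigenvalues_of (R : realType) (n : nat) (A : 'M[R]_n)
    (sigma : 'I_n -> R[i]) : Prop :=
  char_poly (complexify A) = \prod_(i < n) ('X - (sigma i)%:P).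

Definition spectral_radius (R : realType) (n : nat) (A : 'M[R]_n) : R :=
  sup [set normc z | z in [set z | eigenvalue (complexify A) z]].

Definition simple_eigenvalue (R : realType) (n : nat) (A : 'M[R]_n)
    (z : R[i]) : Prop :=
  mup z (char_poly (complexify A)) = 1%N.

(* A linear map w : R^n -> C is the column of its values on the standard basis,
   so that the composite w Y (first Y, then w) is the product Y *m w. *)
Definition left_eigenvector (R : realType) (n : nat) (A : 'M[R]_n)
    (z : R[i]) (w : 'cV[R[i]]_n) : Prop :=
  w != 0 /\ complexify A *m w = z *: w.

Definition nonresonant (R : realType) (n : nat) (k : regularity) (z : R[i])
    (A : 'M[R]_n) : Prop :=
  forall sigma : 'I_n -> R[i], eigenvalues_of A sigma ->
  forall m : 'I_n -> nat,
    (2 <= \sum_(i < n) m i)%N -> below_order (\sum_(i < n) m i)%N k (1 : R) ->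
    z <> \prod_(i < n) sigma i ^+ m i.

(* The iterated partial derivative of f along the coordinate directions
   listed in s (the last one of s is taken first). *)
Definition partial (R : realType) (n : nat) (s : seq 'I_n)
    (f : 'rV[R]_n -> R) : 'rV[R]_n -> R :=
  foldr (fun i (g : 'rV[R]_n -> R) x => 'D_(delta_mx 0 i) g x) f s.

Definition cpartial (R : realType) (n : nat) (s : seq 'I_n)
    (f : 'rV[R]_n -> R[i]) (x : 'rV[R]_n) : R[i] :=
  Complex (partial s (fun y => complex.Re (f y)) x)
          (partial s (fun y => complex.Im (f y)) x).

(* V is meant to be open in the next two definitions. *)
Definition Ck_on (R : realType) (n : nat) (k : nat) (V : set 'rV[R]_n)
    (f : 'rV[R]_n -> R) : Prop :=
  forall s : seq 'I_n,
    ((size s <= k)%N ->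
       forall x, V x -> {for x, continuous (partial s f)}) /\
    ((size s < k)%N ->
       forall x i, V x -> derivable (partial s f) x (delta_mx 0 i)).

Definition holder_on (R : realType) (n : nat) (k : nat) (alpha : R)
    (V : set 'rV[R]_n) (f : 'rV[R]_n -> R) : Prop :=
  exists C : R, forall (s : seq 'I_n) (x y : 'rV[R]_n),
    size s = k -> V x -> V y ->
    `|partial s f x - partial s f y| <= C * `|x - y| `^ alpha.

(* A chart of X: its domain, its coordinate map, and the inverse of the latter.
   The two functions are total; only their values on the domain, resp. on its
   image, matter. *)
Record chart (R : realType) (n : nat) (X : Type) := Chart {
  chart_dom : set X;
  chart_coord : X -> 'rV[R]_n;
  chart_param : 'rV[R]_n -> X }.

Definition chart_img (R : realType) (n : nat) (X : Type) (c : chart R n X) :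
    set 'rV[R]_n :=
  chart_coord c @` chart_dom c.

Definition is_chart (R : realType) (n : nat) (X : topologicalType)
    (c : chart R n X) : Prop :=
  [/\ open (chart_dom c),
      open (chart_img c),
      forall x, chart_dom c x -> chart_param c (chart_coord c x) = x,
      forall x, chart_dom c x -> {for x, continuous (chart_coord c)} &
      forall v, chart_img c v -> {for v, continuous (chart_param c)}].

Definition smooth_transition (R : realType) (n : nat) (X : Type)
    (c d : chart R n X) : Prop :=
  forall (k : nat) (j : 'I_n),
    Ck_on k [set v | chart_img c v /\ chart_dom d (chart_param c v)]
      (fun v => chart_coord d (chart_param c v) 0 j).

Record smooth_manifold (R : realType) (n : nat) := SmoothManifold {
  carrier :> topologicalType;
  atlas : set (chart R n carrier);
  manifold_hausdorff : hausdorff_space carrier;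
  manifold_second_countable : @second_countable carrier;
  atlas_chart : forall c, atlas c -> is_chart c;
  atlas_cover : forall x, exists2 c, atlas c & chart_dom c x;
  atlas_smooth : forall c d, atlas c -> atlas d -> smooth_transition c d }.

(* c belongs to the maximal atlas of Q *)
Definition smooth_chart (R : realType) (n : nat) (Q : smooth_manifold R n)
    (c : chart R n Q) : Prop :=
  is_chart c /\
  forall d, atlas d -> smooth_transition c d /\ smooth_transition d c.

(* C^{k,alpha}_loc for maps between manifolds given by atlases, k finite *)
Definition Ckalpha_fin (R : realType) (p q : nat) (X Y : Type)
    (A : set (chart R p X)) (B : set (chart R q Y)) (k : nat) (alpha : R)
    (f : X -> Y) : Prop :=
  forall x : X, exists (c : chart R p X) (d : chart R q Y) (V : set 'rV[R]_p),
    [/\ A c, B d, chart_dom c x & open V /\ V (chart_coord c x)] /\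
    [/\ V `<=` chart_img c,
        forall v, V v -> chart_dom d (f (chart_param c v)) &
        forall j : 'I_q,
          let g v := chart_coord d (f (chart_param c v)) 0 j in
          Ck_on k V g /\ (0 < alpha -> holder_on k alpha V g)].

Definition Ckalpha_loc (R : realType) (p q : nat) (X Y : Type)
    (A : set (chart R p X)) (B : set (chart R q Y)) (k : regularity) (alpha : R)
    (f : X -> Y) : Prop :=
  match k with
  | Fin j => Ckalpha_fin A B j alpha f
  | Infty => forall j : nat, Ckalpha_fin A B j 0 f
  end.

Definition prod_chart (R : realType) (p q : nat) (X Y : Type)
    (c : chart R p X) (d : chart R q Y) : chart R (p + q) (X * Y) :=
  {| chart_dom := chart_dom c `*` chart_dom d;
     chart_coord := fun z => row_mx (chart_coord c z.1) (chart_coord d z.2);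
     chart_param := fun v =>
       (chart_param c (lsubmx v), chart_param d (rsubmx v)) |}.

Definition prod_atlas (R : realType) (p q : nat) (X Y : Type)
    (A : set (chart R p X)) (B : set (chart R q Y)) :
    set (chart R (p + q) (X * Y)) :=
  [set e | exists c d, [/\ A c, B d & e = prod_chart c d]].

(* C as the real manifold R^2 *)
Definition complex_chart (R : realType) : chart R 2 R[i] :=
  {| chart_dom := setT;
     chart_coord := fun z =>
       \row_(j < 2) (if j == 0 then complex.Re z else complex.Im z);
     chart_param := fun v => Complex (v 0 0) (v 0 1) |}.

Definition complex_atlas (R : realType) : set (chart R 2 R[i]) :=
  [set complex_chart R].

Inductive time_kind := DiscreteTime | ContinuousTime.

Definition time (R : realType) (tk : time_kind) : realDomainType :=
  match tk with DiscreteTime => int | ContinuousTime => R end.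

Definition time_val (R : realType) (tk : time_kind) : time R tk -> R :=
  match tk return time R tk -> R with
  | DiscreteTime => fun t : int => t%:~R
  | ContinuousTime => fun t : R => t
  end.

(* Z is a discrete 0-dimensional manifold, R a 1-dimensional one. *)
Definition time_dim (tk : time_kind) : nat :=
  match tk with DiscreteTime => 0 | ContinuousTime => 1 end.

Definition time_atlas (R : realType) (tk : time_kind) :
    set (chart R (time_dim tk) (time R tk)) :=
  match tk return set (chart R (time_dim tk) (time R tk)) with
  | DiscreteTime =>
      [set c | exists z : int, c = {| chart_dom := [set z];
                                      chart_coord := fun _ => 0;
                                      chart_param := fun _ => z |}]
  | ContinuousTime =>
      [set {| chart_dom := setT;
              chart_coord := fun t : R => const_mx t;
              chart_param := fun v : 'rV[R]_1 => v 0 0 |}]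
  end.

(* the filter t --> +oo in T *)
Definition time_infty (R : realType) (tk : time_kind) :
    set_system (time R tk) :=
  [set A | exists M : time R tk, forall t, M <= t -> A t].

Global Instance time_infty_filter (R : realType) (tk : time_kind) :
  ProperFilter (@time_infty R tk).
Proof.
split; first by case=> M /(_ M (lexx M)).
split; first by exists 0.
- move=> A B [M hA] [N hB]; exists (Num.max M N) => t.
  by rewrite ge_max => /andP[/hA At /hB Bt].
- by move=> A B AB [M hA]; exists M => t /hA /AB.
Qed.

Section DynamicalSystems.
Variables (R : realType) (n : nat) (Q : smooth_manifold R n) (tk : time_kind).
Implicit Types (Phi : Q -> time R tk -> Q) (c : chart R n Q).

Definition dynamical_system Phi : Prop :=
  (forall x, Phi x 0 = x) /\ (forall x t s, Phi x (t + s) = Phi (Phi x s) t).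

(* Phi is C^{k,alpha}_loc jointly in (x, t) *)
Definition Ckalpha_flow (k : regularity) (alpha : R) Phi : Prop :=
  Ckalpha_loc (prod_atlas (@atlas R n Q) (@time_atlas R tk)) (@atlas R n Q)
    k alpha (fun z => Phi z.1 z.2).

Definition Ckalpha_fun (k : regularity) (alpha : R) (psi : Q -> R[i]) : Prop :=
  Ckalpha_loc (@atlas R n Q) (@complex_atlas R) k alpha psi.

(* The tangent space at x is identified with R^n by a chart c around x.
   [chart_jacobian] is the derivative at x of a self-map fixing x, and
   [chart_cderivative] that of a complex-valued function. *)
Definition chart_jacobian c (f : Q -> Q) (x : Q) : 'M[R]_n :=
  jacobian (fun v => chart_coord c (f (chart_param c v))) (chart_coord c x).

Definition chart_cderivative c (psi : Q -> R[i]) (x : Q) : 'cV[R[i]]_n :=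
  \col_(i < n) cpartial [:: i] (psi \o chart_param c) (chart_coord c x).

Definition asymptotically_stable Phi (x0 : Q) : Prop :=
  (forall U, nbhs x0 U ->
     exists2 V, nbhs x0 V & forall x t, V x -> 0 <= t -> U (Phi x t)) /\
  (exists2 V, nbhs x0 V & forall x, V x -> Phi x @ @time_infty R tk --> x0).

Definition basin_of_hyperbolic Phi (x0 : Q) c : Prop :=
  [/\ forall t, Phi x0 t = x0,
      asymptotically_stable Phi x0,
      forall x, Phi x @ @time_infty R tk --> x0 &
      forall z, eigenvalue (complexify (chart_jacobian c (Phi ^~ 1) x0)) z ->
        normc z <> 1].

Definition koopman_eigenfunction Phi (mu : R[i]) (psi : Q -> R[i]) : Prop :=
  (exists x, psi x <> 0) /\
  forall t x, psi (Phi x t) = cexp (mu * (time_val t)%:C%C) * psi x.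

Definition principal_eigenfunction Phi (x0 : Q) c (mu : R[i])
    (psi : Q -> R[i]) : Prop :=
  [/\ koopman_eigenfunction Phi mu psi,
      Ckalpha_fun (Fin 1) 0 psi,
      psi x0 = 0 &
      chart_cderivative c psi x0 != 0].

(* The C^{k,alpha} norm over U, where i-linear maps are normed by the largest
   modulus of their coefficients. *)
Definition Ckalpha_norm (k : nat) (alpha : R) (U : set 'rV[R]_n)
    (G : 'rV[R]_n -> R[i]) : \bar R :=
  (\sum_(i < k.+1)
     ereal_sup [set e | exists (s : seq 'I_n) (x : 'rV[R]_n),
       [/\ size s = i, U x & e = (normc (cpartial s G x))%:E]] +
   if (0 < alpha)%R then
     ereal_sup [set e | exists (s : seq 'I_n) (x y : 'rV[R]_n),
       [/\ size s = k, U x, U y, x != y &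
           e = (normc (cpartial s G x - cpartial s G y) /
                `|x - y| `^ alpha)%:E]]
   else 0)%E.

(* C^{k,alpha}-uniform convergence on compact subsets, k finite, as t --> +oo.
   A diffeomorphism of Q onto R^n is a chart h with full domain and image; the
   convergence is required in every chart of the maximal atlas, so in
   particular in every such h, over every precompact open U of its image. *)
Definition Ckalpha_cvg (k : nat) (alpha : R)
    (F : time R tk -> Q -> R[i]) (psi : Q -> R[i]) : Prop :=
  forall (h : chart R n Q) (U : set 'rV[R]_n),
    smooth_chart h -> open U -> U !=set0 -> precompact U ->
    closure U `<=` chart_img h ->
    (fun t => Ckalpha_norm k alpha U
       (fun v => F t (chart_param h v) - psi (chart_param h v)))
      @ @time_infty R tk --> (0 : \bar R).

Definition Ckalpha_cvg_order (k : regularity) (alpha : R)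
    (F : time R tk -> Q -> R[i]) (psi : Q -> R[i]) : Prop :=
  match k with
  | Fin j => Ckalpha_cvg j alpha F psi
  | Infty => forall k' : nat, (1 <= k')%N -> Ckalpha_cvg k' 0 F psi
  end.

End DynamicalSystems.

(* Main.v *)
Require Import Defs.
From HB Require Import structures.
From mathcomp Require Import all_boot all_order all_algebra.
From mathcomp Require Import complex.
From mathcomp Require Import all_classical all_reals all_analysis.
From mathcomp Require Import ring lra.

Set Implicit Arguments.
Unset Strict Implicit.
Unset Printing Implicit Defensive.

Import Order.TTheory GRing.Theory Num.Theory.
Import numFieldNormedType.Exports.
Import ComplexField.Normc.

Local Open Scope classical_set_scope.
Local Open Scope ring_scope.

(** The proof follows the dynamics near the attracting fixed point.  Write
    $\nu = e^\mu$, let $A$ be the derivative of the time-1 map at $x_0$, $\rho$ its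
    spectral radius, and choose $\theta$ with $\rho < \theta < 1$ and
    $\theta^{k+\alpha} < |\nu|$ ([choose_theta]).  In a chart some iterate $\Phi^N$
    contracts balls by the factor $\theta^N$ ([local_contraction]); the bound on the
    powers of $A$ comes from the Cayley-Hamilton theorem.

    Uniqueness.  An eigenfunction $f$ of the time-1 map whose jets of order less
    than $k + \alpha$ vanish satisfies $|f(x)| \le C |x - x_0|^{k+\alpha}$.  Along the
    orbit of $x$ the right-hand side decays like $\theta^{(k+\alpha) t}$, the left-hand
    side like $|\nu|^t$, which is slower; hence $f = 0$ near $x_0$, and everywhere
    because all orbits converge to $x_0$ ([flat_eigenfunction_zero]).  On the other
    hand the lowest nonvanishing jet of $f$, of order $l$ say, is an eigenvector for
    $\nu$ of the $l$-th tensor power of $A$ ([leading_jet]), whose eigenvalues are the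
    products of $l$ eigenvalues of $A$ ([tens_eigenvalue]).  So $\nu$ is such a product
    unless $f = 0$, and in the nonresonant case $f$ is determined by its 1-jet
    ([eigenfunction_unique]).  Only $\Phi \in C^1$ is assumed here, and the equation
    $f \circ \Phi^1 = \nu f$ cannot be differentiated more than once: the jet equation is
    obtained by blowing up the equation at $x_0$ ([scaling_limit]).

    Existence.  Degree by degree, nonresonance allows one to solve for a polynomial
    $P$ with derivative $w$ such that the jets of $P \circ \Phi^1 - \nu P$ vanish up to
    order $k$ ([formal_eigenfunction]).  The central estimate concerns functions $g$
    with $|D^i g(x)| \le K |x - x_0|^{k+\alpha-i}$ for $i \le k$, together with the Holder
    bound for $D^k g$ ([weighted]): composing $g$ with $\Phi^N$ multiplies $K$ by
    little more than $\theta^{N(k+\alpha)}$ on a small ball ([weighted_contraction]).  For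
    any $P$ whose defect is flat, $\nu^{-NJ} P \circ \Phi^{NJ}$ is therefore a Cauchy
    sequence with a geometric rate near $x_0$, and the dynamics extends its limit
    $\psi$ to the whole basin ([eigenfunction_limit]).  For a time $t$ other than 1,
    the function $e^{-\mu t} \psi \circ \Phi^t$ is again an eigenfunction of the time-1
    map, with derivative $w$ by the assumption on $w$, so that it equals $\psi$ by
    uniqueness ([eigenfunction_all_times]).

    Convergence.  A time $t$ is written $t' + N J$ with $t'$ in a bounded window.
    Compact sets are carried into a small ball around $x_0$ by all $\Phi^{t'}$ with $t'$
    in the window ([compact_absorbed]), the composition with these maps is bounded in
    $C^{k,\alpha}$ uniformly over the window ([window_bound_uniform]), and the factor
    from the $J$ further steps of length $N$ decays geometrically ([koopman_limit]). *)

(** * Mean values over coordinate boxes *)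

Section RowVectors.
Variables (R : realType) (p : nat).
Implicit Types (v w y z : 'rV[R]_p) (f : 'rV[R]_p -> R).

Local Notation e_ i := (delta_mx 0 i : 'rV[R]_p).

Lemma coord_le_norm v j : `|v 0 j| <= `|v|.
Proof. by rewrite [leRHS]/Num.Def.normr/= mx_normrE; exact: (le_bigmax _ (fun ij => `|v ij.1 ij.2|) (0, j)). Qed.

Lemma norm_rV_le v e : 0 <= e -> (forall j, `|v 0 j| <= e) -> `|v| <= e.
Proof.
move=> e0 ve; rewrite /Num.Def.normr/= mx_normrE; apply: bigmax_le => // -[i j] _.
by rewrite ord1.
Qed.

Lemma norm_rV_ltP v e : 0 < e -> (forall j, `|v 0 j| < e) -> `|v| < e.
Proof.
move=> e0 ve; rewrite /Num.Def.normr/= mx_normrE; apply: bigmax_lt => // -[i j] _.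
by rewrite ord1.
Qed.

(** The points of the coordinate box spanned by [y] and [y']; in the maximum
    norm the box is the intersection of all balls containing both corners,
    which makes every estimate over a ball available on the box. *)
Definition in_box y y' z := forall c, `|z - c| <= Num.max `|y - c| `|y' - c|.

Lemma in_box_coord y y' z :
  (forall j, Num.min (y 0 j) (y' 0 j) <= z 0 j <= Num.max (y 0 j) (y' 0 j)) ->
  in_box y y' z.
Proof.
move=> zb c; apply: norm_rV_le; first by rewrite le_max normr_ge0.
move=> j; move: (zb j) (coord_le_norm (y - c) j) (coord_le_norm (y' - c) j).
rewrite !mxE => /andP[h1 h2] h3 h4.
have : `|z 0 j - c 0 j| <= Num.max `|y 0 j - c 0 j| `|y' 0 j - c 0 j|.
  set m := Num.max _ _.
  have : `|y 0 j - c 0 j| <= m by rewrite le_max lexx.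
  have : `|y' 0 j - c 0 j| <= m by rewrite le_max lexx orbT.
  move: h1 h2; rewrite !ler_norml le_max ge_min.
  by move=> /orP[] a /orP[] b /andP[? ?] /andP[? ?]; apply/andP; split; lra.
move/le_trans; apply; rewrite ge_max !le_max h3 h4 orbT //.
Qed.

(** Stated for either sign of [h], as the increments of a path along a coordinate box
    have no fixed sign. *)
Lemma mvt_coord f w j h :
  (forall t, Num.min 0 h <= t <= Num.max 0 h -> derivable f (w + t *: e_ j) (e_ j)) ->
  exists t, Num.min 0 h <= t <= Num.max 0 h /\
    f (w + h *: e_ j) - f w = h * 'D_(e_ j) f (w + t *: e_ j).
Proof.
move=> df.
pose g t := f (w + t *: e_ j).
have Dg t : Num.min 0 h <= t <= Num.max 0 h -> is_derive t 1 g ('D_(e_ j) f (w + t *: e_ j)).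
  move=> /df dft.
  have E : (fun k : R => k^-1 *: (g (k *: 1 + t) - g t)) =
           (fun k : R => k^-1 *: (f (k *: e_ j + (w + t *: e_ j)) - f (w + t *: e_ j))).
    apply/funext => k; rewrite /g; congr (_ *: (f _ - _)).
    by rewrite [k *: 1]mulr1 scalerDl addrCA.
  by apply: DeriveDef; rewrite /derivable /derive E.
have cg a b : a <= b -> Num.min 0 h <= a -> b <= Num.max 0 h ->
    {within `[a, b], continuous g}.
  move=> ab ha hb; apply: derivable_within_continuous => t; rewrite in_itv/= => /andP[t1 t2].
  have /Dg[//] : Num.min 0 h <= t <= Num.max 0 h.
  by rewrite (le_trans ha t1) (le_trans t2 hb).
case: (leP 0 h) => h0.
- have [||t] := @MVT_segment R g (fun t => 'D_(e_ j) f (w + t *: e_ j)) 0 h h0.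
  + move=> t; rewrite in_itv/= => /andP[t1 t2]; apply: Dg.
    by rewrite min_l // max_r // !ltW.
  + by apply: cg => //; rewrite ?min_l ?max_r.
  + rewrite in_itv/= => ht E; exists t; split=> //.
    by rewrite /g scale0r addr0 subr0 mulrC in E.
- have [||t] := @MVT_segment R g (fun t => 'D_(e_ j) f (w + t *: e_ j)) h 0 (ltW h0).
  + move=> t; rewrite in_itv/= => /andP[t1 t2]; apply: Dg.
    by rewrite min_r ?max_l // !ltW.
  + by apply: cg; rewrite ?min_r ?max_l // ltW.
  + rewrite in_itv/= => ht E; exists t; split=> //.
    rewrite /g scale0r addr0 sub0r in E.
    by rewrite -opprB E mulrN opprK mulrC.
Qed.

(** Moving from [y] to [y'] one coordinate at a time stays in the box. *)
Lemma mvt_box f y y' :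
  (forall z j, in_box y y' z -> derivable f z (e_ j)) ->
  exists xi : 'I_p -> 'rV[R]_p, (forall j, in_box y y' (xi j)) /\
    f y' - f y = \sum_j (y' 0 j - y 0 j) * 'D_(e_ j) f (xi j).
Proof.
move=> df.
pose w (k : nat) : 'rV[R]_p := \row_l (if (l < k)%N then y' 0 l else y 0 l).
have wS (j : 'I_p) : w j.+1 = w j + (y' 0 j - y 0 j) *: e_ j.
  apply/rowP => l; rewrite !mxE eqxx /= ltnS leq_eqVlt.
  have [->|lj] := eqVneq l j; first by rewrite eqxx ltnn /= mulr1 addrC subrK.
  by rewrite (negbTE (_ : _ != _ :> nat)) ?mulr0 ?addr0.
have boxw (j : 'I_p) t : Num.min 0 (y' 0 j - y 0 j) <= t <= Num.max 0 (y' 0 j - y 0 j) ->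
    in_box y y' (w j + t *: e_ j).
  move=> ht; apply: in_box_coord => l; rewrite !mxE eqxx /=.
  have [lj|lj] := eqVneq l j.
    rewrite lj ltnn mulr1; move: ht.
    by case: (leP 0 (y' 0 j - y 0 j)); case: (leP (y 0 j) (y' 0 j)); lra.
  rewrite mulr0 addr0; case: ifP => _; rewrite ge_min le_max !lexx ?orbT //.
have H (j : 'I_p) : exists z, in_box y y' z /\
    f (w j.+1) - f (w j) = (y' 0 j - y 0 j) * 'D_(e_ j) f z.
  have [|t [ht E]] := @mvt_coord f (w j) j (y' 0 j - y 0 j).
    by move=> t /boxw b; exact: df.
  by exists (w j + t *: e_ j); split; [exact: boxw|rewrite wS].
have [xi Hxi] := choice H.
exists xi; split => [j|]; first by case: (Hxi j).
have -> : y' = w p by apply/rowP => l; rewrite mxE ltn_ord.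
have -> : f y = f (w 0%N) by congr f; apply/rowP => l; rewrite mxE.
rewrite -(telescope_sumr (fun k => f (w k))) // big_mkord; apply: eq_bigr => j _.
by have [_ ->] := Hxi j; rewrite [w p 0 j]mxE ltn_ord.
Qed.

End RowVectors.

(** * The local $C^{k,a}$ classes *)

Notation row_unit i := (delta_mx (0 : 'I_1) i).

Lemma open_norm_ball (R : realType) (p : nat) (V : set 'rV[R]_p) x :
  open V -> V x -> exists2 r, 0 < r & forall y, `|y - x| < r -> V y.
Proof.
move=> oV Vx; have /nbhs_ballP[r /= r0 rV] := open_nbhs_nbhs (conj oV Vx).
by exists r => // y; rewrite distrC => yr; apply: rV; rewrite -ball_normE.
Qed.

Lemma open_near (R : realType) (p : nat) (V : set 'rV[R]_p) x (P : 'rV[R]_p -> Prop) :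
  open V -> V x -> (forall y, V y -> P y) -> \forall y \near x, P y.
Proof. by move=> oV Vx VP; apply: (filterS VP); exact: open_nbhs_nbhs. Qed.

Lemma continuous_norm_ball (R : realType) (p q : nat) (f : 'rV[R]_p -> 'rV[R]_q) x :
  {for x, continuous f} -> forall e, 0 < e ->
  exists2 r, 0 < r & forall y, `|y - x| < r -> `|f y - f x| < e.
Proof.
move=> /cvgrPdist_lt cf e e0; have /nbhs_ballP[r /= r0 rV] := cf _ e0.
exists r => // y; rewrite distrC => yr; rewrite distrC; apply: rV.
by rewrite -ball_normE.
Qed.

Lemma continuous_norm_ballR (R : realType) (p : nat) (f : 'rV[R]_p -> R) x :
  {for x, continuous f} -> forall e, 0 < e ->
  exists2 r, 0 < r & forall y, `|y - x| < r -> `|f y - f x| < e.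
Proof.
move=> /cvgrPdist_lt cf e e0; have /nbhs_ballP[r /= r0 rV] := cf _ e0.
exists r => // y; rewrite distrC => yr; rewrite distrC; apply: rV.
by rewrite -ball_normE.
Qed.

Lemma norm_ball_continuousR (R : realType) (p : nat) (f : 'rV[R]_p -> R) x :
  (forall e, 0 < e ->
    exists2 r, 0 < r & forall y, `|y - x| < r -> `|f y - f x| <= e) ->
  {for x, continuous f}.
Proof.
move=> H; apply/(@cvgrPdist_le _ _ _ (nbhs x)) => e e0; have [r r0 rV] := H _ e0.
apply/nbhs_ballP; exists r => // y; rewrite -ball_normE/= distrC => yr.
by rewrite distrC; apply: rV.
Qed.

Section HolderClasses.
Variables (R : realType) (p : nat).
Implicit Types (V W : set 'rV[R]_p) (f g : 'rV[R]_p -> R) (a b : R) (k : nat).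

Definition locally_holder a V f := forall x, V x ->
  exists2 r, 0 < r & exists2 C, 0 <= C & forall y z,
    `|y - x| < r -> `|z - x| < r -> `|f y - f z| <= C * `|y - z| `^ a.

(** The local $C^{k,a}$ classes, set up by recursion on [k] through the first
    partial derivatives: this is the shape in which closure under products and
    composition is proved. *)
Fixpoint Cka k a V f : Prop :=
  match k with
  | 0%N => (forall x, V x -> {for x, continuous f}) /\ locally_holder a V f
  | k'.+1 => [/\ forall x, V x -> {for x, continuous f},
                 forall x i, V x -> derivable f x (row_unit i) &
                 forall i, Cka k' a V (partial [:: i] f)]
  end.

Lemma Cka_continuous k a V f x : Cka k a V f -> V x -> {for x, continuous f}.
Proof. by case: k => [[h _]|k [h _ _]] Vx; exact: h. Qed.

Lemma locally_holder_sub a V W f :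
  W `<=` V -> locally_holder a V f -> locally_holder a W f.
Proof. by move=> WV H x /WV /H. Qed.

Lemma Cka_sub k a V W f : W `<=` V -> Cka k a V f -> Cka k a W f.
Proof.
move=> WV; elim: k f => [f [cf hf]|k IH f [cf df pf]] /=.
  by split; [move=> x /WV; exact: cf|exact: locally_holder_sub hf].
by split; [move=> x /WV; exact: cf|move=> x i /WV; exact: df|move=> i; exact: IH (pf i)].
Qed.

Lemma partial1_near f g x i : (\near x, f x = g x) -> partial [:: i] f x = partial [:: i] g x.
Proof. exact: near_eq_derive. Qed.

Lemma Cka_ext k a V f g :
  open V -> (forall x, V x -> f x = g x) -> Cka k a V f -> Cka k a V g.
Proof.
move=> oV.
have cont f1 g1 : (forall x, V x -> f1 x = g1 x) -> (forall x, V x -> {for x, continuous f1}) ->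
    forall x, V x -> {for x, continuous g1}.
  move=> fg cf x Vx; rewrite /prop_for/continuous_at -(fg _ Vx).
  apply: cvg_trans (cf _ Vx); apply: (@near_eq_cvg _ _ (nbhs x)).
  exact: (open_near oV Vx).
elim: k f g => [f g fg [cf hf]|k IH f g fg [cf df pf]] /=.
  split; first exact: cont cf.
  move=> x Vx; have [r r0 [C C0 H]] := hf _ Vx.
  have [s s0 sV] := open_norm_ball oV Vx.
  exists (Num.min r s); first by rewrite lt_min r0.
  exists C => // y z; rewrite !lt_min => /andP[yr ys] /andP[zr zs].
  by rewrite -!fg; [exact: H|exact: sV|exact: sV].
have near_fg x : V x -> \near x, f x = g x.
  by move=> Vx; exact: (open_near oV Vx).
split; first exact: cont cf.
- by move=> x i Vx; apply: near_eq_derivable (df _ i Vx); exact: near_fg.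
- move=> i; apply: IH (pf i) => x Vx; apply: partial1_near; exact: near_fg.
Qed.

(** Both continuity and the Holder condition are required point by point, so the class
    is local. *)
Lemma Cka_local k a V f :
  (forall x, V x -> exists W, [/\ open W, W x & Cka k a W f]) -> Cka k a V f.
Proof.
elim: k f => [f H|k IH f H] /=.
  split=> x /H[W [_ Wx [cf hf]]]; [exact: cf|exact: hf].
split=> [x /H[W [_ Wx [cf _ _]]]|x i /H[W [_ Wx [_ df _]]]|i]; [exact: cf|exact: df|].
by apply: IH => x /H[W [oW Wx [_ _ pf]]]; exists W; split; last exact: pf.
Qed.

(** On small balls the distance is at most its [a]-th power. *)
Lemma locally_holder_weak a V f : 0 <= a <= 1 ->
  locally_holder 1 V f -> locally_holder a V f.
Proof.
move=> /andP[a0 a1] H x /H[r r0 [C C0 Hr]].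
exists (Num.min r 2^-1); first by rewrite lt_min r0 invr_gt0 ltr0n.
exists C => // y z; rewrite !lt_min => /andP[yr y1] /andP[zr z1].
apply: le_trans (Hr _ _ yr zr) _; apply: ler_wpM2l => //.
have d1 : `|y - z| <= 1.
  rewrite -(subrKA x) (le_trans (ler_normD _ _)) //.
  by rewrite (distrC x z); lra.
rewrite powRr1 //; have [->|d0] := eqVneq (`|y - z|) 0.
  exact: powR_ge0.
have dp : 0 < `|y - z| by rewrite lt_neqAle eq_sym d0 normr_ge0.
rewrite -[leLHS](powRr1 (ltW dp)).
by apply: ger_powR => //; rewrite dp d1.
Qed.

Lemma C1_locally_lipschitz V f : open V ->
  (forall x i, V x -> derivable f x (row_unit i)) ->
  (forall i x, V x -> {for x, continuous (partial [:: i] f)}) ->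
  locally_holder 1 V f.
Proof.
move=> oV df cf x Vx; have [s s0 sV] := open_norm_ball oV Vx.
have H i : exists r, 0 < r /\ forall y, `|y - x| < r ->
    `|partial [:: i] f y| <= `|partial [:: i] f x| + 1.
  have [r r0 rb] := continuous_norm_ballR (cf i x Vx) ltr01.
  exists r; split => // y /rb h; rewrite -(subrK (partial [:: i] f x) (partial _ f y)).
  by rewrite (le_trans (ler_normD _ _)) // addrC lerD2l ltW.
have [r Hr] := choice H.
pose t := \big[Num.min/s]_i r i.
have t0 : 0 < t by apply: lt_bigmin => // i _; case: (Hr i).
exists t => //; exists (\sum_i (`|partial [:: i] f x| + 1)).
  by apply: sumr_ge0 => i _; rewrite addr_ge0.
move=> y z yt zt.
have inb w : in_box z y w -> `|w - x| < t.
  by move/(_ x)/le_lt_trans; apply; rewrite gt_max zt yt.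
have [w j /inb wt|xi [xib E]] := @mvt_box R p f z y.
  by apply/df/sV/(lt_le_trans wt); exact: bigmin_le_id.
rewrite E powRr1 // mulr_suml (le_trans (ler_norm_sum _ _ _)) //.
apply: ler_sum => j _; rewrite normrM mulrC; apply: ler_pM => //; last first.
  by have := coord_le_norm (y - z) j; rewrite !mxE.
have [_] := Hr j; apply; apply: lt_le_trans (inb _ (xib j)) _.
exact: bigmin_le_cond.
Qed.

Lemma CkaSW k a b V f : open V -> 0 <= a <= 1 -> Cka k.+1 b V f -> Cka k a V f.
Proof.
move=> oV ha; elim: k f => [f [cf df pf]|k IH f [cf df pf]]; last first.
  by split => // i; apply: IH; exact: pf.
split => //; apply: locally_holder_weak => //; apply: C1_locally_lipschitz => //.
by move=> i; case: (pf i).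
Qed.

(** Lowering [k] costs no Holder continuity: the derivatives that are no longer of top
    order are continuously differentiable, hence locally Lipschitz. *)
Lemma Cka_le j k a V f : open V -> 0 <= a <= 1 -> (j <= k)%N ->
  Cka k a V f -> Cka j a V f.
Proof.
move=> oV ha; elim: k => [|k IH]; first by rewrite leqn0 => /eqP ->.
rewrite leq_eqVlt => /orP[/eqP ->//|jk] H; apply: IH => //; exact: CkaSW H.
Qed.

Lemma Cka0W k a V f : Cka k a V f -> Cka k 0 V f.
Proof.
elim: k f => [f [cf hf]|k IH f [cf df pf]] /=; last first.
  by split => // i; exact: IH (pf i).
split => // x Vx; have [r r0 H] := continuous_norm_ballR (cf _ Vx) ltr01.
exists r => //; exists 2 => // y z /H yr /H zr.
rewrite powRr0 mulr1 -(subrKA (f x)) (le_trans (ler_normD _ _)) //.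
by rewrite (distrC (f x)); lra.
Qed.

(** Partial derivatives that are continuous make [f] Frechet differentiable, by
    [mvt_box]. *)
Lemma C1_differentiable V f x : open V -> V x -> Cka 1 0 V f -> differentiable f x.
Proof.
move=> oV Vx [cf df pf].
pose L : {linear 'rV[R]_p -> 'rV[R]_1} := mulmxr (\col_j partial [:: j] f x : 'cV[R]_p).
have linc : linear (fun M : 'rV[R]_1 => M 0 0 : R).
  by move=> a u v; rewrite !mxE.
pose df0 (h : 'rV[R]_p) : R := (L h) 0 0.
have ldf : linear df0 by move=> a u v; rewrite /df0 linearP !mxE.
pose dfL := GRing.isLinear.Build R 'rV[R]_p R *:%R df0 ldf.
pose D : {linear 'rV[R]_p -> R} := HB.pack df0 dfL.
have DE h : D h = \sum_j h 0 j * partial [:: j] f x.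
  by rewrite /D/= /df0 /L /= mxE; apply: eq_bigr => j _; rewrite !mxE.
pose S := \sum_j `|partial [:: j] f x|.
have S0 : 0 <= S by apply: sumr_ge0.
have Dle h : `|D h| <= S * `|h|.
  rewrite DE mulr_suml (le_trans (ler_norm_sum _ _ _)) //.
  by apply: ler_sum => j _; rewrite normrM mulrC ler_wpM2l // coord_le_norm.
have cD : continuous D.
  move=> h; apply: norm_ball_continuousR => e e0.
  exists (e / (S + 1)); first by rewrite divr_gt0 // ltr_wpDl.
  move=> y yh; rewrite -linearB (le_trans (Dle _)) //.
  move: yh; rewrite ltr_pdivlMr ?ltr_wpDl // => /ltW; apply: le_trans.
  by rewrite mulrC ler_wpM2l // lerDl.
have E e : 0 < e -> \forall h \near (0 : 'rV[R]_p), `|(f \o shift x - (cst (f x) + D)) h| <= e * `|h|.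
  move=> e0; have [s s0 sV] := open_norm_ball oV Vx.
  have e'0 : 0 < e / (p%:R + 1) by rewrite divr_gt0 // ltr_wpDl.
  have H i : exists r, 0 < r /\ forall y, `|y - x| < r ->
      `|partial [:: i] f y - partial [:: i] f x| <= e / (p%:R + 1).
    have [r r0 rb] := continuous_norm_ballR ((pf i).1 _ Vx) e'0.
    by exists r; split => // y /rb /ltW.
  have [r Hr] := choice H.
  pose t := \big[Num.min/s]_i r i.
  have t0 : 0 < t by apply: lt_bigmin => // i _; case: (Hr i).
  apply/nbhs_ballP; exists t => // h; rewrite -ball_normE /= sub0r normrN => ht.
  change (`|f (h + x) - (f x + D h)| <= e * `|h|); rewrite opprD addrA.
  have inb w : in_box x (h + x) w -> `|w - x| < t.
    by move/(_ x)/le_lt_trans; apply; rewrite gt_max subrr normr0 t0 addrK ht.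
  have [w j /inb wt|xi [xib ->]] := @mvt_box R p f x (h + x).
    by apply/df/sV/(lt_le_trans wt); exact: bigmin_le_id.
  rewrite DE -sumrB (le_trans (ler_norm_sum _ _ _)) //.
  rewrite (le_trans (_ : _ <= \sum_(i < p) e / (p%:R + 1) * `|h|)) //.
    apply: ler_sum => j _; rewrite !mxE addrK -mulrBr normrM mulrC.
    apply: ler_pM => //; last exact: coord_le_norm.
    have [_] := Hr j; apply; apply: lt_le_trans (inb _ (xib j)) _.
    exact: bigmin_le_cond.
  rewrite sumr_const card_ord -mulrnAl ler_wpM2r // -mulr_natr mulrAC.
  by rewrite ler_pdivrMr ?ltr_wpDl // ler_wpM2l ?lerDl // ltW.
have dE : 'd f x = D :> (_ -> _) by apply: (diff_unique cD); apply/eqaddoP => e /E.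
by apply/diff_locallyP; rewrite dE; split => //; apply/eqaddoP => e /E.
Qed.
End HolderClasses.

Section Algebra.
Variables (R : realType) (p : nat).
Implicit Types (V W : set 'rV[R]_p) (f g : 'rV[R]_p -> R) (a b : R) (k : nat).

Lemma continuous_locally_bounded f x : {for x, continuous f} ->
  exists2 r, 0 < r & forall y, `|y - x| < r -> `|f y| <= `|f x| + 1.
Proof.
move=> cf; have [r r0 H] := continuous_norm_ballR cf ltr01; exists r => // y /H h.
by rewrite -(subrK (f x) (f y)) (le_trans (ler_normD _ _)) // addrC lerD2l ltW.
Qed.

Lemma partial_coord i j x : partial [:: i] (fun y : 'rV[R]_p => y 0 j) x = (i == j)%:R.
Proof.
have := derive_mx (@derivable_id _ _ x (row_unit i : 'rV[R]_p)).
by rewrite derive_id => /rowP /(_ j); rewrite !mxE eqxx /= eq_sym => <-.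
Qed.

Lemma derivable_coord x v j : derivable (fun y : 'rV[R]_p => y 0 j) x v.
Proof. exact: ((derivable_mxP (@idfun ('rV[R]_p)) x v).1 (@derivable_id _ _ x v) 0 j). Qed.

Section Exponent.
Variable a : R.
Hypothesis ha : 0 <= a <= 1.

Lemma Cka_cst k V c : Cka k a V (cst c).
Proof.
elim: k c => [c|k IH c] /=; last first.
  split=> [x _|x i _|i]; [exact: cst_continuous|exact: derivable_cst|].
  change (Cka k a V (partial [:: i] (cst c))).
  suff -> : partial [:: i] (cst c) = cst 0 :> ('rV[R]_p -> R) by exact: IH.
  by apply/funext => x; exact: derive_cst.
split=> [x _|x _]; first exact: cst_continuous.
by exists 1 => //; exists 0 => // y z _ _; rewrite subrr normr0 mul0r.
Qed.

Lemma Cka_coord k V j : Cka k a V (fun x => x 0 j).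
Proof.
case: k => [|k] /=.
  split=> [x _|]; first exact: coord_continuous.
  apply: locally_holder_weak => // x _; exists 1 => //; exists 1 => // y z _ _.
  by rewrite mul1r powRr1 //; have := coord_le_norm (y - z) j; rewrite !mxE.
split=> [x _|x i _|i]; [exact: coord_continuous|exact: derivable_coord|].
change (Cka k a V (partial [:: i] (fun x => x 0 j))).
suff -> : partial [:: i] (fun x => x 0 j) = cst (i == j)%:R :> ('rV[R]_p -> R).
  exact: Cka_cst.
by apply/funext => x; exact: partial_coord.
Qed.

Lemma Cka_add k V f g : open V -> Cka k a V f -> Cka k a V g ->
  Cka k a V (fun x => f x + g x).
Proof.
move=> oV; elim: k f g => [f g [cf hf] [cg hg]|k IH f g [cf df pf] [cg dg pg]] /=.
  split=> [x Vx|x Vx]; first exact: (continuousD (cf _ Vx) (cg _ Vx)).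
  have [r r0 [C C0 Hf]] := hf _ Vx; have [s s0 [D D0 Hg]] := hg _ Vx.
  exists (Num.min r s); first by rewrite lt_min r0.
  exists (C + D); first exact: addr_ge0.
  move=> y z; rewrite !lt_min => /andP[yr ys] /andP[zr zs].
  rewrite opprD addrACA (le_trans (ler_normD _ _)) // mulrDl lerD //.
    exact: Hf.
  exact: Hg.
split=> [x Vx|x i Vx|i]; first exact: (continuousD (cf _ Vx) (cg _ Vx)).
  by apply: derivableD; [exact: df|exact: dg].
apply: (@Cka_ext _ _ _ _ _ (fun x => partial [:: i] f x + partial [:: i] g x)) => //.
  by move=> x Vx; rewrite -[RHS]/('D_(row_unit i) (f + g) x) deriveD; [|exact: df|exact: dg].
by apply: IH; [exact: pf|exact: pg].
Qed.

(** Induction on [k] with the product rule; at order 0 the Holder condition uses that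
    both factors are locally bounded. *)
Lemma Cka_mul k V f g : open V -> Cka k a V f -> Cka k a V g ->
  Cka k a V (fun x => f x * g x).
Proof.
move=> oV; elim: k f g => [f g [cf hf] [cg hg]|k IH f g Hf Hg] /=.
  split=> [x Vx|x Vx]; first exact: (continuousM (cf _ Vx) (cg _ Vx)).
  have [r r0 [C C0 Hf]] := hf _ Vx; have [s s0 [D D0 Hg]] := hg _ Vx.
  have [r' r'0 Bf] := continuous_locally_bounded (cf _ Vx).
  have [s' s'0 Bg] := continuous_locally_bounded (cg _ Vx).
  exists (Num.min (Num.min r s) (Num.min r' s')); first by rewrite !lt_min r0 s0 r'0.
  exists (C * (`|g x| + 1) + (`|f x| + 1) * D).
    by rewrite addr_ge0 // mulr_ge0 // addr_ge0.
  move=> y z; rewrite !lt_min => /andP[/andP[yr ys] /andP[yr' ys']] /andP[/andP[zr zs] /andP[zr' zs']].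
  have -> : f y * g y - f z * g z = (f y - f z) * g z + f y * (g y - g z) by ring.
  rewrite (le_trans (ler_normD _ _)) // !normrM mulrDl lerD //.
    by rewrite mulrAC; apply: ler_pM => //; [exact: Hf|exact: Bg].
  by rewrite -mulrA; apply: ler_pM => //; [exact: Bf|exact: Hg].
move: (Hf) (Hg) => [cf df pf] [cg dg pg].
split=> [x Vx|x i Vx|i]; first exact: (continuousM (cf _ Vx) (cg _ Vx)).
  by apply: derivableM; [exact: df|exact: dg].
apply: (@Cka_ext _ _ _ _ _ (fun x => f x * partial [:: i] g x + g x * partial [:: i] f x)) => //.
  by move=> x Vx; rewrite -[RHS]/('D_(row_unit i) (f * g) x) deriveM; [|exact: df|exact: dg].
by apply: Cka_add => //; apply: IH; [exact: CkaSW Hf|exact: pg|exact: CkaSW Hg|exact: pf].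
Qed.

Lemma Cka_sum k V (I : Type) (r : seq I) (P : pred I) (F : I -> 'rV[R]_p -> R) : open V ->
  (forall i, P i -> Cka k a V (F i)) -> Cka k a V (fun x => \sum_(i <- r | P i) F i x).
Proof.
move=> oV HF; elim: r => [|i r IH].
  apply: (@Cka_ext _ _ _ _ _ (cst 0)) (Cka_cst _ _ _) => // x _.
  by rewrite big_nil.
have [Pi|nPi] := boolP (P i); last first.
  by apply: Cka_ext IH => // x _; rewrite big_cons (negbTE nPi).
apply: Cka_ext (Cka_add oV (HF i Pi) IH) => // x _.
by rewrite big_cons Pi.
Qed.

Lemma Cka_scale k V c f : open V -> Cka k a V f -> Cka k a V (fun x => c * f x).
Proof. by move=> oV; apply: Cka_mul => //; exact: Cka_cst. Qed.

Lemma Cka_sub_fun k V f g : open V -> Cka k a V f -> Cka k a V g ->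
  Cka k a V (fun x => f x - g x).
Proof.
move=> oV Hf Hg; apply: Cka_ext (Cka_add oV Hf (Cka_scale (-1) oV Hg)) => // x _.
by rewrite mulN1r.
Qed.

End Exponent.
End Algebra.

Section Composition.
Variables (R : realType) (p q : nat).
Implicit Types (V : set 'rV[R]_p) (W : set 'rV[R]_q) (H : 'rV[R]_p -> 'rV[R]_q).

Lemma continuous_coords H x :
  (forall j, {for x, continuous (fun y => H y 0 j)}) -> {for x, continuous H}.
Proof.
move=> cH; apply/(@cvgrPdist_le _ _ _ (nbhs x)) => e e0.
have h j : \forall y \near x, `|H x 0 j - H y 0 j| <= e.
  by have /cvgrPdist_le := cH j; apply.
have : \forall y \near x, forall j, `|H x 0 j - H y 0 j| <= e by apply: (filter_forall _ h).
apply: (@filterS _ (nbhs x)) => y Hy; apply: norm_rV_le; first exact: ltW.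
by move=> j; have := Hy j; rewrite !mxE.
Qed.

Definition C1_map V H := forall j, Cka 1 0 V (fun x => H x 0 j).

Lemma C1_map_continuous V H x : C1_map V H -> V x -> {for x, continuous H}.
Proof. by move=> HH Vx; apply: continuous_coords => j; exact: Cka_continuous (HH j) Vx. Qed.

Lemma C1_map_differentiable V H x : open V -> C1_map V H -> V x -> differentiable H x.
Proof.
move=> oV HH Vx.
have -> : H = \sum_(j < q) (fun y => H y 0 j *: (row_unit j : 'rV[R]_q)).
  by apply/funext => y; rewrite fct_sumE [LHS]row_sum_delta.
apply: differentiable_sum => j; apply: differentiableZl.
exact: C1_differentiable (HH j).
Qed.

Lemma derive_comp_coord (g : 'rV[R]_q -> R) H x v :
  differentiable H x -> differentiable g (H x) ->
  'D_v (g \o H) x = \sum_j 'D_v (fun y => H y 0 j) x * partial [:: j] g (H x).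
Proof.
move=> dH dg; rewrite deriveE; last exact: differentiable_comp.
rewrite diff_comp //= -(deriveE _ dH) derive_mx; last exact: diff_derivable.
rewrite [X in 'd g _ X]row_sum_delta linear_sum; apply: eq_bigr => j _.
by rewrite linearZ /= !mxE /partial /= (deriveE _ dg).
Qed.

Lemma C1_map_lipschitz V H x : open V -> C1_map V H -> V x ->
  exists2 r, 0 < r & exists2 C, 0 <= C & forall y z,
    `|y - x| < r -> `|z - x| < r -> `|H y - H z| <= C * `|y - z|.
Proof.
move=> oV HH Vx.
have h j : exists rC : R * R, [/\ 0 < rC.1, 0 <= rC.2 & forall y z,
    `|y - x| < rC.1 -> `|z - x| < rC.1 -> `|H y 0 j - H z 0 j| <= rC.2 * `|y - z| ].
  have [_ dh ph] := HH j.
  have [|r r0 [C C0 hr]] := C1_locally_lipschitz oV dh _ Vx.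
    by move=> i y Vy; exact: (ph i).1.
  exists (r, C); split => // y z yr zr; have := hr _ _ yr zr.
  by rewrite powRr1.
have [rC hrC] := choice h.
exists (\big[Num.min/1]_j (rC j).1); first by apply: lt_bigmin => // j _; case: (hrC j).
exists (\sum_j (rC j).2); first by apply: sumr_ge0 => j _; case: (hrC j).
move=> y z yr zr; apply: norm_rV_le.
  by rewrite mulr_ge0 // sumr_ge0 // => j _; case: (hrC j).
move=> j; rewrite !mxE; have [_ _ hj] := hrC j.
apply: le_trans (hj _ _ _ _) _.
- by apply: lt_le_trans yr _; exact: bigmin_le_cond.
- by apply: lt_le_trans zr _; exact: bigmin_le_cond.
rewrite ler_wpM2r // (bigD1 j) //= lerDl sumr_ge0 // => i _.
by case: (hrC i).
Qed.

(** [C1_map] is assumed apart from the regularity of [H], so that the induction on [k],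
    which differentiates only once at a time, reaches order 0 with [H] still locally
    Lipschitz. *)
Lemma Cka_comp1 k a V W H g : 0 <= a <= 1 -> open V -> open W ->
  (forall x, V x -> W (H x)) -> C1_map V H ->
  (forall j, Cka k a V (fun x => H x 0 j)) -> Cka k a W g ->
  Cka k a V (g \o H).
Proof.
move=> ha oV oW VW H1; elim: k g => [g HH [cg hg]|k IH g HH Hg].
  split=> [x Vx|x Vx].
    by apply: continuous_comp; [exact: C1_map_continuous H1 _|exact: cg (VW _ Vx)].
  have [r r0 [C C0 hr]] := hg _ (VW _ Vx).
  have [s s0 [D D0 hs]] := C1_map_lipschitz oV H1 Vx.
  have [t t0 ht] := continuous_norm_ball (C1_map_continuous H1 Vx) r0.
  exists (Num.min s t); first by rewrite lt_min s0.
  exists (C * D `^ a); first by rewrite mulr_ge0 // powR_ge0.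
  move=> y z; rewrite !lt_min => /andP[ys yt] /andP[zs zt] /=.
  apply: le_trans (hr _ _ (ht _ yt) (ht _ zt)) _; rewrite -mulrA ler_wpM2l //.
  rewrite -powRM //; apply: ge0_ler_powR; rewrite ?nnegrE ?mulr_ge0 //.
    by case/andP: ha.
  exact: hs.
have [cg dg pg] := Hg.
have Hg1 : Cka 1 0 W g by apply: Cka_le (Cka0W Hg); rewrite ?lexx ?ler01.
have dH x : V x -> differentiable H x by exact: C1_map_differentiable.
have dgH x : V x -> differentiable g (H x) by move=> Vx; exact: C1_differentiable (VW _ Vx) Hg1.
split=> [x Vx|x i Vx|i].
- by apply: continuous_comp; [exact: C1_map_continuous H1 _|exact: cg (VW _ Vx)].
- by apply: diff_derivable; apply: differentiable_comp; [exact: dH|exact: dgH].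
apply: (@Cka_ext _ _ _ _ _
  (fun x => \sum_j partial [:: i] (fun y => H y 0 j) x * (partial [:: j] g \o H) x)) => //.
  by move=> x Vx; rewrite -[RHS]/('D_(row_unit i) (g \o H) x) derive_comp_coord //; [exact: dH|exact: dgH].
apply: Cka_sum => // j _; apply: Cka_mul => //; first by case: (HH j) => _ _; exact.
by apply: IH => [j'|]; [exact: CkaSW (HH j')|exact: pg].
Qed.

Lemma Ck_C1_map k a V H : (1 <= k)%N -> open V ->
  (forall j, Cka k a V (fun x => H x 0 j)) -> C1_map V H.
Proof.
by move=> k1 oV HH j; apply: Cka_le (Cka0W (HH j)); rewrite ?lexx ?ler01.
Qed.

Lemma Cka_comp k a V W H g : (1 <= k)%N -> 0 <= a <= 1 -> open V -> open W ->
  (forall x, V x -> W (H x)) ->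
  (forall j, Cka k a V (fun x => H x 0 j)) -> Cka k a W g ->
  Cka k a V (g \o H).
Proof. by move=> k1 ha oV oW VW HH; apply: Cka_comp1 => //; exact: Ck_C1_map HH. Qed.

End Composition.

(** * Words of partial derivatives and the chain rule *)

Section Words.
Variables (R : realType) (p : nat).
Implicit Types (V W : set 'rV[R]_p) (f g : 'rV[R]_p -> R) (a b : R) (k : nat)
  (s t : seq 'I_p).

Lemma partial_cat s t f : partial (s ++ t) f = partial s (partial t f).
Proof. by rewrite /partial foldr_cat. Qed.

Lemma partial_rcons s i f : partial (rcons s i) f = partial s (partial [:: i] f).
Proof. by rewrite -cats1 partial_cat. Qed.

Lemma partial_ext V s f g x : open V -> (forall y, V y -> f y = g y) -> V x ->
  partial s f x = partial s g x.
Proof.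
move=> oV fg; elim: s x => [|i s IH] x Vx; first exact: fg.
by apply: near_eq_derive; apply: (open_near oV Vx) => y; exact: IH.
Qed.

Lemma Cka_partial k a V f s : (size s <= k)%N -> Cka k a V f ->
  Cka (k - size s) a V (partial s f).
Proof.
elim/last_ind: s k f => [|s i IH] k f; first by rewrite subn0.
rewrite size_rcons partial_rcons; case: k => // k; rewrite ltnS subSS => sk [_ _ pf].
by apply: IH => //; exact: pf.
Qed.

(** Bridge between the recursive classes and the conditions on all iterated partial
    derivatives. *)
Lemma CkaP k a V f : Cka k a V f <->
  Ck_on k V f /\ forall s, size s = k -> locally_holder a V (partial s f).
Proof.
split=> [Hf|].
  split=> [s|s sk]; last first.
    by have := @Cka_partial k a V f s; rewrite sk leqnn subnn => /(_ isT Hf)[].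
  split=> [sk x Vx|sk x i Vx]; first exact: Cka_continuous (Cka_partial sk Hf) Vx.
  have := Cka_partial (ltnW sk) Hf.
  by rewrite -subnSK // => -[_ d _]; exact: d.
elim: k f => [f [H Hh]|k IH f [H Hh]] /=.
  by split; [exact: (H [::]).1|exact: (Hh [::])].
split; [exact: (H [::]).1|by move=> x i; exact: (H [::]).2|].
move=> i; apply: IH; split=> [s|s sk]; rewrite -partial_rcons; last first.
  by apply: Hh; rewrite size_rcons sk.
by have := H (rcons s i); rewrite size_rcons !ltnS.
Qed.

Lemma Cka_partial_derivable k a V f s i x : (size s < k)%N -> Cka k a V f -> V x ->
  derivable (partial s f) x (row_unit i).
Proof. by move=> sk /CkaP[/(_ s)[_ H] _] Vx; exact: H. Qed.

Lemma partial_add V k a s f g x : open V -> (size s <= k)%N ->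
  Cka k a V f -> Cka k a V g -> V x ->
  partial s (fun y => f y + g y) x = partial s f x + partial s g x.
Proof.
move=> oV; elim: s x => [|i s IH] x // sk Hf Hg Vx.
have df := Cka_partial_derivable (i := i) sk Hf Vx.
have dg := Cka_partial_derivable (i := i) sk Hg Vx.
rewrite /= -deriveD //.
by apply: near_eq_derive; apply: (open_near oV Vx) => y Vy; exact: IH (ltnW sk) Hf Hg Vy.
Qed.

Lemma partial_scale V k a s c f x : open V -> (size s <= k)%N ->
  Cka k a V f -> V x -> partial s (fun y => c * f y) x = c * partial s f x.
Proof.
move=> oV; elim: s x => [|i s IH] x // sk Hf Vx.
have df := Cka_partial_derivable (i := i) sk Hf Vx.
rewrite /= -[RHS]/(c *: ('D_(row_unit i) (partial s f) x)) -deriveZ //.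
by apply: near_eq_derive; apply: (open_near oV Vx) => y Vy; exact: IH (ltnW sk) Hf Vy.
Qed.

Lemma derivable_bigsum (I : Type) (r : seq I) (F : I -> 'rV[R]_p -> R) x v :
  (forall i, derivable (F i) x v) ->
  derivable (fun y => \sum_(i <- r) F i y) x v /\
  'D_v (fun y => \sum_(i <- r) F i y) x = \sum_(i <- r) 'D_v (F i) x.
Proof.
move=> dF; elim: r => [|i r [d1 d2]].
  rewrite big_nil (_ : (fun y => _) = cst 0); last by apply/funext => y; rewrite big_nil.
  by split; [exact: derivable_cst|exact: derive_cst].
rewrite big_cons (_ : (fun y => _) = F i + (fun y => \sum_(i <- r) F i y)); last first.
  by apply/funext => y; rewrite big_cons.
by split; [exact: (derivableD (dF i) d1)|rewrite (deriveD (dF i) d1) d2].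
Qed.

Lemma shift_derive f (w x v : 'rV[R]_p) :
  (derivable f (x + w) v -> derivable (fun z => f (z + w)) x v) /\
  'D_v (fun z => f (z + w)) x = 'D_v f (x + w).
Proof.
rewrite /derivable /derive.
set g1 := fun h => h^-1 *: _; set g2 := fun h => h^-1 *: _.
suff -> : g2 = g1 by [].
by apply/funext => h; rewrite /g1 /g2 /= addrA.
Qed.

(** Symmetry of second derivatives: both mixed derivatives are approximated by
    the same second difference quotient. *)
Lemma partial_swap2 V f i j x : open V -> Cka 2 0 V f -> V x ->
  partial [:: i; j] f x = partial [:: j; i] f x.
Proof.
move=> oV Hf Vx; have [r r0 rV] := open_norm_ball oV Vx.
have sub2 (l m : 'I_p) (h t t' : R) : 0 < h -> h + h < r -> Num.min 0 h <= t <= Num.max 0 h ->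
    Num.min 0 h <= t' <= Num.max 0 h ->
    `|(x + t *: row_unit l + t' *: row_unit m : 'rV[R]_p) - x| <= h + h.
  move=> h0 hr; rewrite min_l ?max_r ?(ltW h0) // => /andP[a1 a2] /andP[b1 b2].
  rewrite -[x + _ + _]addrA [x + _]addrC addrK (le_trans (ler_normD _ _)) //.
  have nu (l' : 'I_p) : `|(row_unit l' : 'rV[R]_p)| <= 1.
    by apply: norm_rV_le => // k; rewrite !mxE; case: (_ && _); rewrite ?normr1 ?normr0.
  by rewrite lerD // normrZ ger0_norm // -[leRHS]mulr1 ler_pM // normr_ge0.
have [cf df pf] := Hf.
have key (l m : 'I_p) (h : R) : 0 < h -> h + h < r -> exists z, `|z - x| <= h + h /\
   f (x + h *: row_unit l + h *: row_unit m) - f (x + h *: row_unit l)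
     - (f (x + h *: row_unit m) - f x) = h * (h * partial [:: m; l] f z).
  move=> h0 hr; have h00 : Num.min 0 h <= 0 <= Num.max 0 h.
    by rewrite min_l ?max_r ?lexx ?(ltW h0).
  have h0h : Num.min 0 h <= h <= Num.max 0 h.
    by rewrite min_l ?max_r ?lexx ?(ltW h0).
  pose g z := f (z + h *: row_unit m) - f z.
  have inV (t t' : R) : Num.min 0 h <= t <= Num.max 0 h -> Num.min 0 h <= t' <= Num.max 0 h ->
      V (x + t *: row_unit l + t' *: row_unit m).
    by move=> ht ht'; apply: rV; apply: le_lt_trans (hr); exact: (sub2 l m h _ _ h0 hr).
  have inV1 (t : R) : Num.min 0 h <= t <= Num.max 0 h -> V (x + t *: row_unit l).
    by move=> ht; have := inV t 0 ht h00; rewrite scale0r addr0.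
  have dg (t : R) : Num.min 0 h <= t <= Num.max 0 h ->
     derivable g (x + t *: row_unit l) (row_unit l).
    move=> ht; apply: derivableB; last exact/df/inV1.
    by apply: (shift_derive _ _ _ _).1; apply/df/inV.
  have [t [ht]] := mvt_coord dg.
  rewrite {1 2}/g => E.
  have {}E : f (x + h *: row_unit l + h *: row_unit m) - f (x + h *: row_unit l)
     - (f (x + h *: row_unit m) - f x) = h * (partial [:: l] f (x + t *: row_unit l + h *: row_unit m)
      - partial [:: l] f (x + t *: row_unit l)).
    rewrite E deriveB; last 2 first.
    - by apply: (shift_derive _ _ _ _).1; apply/df/inV.
    - exact/df/inV1.
    by rewrite (shift_derive _ _ _ _).2.
  have [|t' [ht' E']] := @mvt_coord R p (partial [:: l] f) (x + t *: row_unit l) m h.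
    by move=> t' ht'; have [_ + _] := pf l; apply; exact: inV.
  exists (x + t *: row_unit l + t' *: row_unit m); split; first exact: (sub2 l m h _ _ h0 hr).
  by rewrite E E'.
have Cij (l m : 'I_p) : {for x, continuous (partial [:: l; m] f)}.
  by have [_ _ pm] := pf m; exact: (pm l).1 _ Vx.
have swap4 (b1 b2 b3 b4 : R) : b1 - b2 - (b3 - b4) = b1 - b3 - (b2 - b4) by ring.
have close (c1 c2 c3 e : R) : `|c1 - c2| <= e / 2 -> `|c1 - c3| <= e / 2 -> `|c3 - c2| <= e.
  by rewrite !ler_norml => /andP[? ?] /andP[? ?]; apply/andP; split; lra.
(* at x, both mixed derivatives lie within e / 2 of a common difference quotient *)
apply/eqP; rewrite -subr_eq0 -normr_le0; apply/ler_addgt0Pl => e e0; rewrite addr0.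
have e2 : 0 < e / 2 by rewrite divr_gt0.
have [s1 s10 H1] := continuous_norm_ballR (Cij i j) e2.
have [s2 s20 H2] := continuous_norm_ballR (Cij j i) e2.
pose h := Num.min r (Num.min s1 s2) / 4.
have m0 : 0 < Num.min r (Num.min s1 s2) by rewrite !lt_min r0 s10.
have h0 : 0 < h by rewrite divr_gt0.
have hm : h + h < Num.min r (Num.min s1 s2) by rewrite /h; lra.
have := hm; rewrite !lt_min => /and3P[hr hs1 hs2].
have [z [zh Ez]] := key j i h h0 hr; have [z' [z'h Ez']] := key i j h h0 hr.
have E : partial [:: i; j] f z = partial [:: j; i] f z'.
  apply: (mulfI (lt0r_neq0 h0)); apply: (mulfI (lt0r_neq0 h0)).
  apply: etrans (esym Ez) _; apply: etrans _ Ez'.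
  have -> : x + h *: row_unit j + h *: row_unit i = x + h *: row_unit i + h *: row_unit j.
    exact: addrAC.
  exact: swap4.
have := H1 _ (le_lt_trans zh hs1); have := H2 _ (le_lt_trans z'h hs2).
by rewrite E => /ltW A /ltW B; exact: close A B.
Qed.

(** Schwarz for two neighbouring letters anywhere in a word: the prefix differentiates
    an identity between functions, and the suffix only changes the function. *)
Lemma partial_swap V k a f (u v : seq 'I_p) i j x : open V ->
  (size (u ++ [:: i, j & v]) <= k)%N -> Cka k a V f -> V x ->
  partial (u ++ [:: i, j & v]) f x = partial (u ++ [:: j, i & v]) f x.
Proof.
move=> oV; rewrite size_cat /= => sk Hf Vx.
rewrite (partial_cat u) (partial_cat u [:: j, i & v]); apply: (partial_ext _ oV _ Vx) => y Vy.
rewrite (partial_cat [:: i; j] v) (partial_cat [:: j; i] v); apply: (partial_swap2 _ _ oV _ Vy).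
have sv : (size v <= k)%N by apply: leq_trans sk; apply: leq_trans (leq_addl (size u) _); exact/leqW/leqW.
apply: Cka_le (Cka0W (Cka_partial sv Hf)); rewrite ?lexx ?ler01 //.
by rewrite leq_subRL // addn2; apply: leq_trans sk; exact: leq_addl.
Qed.

End Words.

(** The action of the linear substitution [B] on multilinear forms, a form
    being given by its values [T] on words of basis vectors. *)
Fixpoint tens (K : pzSemiRingType) (p q : nat) (B : 'I_p -> 'I_q -> K) (s : seq 'I_p)
    (T : seq 'I_q -> K) : K :=
  if s is i :: s' then \sum_j B i j * tens B s' (fun u => T (j :: u)) else T [::].

Section Chain.
Variables (R : realType) (p q : nat).
Implicit Types (V : set 'rV[R]_p) (W : set 'rV[R]_q) (H : 'rV[R]_p -> 'rV[R]_q).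

Definition jac H (z : 'rV[R]_p) (i : 'I_p) (j : 'I_q) : R :=
  partial [:: i] (fun y => H y 0 j) z.

(** Higher-order chain rule.  Only the shape matters later on: the coefficients
    depend on [H] alone, and the terms of highest order carry the tensor power
    of the first derivative. *)
Lemma chain_expansion k a V H s : open V -> 0 <= a <= 1 -> (size s <= k)%N ->
  (forall j, Cka k a V (fun x => H x 0 j)) ->
  exists (I : finType) (co : I -> 'rV[R]_p -> R) (wd : I -> seq 'I_q),
  [/\ forall i, (size (wd i) <= size s)%N,
      forall i, Cka (k - size s) a V (co i),
      forall W V' g z, open W -> open V' -> V' `<=` V -> (forall x, V' x -> W (H x)) ->
        Cka k 0 W g -> V' z ->
        partial s (g \o H) z = \sum_i co i z * partial (wd i) g (H z) &
      forall z (T : seq 'I_q -> R), V z ->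
        \sum_(i | size (wd i) == size s) co i z * T (wd i) = tens (jac H z) s T].
Proof.
move=> oV ha + HH; elim: s => [_|i s IH sk].
  exists unit, (fun _ => cst 1), (fun _ => [::]); split => //.
  - by move=> _; exact: Cka_cst.
  - by move=> W V' g z oW oV' V'V VW Hg Vz; rewrite (bigD1 tt) //= big1 ?addr0 ?mul1r //; case.
  - by move=> z T Vz; rewrite (bigD1 tt) //= big1 ?addr0 ?mul1r //; case.
have [I [co [wd [szw Hco Hf Ht]]]] := IH (ltnW sk).
have k1 : (1 <= k)%N by exact: leq_trans sk.
have kS : (k - size s = (k - size (i :: s)).+1)%N by rewrite subnSK.
pose co' (m : I + I * 'I_q) z := match m with
  | inl m => partial [:: i] (co m) z
  | inr (m, j) => partial [:: i] (fun y => H y 0 j) z * co m z end.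
pose wd' (m : I + I * 'I_q) := match m with inl m => wd m | inr (m, j) => j :: wd m end.
have HC1 : C1_map V H by exact: Ck_C1_map HH.
have dco m z : V z -> derivable (co m) z (row_unit i).
  by move=> Vz; have := Hco m; rewrite kS => -[_ + _]; apply.
exists (I + I * 'I_q)%type, co', wd'; split.
- by case=> [m|[m j]] /=; rewrite ?ltnS //; exact: leqW.
- have k1E : (k = k.-1.+1)%N by rewrite prednK.
  case=> [m|[m j]]; first by have := Hco m; rewrite kS => -[_ _]; exact.
  apply: Cka_mul => //.
    have := HH j; rewrite {1}k1E => -[_ _ /(_ i)]; apply: Cka_le => //.
    by rewrite /= -subn1 leq_sub2l.
  by have := Hco m; rewrite kS; exact: CkaSW.
- move=> W V' g z oW oV' V'V VW Hg V'z; have Vz := V'V _ V'z.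
  have dg m : Cka 1 0 W (partial (wd m) g).
    have szk : (size (wd m) < k)%N by apply: leq_ltn_trans (szw m) _.
    by apply: Cka_le (Cka_partial (ltnW szk) Hg); rewrite ?lexx ?ler01 ?subn_gt0.
  have dgH m : differentiable (partial (wd m) g) (H z).
    by apply: C1_differentiable (dg m) => //; exact: VW.
  have dH : differentiable H z by exact: C1_map_differentiable Vz.
  have dm m : derivable (partial (wd m) g \o H) z (row_unit i).
    by apply: diff_derivable; exact: differentiable_comp.
  (* the new letter differentiates the coefficient or the factor partial (wd m) g \o H
     *)
  transitivity ('D_(row_unit i) (fun y => \sum_m (co m * (partial (wd m) g \o H)) y) z).
    by apply: near_eq_derive; apply: (open_near oV' V'z) => y Vy; exact: (Hf W V' g y oW oV' V'V VW Hg Vy).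
  rewrite (derivable_bigsum _ _).2; last by move=> m; apply: derivableM => //; exact: dco.
  pose F m j := co' (inr (m, j)) z * partial (j :: wd m) g (H z).
  rewrite big_sumType /= [X in _ = _ + X](eq_bigr (fun mj : I * 'I_q => F mj.1 mj.2)); last by case.
  rewrite -(pair_bigA _ F) /=.
  rewrite -big_split /=; apply: eq_bigr => m _.
  rewrite deriveM //; last exact: dco.
  rewrite [LHS]addrC; congr (_ + _); first exact: mulrC.
  rewrite derive_comp_coord // -[LHS]/(_ * _) mulr_sumr; apply: eq_bigr => j _.
  by rewrite /F /= mulrA [co m z * _]mulrC.
- move=> z T Vz; rewrite big_sumType /= big_pred0 ?add0r; last first.
    by move=> m; apply/negbTE; rewrite neq_ltn ltnS szw.
  rewrite (eq_bigl (fun m : I * 'I_q => (size (wd m.1) == size s) && true)); last first.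
    by case=> m j /=; rewrite eqSS andbT.
  pose F m j := co' (inr (m, j)) z * T (j :: wd m).
  rewrite (eq_bigr (fun mj : I * 'I_q => F mj.1 mj.2)); last by case.
  rewrite -(pair_big (fun m => size (wd m) == size s) xpredT F) /= exchange_big /=.
  apply: eq_bigr => j _; rewrite -Ht // mulr_sumr.
  by apply: eq_bigr => m _; rewrite mulrA.
Qed.

End Chain.

(** * Complex modulus and tensor powers of a matrix *)

Section ComplexModulus.
Variable R : realType.
Implicit Types (x y z : R[i]) (r : R).

Lemma normc_ge0 x : 0 <= normc x.
Proof. by case: x => a b; exact: sqrtr_ge0. Qed.

Lemma normc_realE r : normc r%:C%C = `|r|.
Proof. by rewrite /normc /= expr0n addr0 sqrtr_sqr. Qed.

Lemma normc_Re x : `|complex.Re x| <= normc x.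
Proof.
case: x => a b /=; rewrite -sqrtr_sqr ler_sqrt ?lerDl ?sqr_ge0 //.
by rewrite addr_ge0 ?sqr_ge0.
Qed.

Lemma normc_Im x : `|complex.Im x| <= normc x.
Proof.
case: x => a b /=; rewrite -sqrtr_sqr ler_sqrt ?lerDr ?sqr_ge0 //.
by rewrite addr_ge0 ?sqr_ge0.
Qed.

Lemma normc_le_ReIm x : normc x <= `|complex.Re x| + `|complex.Im x|.
Proof.
have -> : x = (complex.Re x)%:C%C + (complex.Im x)%:C%C * Complex 0 1.
  by case: x => a b; apply/eqP; rewrite eq_complex /=; apply/andP; split; apply/eqP; ring.
apply: le_trans (le_normcD _ _) _; rewrite normcM !normc_realE.
have -> : normc (Complex (0 : R) 1) = 1 by rewrite /normc expr0n expr1n add0r sqrtr1.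
by case: x => a b /=; rewrite mulr1 !(mulr0, mulr1, mul0r, addr0, subr0, add0r).
Qed.

Lemma normc_sum (I : Type) (r : seq I) (P : pred I) (F : I -> R[i]) :
  normc (\sum_(i <- r | P i) F i) <= \sum_(i <- r | P i) normc (F i).
Proof.
elim/big_rec2: _ => [|i y z _ H]; first by rewrite normc0.
by apply: le_trans (le_normcD _ _) _; rewrite lerD2l.
Qed.

Lemma normc_dist x y : normc (x - y) = normc (y - x).
Proof. by rewrite -normcN opprB. Qed.

Lemma normc_gt0 x : x != 0 -> 0 < normc x.
Proof.
move=> x0; rewrite lt_neqAle normc_ge0 andbT eq_sym.
by apply: contra x0 => /eqP /eq0_normc ->.
Qed.

End ComplexModulus.

Section TensorLinear.
Variables (K : comNzRingType) (p q : nat).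
Implicit Types (B : 'I_p -> 'I_q -> K) (T : seq 'I_q -> K) (s : seq 'I_p).

Lemma tens_ext B s T T' : (forall u, size u = size s -> T u = T' u) ->
  tens B s T = tens B s T'.
Proof.
elim: s T T' => [|i s IH] T T' E /=; first exact: E.
by apply: eq_bigr => j _; congr (_ * _); apply: IH => u us; apply: E; rewrite /= us.
Qed.

Lemma tens_sum B s (I : finType) (P : pred I) (c : I -> K) (T : I -> seq 'I_q -> K) :
  tens B s (fun u => \sum_(i | P i) c i * T i u) = \sum_(i | P i) c i * tens B s (T i).
Proof.
elim: s T => [//|i s IH] T /=.
under eq_bigr do rewrite IH mulr_sumr.
rewrite exchange_big; apply: eq_bigr => l _; rewrite mulr_sumr.
by apply: eq_bigr => j _; rewrite mulrCA.
Qed.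

Lemma tens_scale B s c T : tens B s (fun u => c * T u) = c * tens B s T.
Proof.
elim: s T => [//|i s IH] T /=; rewrite mulr_sumr.
by apply: eq_bigr => j _; rewrite IH mulrCA.
Qed.

Lemma tens_add B s T T' : tens B s (fun u => T u + T' u) = tens B s T + tens B s T'.
Proof.
elim: s T T' => [//|i s IH] T T' /=; rewrite -big_split /=.
by apply: eq_bigr => j _; rewrite IH mulrDr.
Qed.

(** Invariance under adjacent transpositions of the letters, on words of length
    [l]: the form in which Schwarz's theorem delivers the symmetry of higher
    derivatives. *)
Definition symmetric_form l T := forall u v i j,
  size (u ++ [:: i, j & v]) = l -> T (u ++ [:: i, j & v]) = T (u ++ [:: j, i & v]).

Lemma symmetric_form_cons l T i : symmetric_form l.+1 T -> symmetric_form l (fun u => T (i :: u)).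
Proof. by move=> H u v a b /= ul; apply: (H (i :: u)); rewrite /= ul. Qed.

End TensorLinear.

Lemma tens_symmetric (K : comNzRingType) (p q : nat) (B : 'I_p -> 'I_q -> K) l T :
  symmetric_form l T -> symmetric_form l (fun s => tens B s T).
Proof.
move=> H u; elim: u l T H => [|a u IH] l T H v i j /=.
  move=> vl; under eq_bigr do rewrite mulr_sumr.
  under [RHS]eq_bigr do rewrite mulr_sumr.
  rewrite exchange_big; apply: eq_bigr => b _; apply: eq_bigr => c _.
  rewrite mulrCA; congr (_ * (_ * _)); apply: tens_ext => w wv.
  by apply: (H [::]); rewrite /= wv.
case: l H => // l H [ul]; apply: eq_bigr => b _; congr (_ * _).
by apply: IH ul; exact: symmetric_form_cons.
Qed.

Section TensorSpectrum.
Variables (K : fieldType) (n : nat) (A : 'M[K]_n.+1).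
Implicit Types (M N : 'M[K]_n.+1) (T : seq 'I_n.+1 -> K) (s : seq 'I_n.+1).

(** Cayley-Hamilton is applied to one slot of a form at a time; [slot1] lets a
    matrix act on the first argument alone. *)
Definition slot1 M T s : K :=
  if s is i :: s' then \sum_j M i j * T (j :: s') else 0.

Lemma slot1_mul M N T s : slot1 (M *m N) T s = slot1 M (slot1 N T) s.
Proof.
case: s => //= i s; under eq_bigr do rewrite mxE mulr_suml.
under [RHS]eq_bigr do rewrite mulr_sumr.
by rewrite exchange_big; apply: eq_bigr => j _; apply: eq_bigr => l _; rewrite mulrA.
Qed.

Lemma slot1_1 T i s : slot1 1%:M T (i :: s) = T (i :: s).
Proof.
rewrite /= (bigD1 i) //= mxE eqxx mul1r big1 ?addr0 // => j ji.
by rewrite mxE eq_sym (negbTE ji) mul0r.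
Qed.

Lemma slot1_subC M x T i s :
  slot1 (M - x%:M) T (i :: s) = slot1 M T (i :: s) - x * T (i :: s).
Proof.
rewrite -[in x * _](slot1_1 T i s) /= mulr_sumr -sumrB; apply: eq_bigr => l _.
rewrite !mxE mulrBl mulrA; congr (_ - _ * _).
by case: (i == l); rewrite ?mulr1 ?mulr0.
Qed.

(** Keeps the eigenvalue equation of a form when a matrix acts on one of its slots. *)
Lemma tens_slot1 M T i s : A *m M = M *m A ->
  tens A (i :: s) (slot1 M T) = slot1 M (fun u => tens A u T) (i :: s).
Proof.
move=> AM.
have -> : tens A (i :: s) (slot1 M T) =
    slot1 (A *m M) (fun u => if u is j :: u' then tens A u' (fun v => T (j :: v)) else 0) (i :: s).
  by rewrite slot1_mul /=; apply: eq_bigr => j _; rewrite tens_sum.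
by rewrite AM slot1_mul.
Qed.

(** The product of all factors [A - x] kills a nonzero form; the last partial
    product that does not kill it yields an eigenform of [slot1 A]. *)
Lemma slot1_eigen (r : seq K) (L : nat) T :
  (exists i s, size s = L /\ T (i :: s) != 0) ->
  (forall i s, size s = L -> slot1 (foldr (fun x M => (A - x%:M) *m M) 1%:M r) T (i :: s) = 0) ->
  exists M x, [/\ x \in r, A *m M = M *m A,
     exists i s, size s = L /\ slot1 M T (i :: s) != 0 &
     forall i s, size s = L -> slot1 A (slot1 M T) (i :: s) = x * slot1 M T (i :: s)].
Proof.
move=> [i0 [s0 [s0L T0]]]; elim: r => [/(_ i0 _ s0L)|x r IH H].
  by rewrite slot1_1 => T0'; rewrite T0' eqxx in T0.
set M := foldr _ _ _ in IH.
have [Z|/existsNP[i /existsNP[s /not_implyP[sL /eqP Ms]]]] :=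
    pselect (forall i s, size s = L -> slot1 M T (i :: s) = 0).
  by have [M' [y [yr ? ? ?]]] := IH Z; exists M', y; split; rewrite // in_cons yr orbT.
exists M, x; split; first exact: mem_head.
- rewrite /M; elim: (r) => [|y r' IHr] /=; first by rewrite mulmx1 mul1mx.
  have c : A *m (A - y%:M) = (A - y%:M) *m A by rewrite mulmxBr mulmxBl scalar_mxC.
  by rewrite mulmxA c -mulmxA IHr mulmxA.
- by exists i, s.
move=> j u uL; apply/eqP; rewrite -subr_eq0 -slot1_subC -slot1_mul.
by rewrite (H j u uL).
Qed.

(** The actions on different slots commute, so an eigenform of the [l]-th tensor
    power can be made an eigenform slot by slot; each slot contributes one
    eigenvalue of [A] to the product. *)
Lemma tens_eigenvalue (sigma : 'I_n.+1 -> K) l T z :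
  char_poly A = \prod_i ('X - (sigma i)%:P) ->
  (exists s, size s = l /\ T s != 0) ->
  (forall s, size s = l -> tens A s T = z * T s) ->
  exists m : 'I_n.+1 -> nat, (\sum_i m i = l)%N /\ z = \prod_i sigma i ^+ m i.
Proof.
move=> chA; elim: l T z => [|l IH] T z [s [sl T0]] HT.
  exists (fun _ => 0%N); split; first by rewrite big1.
  rewrite big1 => [|i _]; last by rewrite expr0.
  have := HT _ sl; move: T0; case: s sl => //= _ T0.
  by rewrite -{1}[T [::]]mul1r => /(mulIf T0).
pose rI := [seq sigma i | i <- index_enum 'I_n.+1].
have CH : foldr (fun x M => (A - x%:M) *m M) 1%:M rI = 0.
  rewrite -(Cayley_Hamilton A) chA rmorph_prod /= /rI.
  elim: (index_enum _) => [|i r IHr] /=; first by rewrite big_nil.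
  by rewrite big_cons IHr rmorphB /= horner_mx_X horner_mx_C.
have [||M [x [xs AM [i [u [ul MT]]] Ex]]] := @slot1_eigen rI l T.
- by case: s sl T0 => //= i s [sl] T0; exists i, s.
- by move=> i u _; rewrite CH /= big1 // => j _; rewrite mxE mul0r.
set T' := slot1 M T in MT Ex.
have HT' j v : size v = l -> tens A (j :: v) T' = z * T' (j :: v).
  move=> vl; rewrite tens_slot1 //= mulr_sumr; apply: eq_bigr => b _.
  by rewrite mulrCA -[in RHS]HT //= vl.
have HT'' v : size v = l -> x * tens A v (fun w => T' (i :: w)) = z * T' (i :: v).
  move=> vl; rewrite -HT' //= -tens_scale -tens_sum; apply: tens_ext => w wv.
  by rewrite -Ex // wv.
have /mapP[j _ xj] := xs.
(* a zero eigenvalue in one slot forces z = 0, and any word using it will do *)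
have [x0|x0] := eqVneq x 0.
  exists (fun i => (l.+1 * (i == j))%N); split.
    by rewrite -big_distrr /= (bigD1 j) //= eqxx big1 ?muln1 // => b /negbTE ->.
  have /eqP := HT'' _ ul; rewrite x0 mul0r eq_sym mulf_eq0 (negbTE MT) orbF => /eqP ->.
  by rewrite (bigD1 j) //= eqxx muln1 -xj x0 expr0n mul0r.
have [||m [ml zm]] := IH (fun w => T' (i :: w)) (z / x).
- by exists u.
- by move=> v vl; rewrite mulrAC -HT'' // mulrC mulKf.
exists (fun i => (m i + (i == j))%N); split.
  by rewrite big_split /= ml (bigD1 j) //= eqxx big1 ?addn1 // => b /negbTE ->.
rewrite -[z](divfK x0) zm; under [RHS]eq_bigr do rewrite exprD.
rewrite big_split /=; congr (_ * _).
by rewrite (bigD1 j) //= eqxx expr1 big1 ?mulr1 // => b /negbTE ->.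
Qed.

End TensorSpectrum.

Section TensorSolve.
Variables (K : fieldType) (n : nat) (A : 'I_n -> 'I_n -> K).

(** Injectivity gives surjectivity, forms of degree [l] being vectors indexed by the
    words of length [l]. *)
Lemma tens_solve l z :
  (forall T, (forall s, size s = l -> tens A s T = z * T s) -> forall s, size s = l -> T s = 0) ->
  forall Y : seq 'I_n -> K, exists T, forall s, size s = l -> tens A s T - z * T s = Y s.
Proof.
move=> inj Y; pose N := #|{: l.-tuple 'I_n}|.
pose form (c : 'rV[K]_N) s : K :=
  if insub s is Some t then c 0 (enum_rank (t : l.-tuple 'I_n)) else 0.
have form_lin a c d s : form (a *: c + d) s = a * form c s + form d s.
  by rewrite /form; case: insubP => [t _ _|_]; rewrite ?mxE ?mulr0 ?addr0.
pose f (c : 'rV[K]_N) : 'rV[K]_N :=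
  \row_k (tens A (enum_val k : l.-tuple 'I_n) (form c) - z * form c (enum_val k : l.-tuple 'I_n)).
have f_lin : linear f.
  move=> a c d; apply/rowP => k; rewrite !mxE form_lin.
  rewrite (tens_ext _ (T' := fun u => a * form c u + form d u)); last by move=> u _; exact: form_lin.
  by rewrite tens_add tens_scale; ring.
pose F : {linear 'rV[K]_N -> 'rV[K]_N} := HB.pack f (GRing.isLinear.Build K _ _ _ f f_lin).
have fE (t : l.-tuple 'I_n) c : f c 0 (enum_rank t) = tens A t (form c) - z * form c t.
  by rewrite mxE enum_rankK.
have free : row_free (lin1_mx F).
  rewrite -kermx_eq0; apply/eqP/row_matrixP => i; rewrite row0.
  set c := row i _.
  have fc0 : f c = 0 by rewrite -[f c]/(F c) -mul_rV_lin1 -row_mul mulmx_ker row0.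
  have Hc s : size s = l -> form c s = 0.
    apply: inj => {}s /eqP sl; apply/eqP; rewrite -subr_eq0; apply/eqP.
    by rewrite -(fE (Tuple sl)) fc0 mxE.
  apply/rowP => k; rewrite [RHS]mxE; have := Hc (enum_val k : l.-tuple 'I_n).
  by rewrite size_tuple => /(_ erefl); rewrite /form valK enum_valK.
have U : lin1_mx F \in unitmx by rewrite -row_free_unit.
pose y : 'rV[K]_N := \row_k Y (enum_val k : l.-tuple 'I_n).
exists (form (y *m invmx (lin1_mx F))) => s /eqP sl.
rewrite -(fE (Tuple sl)) -[f _]/(F _) -mul_rV_lin1 mulmxKV // mxE.
by rewrite enum_rankK.
Qed.

End TensorSolve.

(** * Simple eigenvalues and growth of matrix powers *)

Section SimpleEigenvalue.
Variables (K : fieldType).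

Lemma char_poly_conj n (B P : 'M[K]_n) : P \in unitmx ->
  char_poly (invmx P *m B *m P) = char_poly B.
Proof.
move=> Pu; rewrite /char_poly /char_poly_mx.
have Pu' : map_mx (@polyC K) P \in unitmx by rewrite map_unitmx.
have -> : 'X%:M - map_mx (@polyC K) (invmx P *m B *m P) =
   invmx (map_mx (@polyC K) P) *m ('X%:M - map_mx polyC B) *m map_mx polyC P.
  rewrite mulmxBr mulmxBl scalar_mxC -[_ *m _ *m map_mx _ P]mulmxA mulVmx // mulmx1.
  by rewrite !map_mxM /= map_invmx.
by rewrite !det_mulmx det_inv mulrAC mulVr ?mul1r // -unitmxE.
Qed.

(** Two independent eigenvectors make the eigenvalue a multiple root of the
    characteristic polynomial. *)
Lemma simple_root_eigenvector n (B : 'M[K]_n) z (v1 v2 : 'cV[K]_n) :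
  mup z (char_poly B) = 1%N -> v1 != 0 -> B *m v1 = z *: v1 -> B *m v2 = z *: v2 ->
  exists a, v2 = a *: v1.
Proof.
move=> mz v10 Bv1 Bv2.
have [/sub_rVP[a va]|nsub] := boolP (v2^T <= v1^T)%MS.
  by exists a; apply: trmx_inj; rewrite va linearZ.
pose U := col_mx v1^T v2^T; exfalso.
have rU : \rank U = 2%N.
  apply/eqP; rewrite eqn_leq rank_leq_row /=.
  have lt1 : (v1^T < v1^T + v2^T)%MS.
    by rewrite /ltmx addsmxSl; apply: contra nsub => /(submx_trans (addsmxSr _ _)).
  by have := rank_ltmx lt1; rewrite addsmxE rank_rV trmx_eq0 v10.
have UB : U *m B^T = z *: U.
  by rewrite mul_col_mx -!trmx_mul Bv1 Bv2 !linearZ /= scale_col_mx.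
have [m En] : exists m, n = (2 + m)%N.
  by have := rank_leq_col U; rewrite rU => h; exists (n - 2)%N; rewrite subnKC.
subst n.
pose E := row_ebase U; have uE : E \in unitmx by exact: row_ebase_unit.
pose D := invmx (col_ebase U) *m U.
have DE : D = pid_mx 2 *m E.
  by rewrite /D -{2}(mulmx_ebase U) rU !mulmxA mulVmx ?col_ebase_unit // mul1mx.
have DB : D *m B^T = z *: D by rewrite /D -mulmxA UB linearZ.
pose C := invmx (invmx E) *m B^T *m invmx E.
have CB : char_poly C = char_poly B.
  rewrite char_poly_conj ?unitmx_inv // /char_poly -[in RHS]det_tr; congr (\det _).
  by rewrite /char_poly_mx linearB /= tr_scalar_mx matrix.map_trmx.
(* in a basis starting with the two eigenvectors, B is block triangular with a scalar 2
   x 2 block *)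
have uC : usubmx C = row_mx z%:M 0.
  have -> : usubmx C = pid_mx 2 *m C by rewrite pid_mx_row -[C in RHS]vsubmxK mul_row_col mul1mx mul0mx addr0.
  rewrite /C invmxK !mulmxA -DE DB DE -scalemxAl -mulmxA mulmxV // mulmx1 pid_mx_row.
  by rewrite scale_row_mx scaler0 scalemx1.
have : ('X - z%:P) ^+ 2 %| char_poly B.
  rewrite -CB /char_poly /char_poly_mx -(vsubmxK C) uC -[dsubmx C]hsubmxK.
  rewrite -/(block_mx _ _ _ _) map_block_mx /= map_scalar_mx map_mx0 /= scalar_mx_block opp_block_mx add_block_mx.
  by rewrite oppr0 addr0 det_lblock -raddfB /= det_scalar dvdp_mulr.
rewrite -mup_geq ?mz //; exact/monic_neq0/char_poly_monic.
Qed.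
End SimpleEigenvalue.

Section PowerBound.
Variables (R : realType) (n : nat).
Local Notation C := R[i].
Implicit Types X : 'M[C]_n.+1.

Definition sum_normc X : R := \sum_i \sum_j normc (X i j).

Lemma sum_normc_ge0 X : 0 <= sum_normc X.
Proof. by apply: sumr_ge0 => i _; apply: sumr_ge0 => j _; exact: normc_ge0. Qed.

Lemma normc_le_sum X i j : normc (X i j) <= sum_normc X.
Proof.
rewrite /sum_normc (bigD1 i) //= (bigD1 j) //= -addrA lerDl addr_ge0 //.
  by apply: sumr_ge0 => l _; exact: normc_ge0.
by apply: sumr_ge0 => k _; apply: sumr_ge0 => l _; exact: normc_ge0.
Qed.

Lemma sum_normcD X Y : sum_normc (X + Y) <= sum_normc X + sum_normc Y.
Proof.
rewrite /sum_normc -big_split; apply: ler_sum => i _ /=; rewrite -big_split.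
by apply: ler_sum => j _; rewrite mxE le_normcD.
Qed.

Lemma sum_normcZ a X : sum_normc (a *: X) = normc a * sum_normc X.
Proof.
rewrite /sum_normc mulr_sumr; apply: eq_bigr => i _; rewrite mulr_sumr.
by apply: eq_bigr => j _; rewrite mxE normcM.
Qed.

(** Removing one Cayley-Hamilton factor at a time: if the powers applied to
    [(B - x) X] grow at most like $\theta^m$ and $|x| < \theta$, the recursion
    $B^{m+1} X = B^m (B - x) X + x B^m X$ gives the same rate for [X].  This avoids
    Jordan forms. *)
Lemma power_bound_product (B : 'M[C]_n.+1) th (r : seq C) X : 0 < th ->
  (forall x, x \in r -> normc x < th) ->
  foldr (fun x M => M * (B - x%:M)) 1 r * X = 0 ->
  exists2 K, 0 <= K & forall m, sum_normc (B ^+ m * X) <= K * th ^+ m.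
Proof.
move=> th0; elim: r X => [|x r IH] X rth /=.
  rewrite mul1r => ->; exists 0 => // m; rewrite mulr0 mul0r /sum_normc.
  by rewrite big1 // => i _; rewrite big1 // => j _; rewrite mxE normc0.
rewrite -mulrA => /IH[y yr|K K0 HK]; first by apply: rth; rewrite in_cons yr orbT.
have xth : normc x < th by apply: rth; exact: mem_head.
have d0 : 0 < th - normc x by rewrite subr_gt0.
pose K' := Num.max (sum_normc X) (K / (th - normc x)).
have K'0 : 0 <= K' by rewrite le_max sum_normc_ge0.
exists K' => //; elim=> [|m IHm]; first by rewrite expr0 mul1r expr0 mulr1 le_max lexx.
have -> : B ^+ m.+1 * X = B ^+ m * ((B - x%:M) * X) + x *: (B ^+ m * X).
  rewrite exprSr -mulrA mulrBl mulrBr -[x%:M * X]/(_ *m _) mul_scalar_mx.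
  by rewrite -scalerAr subrK.
rewrite (le_trans (sum_normcD _ _)) // sum_normcZ.
rewrite (le_trans (lerD (HK m) (ler_wpM2l (normc_ge0 _) IHm))) //.
rewrite exprS !mulrA -mulrDl ler_wpM2r ?exprn_ge0 ?(ltW th0) //.
have : K / (th - normc x) <= K' by rewrite le_max lexx orbT.
by rewrite ler_pdivrMr // mulrBr; lra.
Qed.

End PowerBound.

(** * Powers below the spectral radius, and homogeneous polynomials *)

Section SpectralRadius.
Variables (R : realType) (n : nat).
Implicit Types (A : 'M[R]_n.+1) (sigma : 'I_n.+1 -> R[i]).

Lemma eigenvalues_of_exists A : exists sigma, eigenvalues_of A sigma.
Proof.
have [r Er] := closed_field_poly_normal (char_poly (complexify A)).
rewrite (monicP (char_poly_monic _)) scale1r in Er.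
have szr : size r = n.+1.
  by have := size_char_poly (complexify A); rewrite Er size_prod_XsubC => -[].
exists (fun i => r`_i); rewrite /eigenvalues_of Er (big_nth 0) big_mkord szr.
by [].
Qed.

Lemma eigenvalues_ofP A sigma z : eigenvalues_of A sigma ->
  reflect (exists i, z = sigma i) (eigenvalue (complexify A) z).
Proof.
move=> sA; rewrite eigenvalue_root_char sA rootE horner_prod.
apply: (iffP (prodf_eq0 _ _)) => [[i _]|[i ->]]; rewrite ?hornerXsubC ?subr_eq0.
  by move=> /eqP ->; exists i.
by exists i; rewrite ?hornerXsubC ?subrr.
Qed.

Lemma eigenvalue_le_radius A z : eigenvalue (complexify A) z ->
  normc z <= spectral_radius A.
Proof.
move=> ez; have [sigma sA] := eigenvalues_of_exists A.
have zi w : eigenvalue (complexify A) w -> normc w <= \sum_i normc (sigma i).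
  move=> /(eigenvalues_ofP w sA)[i ->]; rewrite (bigD1 i) //= lerDl sumr_ge0 // => j _.
  exact: normc_ge0.
apply: sup_upper_bound; last by exists z.
split; first by exists (normc z), z.
by exists (\sum_i normc (sigma i)) => _ [w /zi ? <-].
Qed.

Lemma complexifyX A m : complexify (A ^+ m) = complexify A ^+ m.
Proof. by rewrite /complexify rmorphXn. Qed.

(** The dimension factor turns a bound on entries into a bound on the operator norm for
    the maximum norm; it is absorbed by a power, the bound being obtained first for a
    rate [th'] smaller than [th]. *)
Lemma small_powers A sigma th : eigenvalues_of A sigma -> 0 < th ->
  (forall i, normc (sigma i) < th) ->
  exists2 N, (0 < N)%N & forall i j, n.+1%:R * `|(A ^+ N) i j| < th ^+ N.
Proof.
move=> sA th0 Hs.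
pose th' := \big[Num.max/th / 2]_i ((normc (sigma i) + th) / 2).
have th'th : th' < th.
  apply: bigmax_lt; first by lra.
  by move=> i _; have := Hs i; lra.
have th'0 : 0 < th' by apply: lt_le_trans (bigmax_ge_id _ _ _ _); lra.
have sth' i : normc (sigma i) < th'.
  apply: lt_le_trans (le_bigmax _ _ i); have := Hs i; lra.
pose r := [seq sigma i | i <- index_enum 'I_n.+1].
have CH : foldr (fun x M => M * (complexify A - x%:M)) 1 r * 1 = 0.
  rewrite mulr1 -(Cayley_Hamilton (complexify A)) sA /r.
  elim: (index_enum _) => [|i l IHl] /=; first by rewrite big_nil rmorph1.
  by rewrite big_cons mulrC rmorphM /= IHl rmorphB /= horner_mx_X horner_mx_C.
have [|K K0 HK] := power_bound_product th'0 _ CH.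
  by move=> x /mapP[i _ ->].
have q1 : `|th' / th| < 1 by rewrite ger0_norm ?divr_ge0 ?ltW // ltr_pdivrMr // mul1r.
have Kn0 : 0 < n.+1%:R * K + 1 by rewrite ltr_wpDl // mulr_ge0.
have /cvgrPdist_lt/(_ (n.+1%:R * K + 1)^-1) := cvg_expr q1.
rewrite invr_gt0 => /(_ Kn0) [N0 _ HN0].
exists N0.+1 => // i j; have := HN0 N0.+1 (leqnSn _); rewrite /= sub0r normrN normrX.
rewrite ger0_norm ?divr_ge0 ?ltW // expr_div_n.
rewrite ltr_pdivrMr ?exprn_gt0 // ltr_pdivlMl // => H.
apply: le_lt_trans H.
have : `|(A ^+ N0.+1) i j| <= K * th' ^+ N0.+1.
  apply: le_trans (HK N0.+1); rewrite mulr1 -complexifyX.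
  apply: le_trans (normc_le_sum _ i j); rewrite mxE.
  by rewrite -[X in X <= _]normc_realE.
rewrite -(ler_pM2l (ltr0Sn R n)) => /le_trans; apply.
by rewrite mulrA ler_wpM2r ?exprn_ge0 ?(ltW th'0) // lerDl.
Qed.

End SpectralRadius.

Lemma derive_cmul (R : realType) (p : nat) (f : 'rV[R]_p -> R) c x v :
  derivable f x v -> derivable (fun y => c * f y) x v /\
  'D_v (fun y => c * f y) x = c * 'D_v f x.
Proof. by move=> df; split; [exact: (@derivableZ _ _ _ f c x v df)|exact: (@deriveZ _ _ _ f c x v df)]. Qed.

Section Forms.
Variables (R : realType) (p : nat) (p0 : 'rV[R]_p).
Implicit Types (T : seq 'I_p -> R) (s u v : seq 'I_p) (l : nat).

(** The homogeneous polynomial $T(x - p_0, \dots, x - p_0) / l!$; the recursion is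
    Euler's identity, so that for a symmetric [T] differentiating in direction
    [i] is fixing the first argument to the [i]-th basis vector. *)
Fixpoint form_poly l T (x : 'rV[R]_p) : R :=
  if l is l'.+1 then l%:R^-1 * \sum_j (x 0 j - p0 0 j) * form_poly l' (fun u => T (j :: u)) x
  else T [::].

Lemma form_poly_ext l T T' x : (forall u, size u = l -> T u = T' u) ->
  form_poly l T x = form_poly l T' x.
Proof.
elim: l T T' => [|l IH] T T' E /=; first exact: E.
by congr (_ * _); apply: eq_bigr => j _; congr (_ * _); apply: IH => u ul; apply: E; rewrite /= ul.
Qed.

Lemma form_poly_sum l (I : finType) (c : I -> R) (T : I -> seq 'I_p -> R) x :
  form_poly l (fun u => \sum_i c i * T i u) x = \sum_i c i * form_poly l (T i) x.
Proof.
elim: l T => [//|l IH] T /=.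
under eq_bigr do rewrite IH mulr_sumr.
rewrite exchange_big mulr_sumr; apply: eq_bigr => i _.
by rewrite mulrCA; congr (_ * _); rewrite mulr_sumr; apply: eq_bigr => j _; rewrite mulrCA.
Qed.

Lemma form_poly_lin l (a b : R) T T' x :
  form_poly l (fun u => a * T u + b * T' u) x = a * form_poly l T x + b * form_poly l T' x.
Proof.
elim: l T T' => [//|l IH] T T' /=.
under eq_bigr do rewrite IH mulrDr.
rewrite big_split /= mulrDr; congr (_ + _); rewrite mulrCA; congr (_ * _);
  rewrite mulr_sumr; apply: eq_bigr => j _; rewrite mulrCA //.
Qed.

Lemma Cka_form_poly k a V l T : 0 <= a <= 1 -> open V -> Cka k a V (form_poly l T).
Proof.
move=> ha oV; elim: l T => [|l IH] T /=; first exact: Cka_cst.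
apply: Cka_scale => //; apply: Cka_sum => // j _; apply: Cka_mul => //.
by apply: Cka_sub_fun => //; [exact: Cka_coord|exact: Cka_cst].
Qed.

Lemma partial_form_poly1 l T i x : symmetric_form l.+1 T ->
  partial [:: i] (form_poly l.+1 T) x = form_poly l (fun u => T (i :: u)) x.
Proof.
have dc j (y : 'rV[R]_p) : derivable (fun x : 'rV[R]_p => x 0 j - p0 0 j) y (row_unit i).
  by apply: derivableB; [exact: derivable_coord|exact: derivable_cst].
have Dc j (y : 'rV[R]_p) : 'D_(row_unit i) (fun x : 'rV[R]_p => x 0 j - p0 0 j) y = (i == j)%:R.
  rewrite deriveB; [|exact: derivable_coord|exact: derivable_cst].
  by rewrite derive_cst subr0 -[LHS]/(partial [:: i] _ y) partial_coord.
elim: l T => [|l IH] T sT.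
  rewrite (_ : form_poly 1 T = fun x => \sum_j T [:: j] * (x 0 j - p0 0 j)); last first.
    by apply/funext => y /=; rewrite invr1 mul1r; apply: eq_bigr => j _; rewrite mulrC.
  have dS := derivable_bigsum (index_enum 'I_p) (fun j => (derive_cmul (T [:: j]) (dc j x)).1).
  rewrite -[LHS]/('D_(row_unit i) _ x) -[RHS]/(T [:: i]) dS.2.
  under eq_bigr => j _ do rewrite (derive_cmul (T [:: j]) (dc j x)).2 Dc.
  rewrite (bigD1 i) //= eqxx mulr1 big1 ?addr0 // => j ji.
  by rewrite eq_sym (negbTE ji) mulr0.
pose F j := form_poly l.+1 (fun u => T (j :: u)).
have dF j y : derivable (F j) y (row_unit i).
  have : Cka 1 0 setT (F j) by apply: Cka_form_poly; [rewrite lexx ler01|exact: openT].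
  by case=> _ + _; apply.
have -> : form_poly l.+2 T = (fun y => l.+2%:R^-1 * \sum_j ((fun x : 'rV[R]_p => x 0 j - p0 0 j) * F j) y) by [].
have dS := derivable_bigsum (index_enum 'I_p) (fun j => derivableM (dc j x) (dF j x)).
rewrite -[LHS]/('D_(row_unit i) _ x) (derive_cmul _ dS.1).2 dS.2.
under eq_bigr => j _ do rewrite (deriveM (dc j x) (dF j x)) Dc.
rewrite big_split /= addrC (bigD1 i) //= eqxx.
rewrite [X in _ + X + _]big1 => [|j ji]; last first.
  by rewrite eq_sym (negbTE ji) scaler0.
rewrite addr0.
have -> : \sum_j (x 0 j - p0 0 j) *: 'D_(row_unit i) (F j) x = l.+1%:R * F i x.
  rewrite /F /= mulrA divff ?pnatr_eq0 // mul1r; apply: eq_bigr => j _.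
  rewrite -[LHS]/(_ * _); congr (_ * _).
  rewrite (IH _ (symmetric_form_cons _ sT) : 'D_(row_unit i) (F j) x = _).
  apply: form_poly_ext => u ul; apply: (sT [::]); by rewrite /= ul.
rewrite -[X in X + _]/(F i x * 1) mulr1 -[LHS]/(_ * _) -{1}[F i x]mul1r -mulrDl mulrA.
by rewrite -natr1 [1 + _]addrC natr1 mulVf ?mul1r // pnatr_eq0.
Qed.

Lemma symmetric_form_move l T u i v : symmetric_form l T ->
  size (u ++ i :: v) = l -> T (u ++ i :: v) = T (i :: u ++ v).
Proof.
elim: u l T => [//|j u IH] l T sT /= ul.
case: l ul sT => // l [ul] sT.
rewrite (IH l (fun w => T (j :: w))) //; last exact: symmetric_form_cons.
by apply: (sT [::]); rewrite /= -ul !size_cat /= addnS.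
Qed.

Lemma partial_form_poly l T s x : symmetric_form l T -> (size s <= l)%N ->
  partial s (form_poly l T) x = form_poly (l - size s) (fun u => T (s ++ u)) x.
Proof.
move=> sT; elim: s x => [|i s IH] x; first by rewrite subn0.
move=> sl; rewrite /= (_ : partial s _ = form_poly (l - size s) (fun u => T (s ++ u))); last first.
  by apply/funext => y; rewrite IH // ltnW.
rewrite -subnSK // -[LHS]/(partial [:: i] _ x) partial_form_poly1.
  apply: form_poly_ext => u ul; rewrite (symmetric_form_move sT) // size_cat /= ul.
  by rewrite subnSK // subnKC // ltnW.
move=> u v a b ul; rewrite !catA; apply: sT.
by rewrite -catA size_cat ul subnSK // subnKC // ltnW.
Qed.

Lemma form_poly_center l T : (0 < l)%N -> form_poly l T p0 = 0.
Proof. by case: l => //= l _; rewrite big1 ?mulr0 // => j _; rewrite subrr mul0r. Qed.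

(** Linear substitutions act on polynomials through [tens], which is how an eigenvalue
    equation for a polynomial becomes one for its form. *)
Lemma form_poly_subst l T (A : 'M[R]_p) (h : 'rV[R]_p) :
  form_poly l T (p0 + h *m A) = form_poly l (fun s => tens A s T) (p0 + h).
Proof.
elim: l T => [//|l IH] T /=; congr (_ * _).
under eq_bigr => j _ do rewrite IH mxE addrAC subrr add0r mxE mulr_suml.
rewrite exchange_big; apply: eq_bigr => i _; rewrite form_poly_sum mxE addrAC subrr add0r mulr_sumr.
by apply: eq_bigr => j _; rewrite mulrA.
Qed.

Lemma form_poly_homogeneous l T (h : 'rV[R]_p) t :
  form_poly l T (p0 + t *: h) = t ^+ l * form_poly l T (p0 + h).
Proof.
elim: l T => [|l IH] T /=; first by rewrite expr0 mul1r.
rewrite mulrCA; congr (_ * _); rewrite mulr_sumr; apply: eq_bigr => j _.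
by rewrite IH !mxE ![p0 0 j + _ - _]addrAC !subrr !add0r exprS; ring.
Qed.

(** A symmetric form is recovered from its polynomial by differentiating as often as its
    degree. *)
Lemma form_poly_inj l T T' : symmetric_form l T -> symmetric_form l T' ->
  (forall x, form_poly l T x = form_poly l T' x) -> forall s, size s = l -> T s = T' s.
Proof.
move=> sT sT' E s sl.
have := partial_form_poly p0 sT (eq_leq sl); have := partial_form_poly p0 sT' (eq_leq sl).
by rewrite sl subnn /= !cats0 => <- <-; congr partial; apply/funext.
Qed.

End Forms.

(** * Taylor estimates and leading jets *)

Definition nball (R : realType) (p : nat) (x0 : 'rV[R]_p) (r : R) : set 'rV[R]_p :=
  [set x | `|x - x0| < r].

Lemma open_nball (R : realType) (p : nat) (x0 : 'rV[R]_p) r : open (nball x0 r).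
Proof.
have -> : nball x0 r = ball x0 r; last exact: ball_open.
by apply/seteqP; split => x; rewrite /nball -ball_normE /= distrC.
Qed.

Lemma nbhs_nball (R : realType) (p : nat) (x0 : 'rV[R]_p) r : 0 < r -> nbhs x0 (nball x0 r).
Proof. by move=> r0; apply: open_nbhs_nbhs; split; [exact: open_nball|rewrite /nball/= subrr normr0]. Qed.

Lemma fin_uniform (R : realType) (I : finType) (P : I -> R -> R -> Prop) :
  (forall i r r' C C', r' <= r -> C <= C' -> P i r C -> P i r' C') ->
  (forall i, exists r C, [/\ 0 < r, 0 <= C & P i r C]) ->
  exists r C, [/\ 0 < r, 0 <= C & forall i, P i r C].
Proof.
move=> mono H.
have H' i : exists rC : R * R, [/\ 0 < rC.1, 0 <= rC.2 & P i rC.1 rC.2].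
  by have [r [C ?]] := H i; exists (r, C).
have [rC HrC] := choice H'.
exists (\big[Num.min/1]_i (rC i).1), (\sum_i (rC i).2); split.
- by apply: lt_bigmin => // i _; case: (HrC i).
- by apply: sumr_ge0 => i _; case: (HrC i).
move=> i; have [_ _] := HrC i; apply: mono; first exact: bigmin_le_cond.
by rewrite (bigD1 i) //= lerDl sumr_ge0 // => j _; case: (HrC j).
Qed.

Lemma powR_mulS (R : realType) (x b : R) : 0 <= x -> 0 <= b -> x * x `^ b = x `^ (b + 1).
Proof.
move=> x0 b0; have b1 : b + 1 != 0 by rewrite gt_eqF // ltr_wpDl.
have [->|xn] := eqVneq x 0; first by rewrite mul0r powR0.
by rewrite powRD ?xn ?implybT // powRr1 // mulrC.
Qed.

Section Taylor.
Variables (R : realType) (p : nat) (p0 : 'rV[R]_p).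
Implicit Types (V : set 'rV[R]_p) (f : 'rV[R]_p -> R) (s : seq 'I_p) (k l : nat).

(** The mean value theorem, applied from the centre, gains one power of the distance. *)
Lemma taylor_step f r K b : 0 <= K -> 0 <= b ->
  (forall x i, nball p0 r x -> derivable f x (row_unit i)) ->
  (forall i x, nball p0 r x -> `|partial [:: i] f x| <= K * `|x - p0| `^ b) ->
  f p0 = 0 -> forall x, nball p0 r x -> `|f x| <= p%:R * K * `|x - p0| `^ (b + 1).
Proof.
move=> K0 b0 df pf f0 x xr.
have inb w : in_box p0 x w -> `|w - p0| <= `|x - p0|.
  by move/(_ p0); rewrite subrr normr0 max_r.
have [w j /inb wx|xi [xib]] := @mvt_box R p f p0 x.
  by apply: df; exact: le_lt_trans wx xr.
rewrite f0 subr0 => ->; apply: le_trans (ler_norm_sum _ _ _) _.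
have -> : p%:R * K * `|x - p0| `^ (b + 1) = \sum_(j < p) K * (`|x - p0| * `|x - p0| `^ b).
  by rewrite powR_mulS // sumr_const card_ord -[RHS]mulr_natl mulrA.
apply: ler_sum => j _; rewrite normrM mulrCA; apply: ler_pM => //.
  by have := coord_le_norm (x - p0) j; rewrite !mxE.
apply: le_trans (pf j _ (le_lt_trans (inb _ (xib j)) xr)) _; rewrite ler_wpM2l //.
by apply: ge0_ler_powR; rewrite ?nnegrE //; exact: inb.
Qed.

Lemma taylor_weights f k a r K : 0 <= K -> 0 <= a -> Cka k 0 (nball p0 r) f ->
  (forall s x, size s = k -> nball p0 r x -> `|partial s f x| <= K * `|x - p0| `^ a) ->
  (forall s, (size s < k)%N -> partial s f p0 = 0) ->
  forall s x, (size s <= k)%N -> nball p0 r x ->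
    `|partial s f x| <= p.+1%:R ^+ k * K * `|x - p0| `^ ((k - size s)%:R + a).
Proof.
move=> K0 a0 Hf top low s.
suff H m : forall s x, (size s + m = k)%N -> nball p0 r x ->
    `|partial s f x| <= p.+1%:R ^+ m * K * `|x - p0| `^ (m%:R + a).
  move=> x sk xr; apply: le_trans (H (k - size s)%N s x _ xr) _; first by rewrite subnKC.
  rewrite ler_wpM2r ?powR_ge0 // ler_wpM2r // ler_weXn2l ?leq_subr //.
  by rewrite ler1n.
elim: m => [|m IH] {}s x sk xr.
  by rewrite expr0 mul1r add0r; apply: top => //; rewrite -sk addn0.
have sk' : (size s < k)%N by rewrite -sk addnS ltnS leq_addr.
have -> : m.+1%:R + a = (m%:R + a) + 1 by rewrite -natr1 addrAC.
apply: le_trans (@taylor_step (partial s f) r (p.+1%:R ^+ m * K) (m%:R + a) _ _ _ _ _ x xr) _.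
- by rewrite mulr_ge0 // exprn_ge0.
- by rewrite addr_ge0.
- by move=> y i yr; exact: Cka_partial_derivable Hf yr.
- by move=> i y yr; apply: (IH (i :: s)) => //=; rewrite addSnnS.
- exact: low.
by rewrite mulrA exprS ler_wpM2r ?powR_ge0 // ler_wpM2r // ler_wpM2r ?exprn_ge0 // ler_nat.
Qed.

(** Vanishing jets give decay: below the top order by the mean value theorem, at the top
    order from the Holder condition if [a > 0]. With [a = 0] the jets of order [k] need
    not vanish and are merely bounded, which is what the weight $|x - p_0|^0$ asks for.
    *)
Lemma real_weights V f k a : open V -> V p0 -> 0 <= a <= 1 -> Cka k a V f ->
  (forall s, below_order (size s) (Fin k) a -> partial s f p0 = 0) ->
  exists r K, [/\ 0 < r, 0 <= K, nball p0 r `<=` V,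
    forall s x, (size s <= k)%N -> nball p0 r x ->
      `|partial s f x| <= K * `|x - p0| `^ ((k - size s)%:R + a) &
    forall s x y, size s = k -> nball p0 r x -> nball p0 r y ->
      `|partial s f x - partial s f y| <= K * `|x - y| `^ a].
Proof.
move=> oV Vp ha Hf jets; have [a0 a1] := andP ha.
have [rV rV0 subV] := open_norm_ball oV Vp.
pose P (t : k.-tuple 'I_p) r C :=
  (forall y z, nball p0 r y -> nball p0 r z -> `|partial t f y - partial t f z| <= C * `|y - z| `^ a) /\
  (forall x, nball p0 r x -> `|partial t f x| <= C * `|x - p0| `^ a).
have [||r [C [r0 C0 HP]]] := @fin_uniform R _ P.
- move=> t r r' C C' rr CC [h1 h2]; split=> [y z yr zr|x xr].
    apply: le_trans (h1 _ _ (lt_le_trans yr rr) (lt_le_trans zr rr)) _.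
    by rewrite ler_wpM2r ?powR_ge0.
  apply: le_trans (h2 _ (lt_le_trans xr rr)) _.
  by rewrite ler_wpM2r ?powR_ge0.
- move=> t; have [_ /(_ t (size_tuple t) _ Vp)[r r0 [C C0 H]]] := (CkaP k a V f).1 Hf.
  exists r, (`|partial t f p0| + C); split; rewrite ?addr_ge0 //; split=> [y z yr zr|x xr].
    apply: le_trans (H _ _ yr zr) _.
    by rewrite ler_wpM2r ?powR_ge0 // lerDr.
  have p0r : nball p0 r p0 by rewrite /nball /= subrr normr0.
  have E : `|partial t f p0| = `|partial t f p0| * `|x - p0| `^ a.
    have [a00|a00] := eqVneq a 0; first by rewrite a00 powRr0 mulr1.
    by rewrite jets ?normr0 ?mul0r // size_tuple /= ltrDl lt_neqAle eq_sym a00.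
  rewrite mulrDl -E -[partial t f x](subrK (partial t f p0)) addrC.
  by rewrite (le_trans (ler_normD _ _)) // lerD2l; exact: H.
pose r' := Num.min r rV; have r'r : r' <= r by rewrite ge_min lexx.
have subV' : nball p0 r' `<=` V.
  by move=> x xr; apply: subV; apply: lt_le_trans xr _; rewrite ge_min lexx orbT.
have c1 : 1 <= p.+1%:R ^+ k :> R by rewrite exprn_ege1 // ler1n.
exists r', (p.+1%:R ^+ k * C); split; rewrite ?mulr_ge0 ?exprn_ge0 // ?lt_min ?r0 //.
- apply: taylor_weights => //.
  + by apply: Cka0W; exact: Cka_sub Hf.
  + move=> s x /eqP sk xr; have [_] := HP (Tuple sk); apply.
    exact: lt_le_trans xr r'r.
  + move=> s sk; apply: jets => /=.
    by rewrite (@lt_le_trans _ _ k%:R) ?ltr_nat // lerDl.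
- move=> s x y /eqP sk xr yr; have [h _] := HP (Tuple sk).
  apply: le_trans (h x y (lt_le_trans xr r'r) (lt_le_trans yr r'r)) _.
  by rewrite ler_wpM2r ?powR_ge0 // ler_peMl.
Qed.

(** Little-o form of the Taylor estimate, from the continuity of the top derivatives. *)
Lemma small_jets V f l : open V -> V p0 -> Cka l 0 V f ->
  (forall s, (size s <= l)%N -> partial s f p0 = 0) ->
  forall e, 0 < e -> exists2 r, 0 < r & forall x, nball p0 r x -> `|f x| <= e * `|x - p0| ^+ l.
Proof.
move=> oV Vp Hf jets e e0.
have [rV rV0 subV] := open_norm_ball oV Vp.
have c0 : 0 < p.+1%:R ^+ l :> R by rewrite exprn_gt0.
pose e' := e / p.+1%:R ^+ l; have e'0 : 0 < e' by rewrite divr_gt0.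
pose P (t : l.-tuple 'I_p) r (C : R) := forall x, nball p0 r x -> `|partial t f x| <= e'.
have [||r [C [r0 _ HP]]] := @fin_uniform R _ P.
- by move=> t r r' C C' rr _ H x xr; apply: H; exact: lt_le_trans xr rr.
- move=> t; have tl : (size t <= l)%N by rewrite size_tuple.
  have [r r0 H] := continuous_norm_ballR (Cka_continuous (Cka_partial tl Hf) Vp) e'0.
  by exists r, 0; split=> // x /H; rewrite jets // subr0 => /ltW.
pose r' := Num.min r rV; have r'r : r' <= r by rewrite ge_min lexx.
have subV' : nball p0 r' `<=` V.
  by move=> x xr; apply: subV; apply: lt_le_trans xr _; rewrite ge_min lexx orbT.
exists r'; first by rewrite lt_min r0.
move=> x xr; have := @taylor_weights f l 0 r' e' (ltW e'0) (lexx _) _ _ _ [::] x isT xr.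
rewrite subn0 addr0 powR_mulrn // /e' [_ * (e / _)]mulrC divfK ?lt0r_neq0 //.
apply.
- exact: Cka_sub Hf.
- move=> s y /eqP sl yr; rewrite powRr0 mulr1; apply: (HP (Tuple sl)).
  exact: lt_le_trans yr r'r.
- by move=> s sl; apply: jets; exact: ltnW.
Qed.

Lemma symmetric_jet V f l : open V -> V p0 -> Cka l 0 V f ->
  symmetric_form l (fun s => partial s f p0).
Proof. by move=> oV Vp Hf u v i j ul; apply: (@partial_swap _ _ V l 0 f u v i j p0 oV _ Hf Vp); rewrite ul. Qed.

(** The function differs from its Taylor form of degree [l] by $o(|x - p_0|^l)$, and
    the form is homogeneous.  Curves are admitted besides straight lines because
    [F] bends the lines through [p0] in the application. *)
Lemma scaling_limit V f l (y : R -> 'rV[R]_p) y0 : open V -> V p0 -> Cka l 0 V f ->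
  (forall s, (size s < l)%N -> partial s f p0 = 0) ->
  y t @[t --> 0^'] --> y0 ->
  f (p0 + t *: y t) / t ^+ l @[t --> 0^'] --> form_poly p0 l (fun s => partial s f p0) (p0 + y0).
Proof.
move=> oV Vp Hf jets yy0; set T := fun s => partial s f p0.
have sT : symmetric_form l T by exact: symmetric_jet Hf.
pose h := form_poly p0 l T.
have ha01 : (0 : R) <= (0 : R) <= (1 : R) by apply/andP; split; [exact: lexx|exact: ler01].
have Hh W : open W -> Cka l 0 W h by move=> oW; exact: Cka_form_poly.
pose g x := f x + -1 * h x.
have Hg : Cka l 0 V g.
  have Q1 := (Cka_scale ha01 (-1) oV (Hh V oV)). exact: (Cka_add oV Hf Q1).
have jg s : (size s <= l)%N -> partial s g p0 = 0.
  move=> sl; rewrite /g (partial_add (k := l) (a := 0) oV) //; last first.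
    exact: (Cka_scale ha01 (-1) oV (Hh V oV)).
  rewrite (partial_scale (k := l) (a := 0) _ oV) //; last exact: (Hh V oV).
  rewrite partial_form_poly // mulN1r; move: sl; rewrite leq_eqVlt => /orP[/eqP sl|sl].
    by rewrite sl subnn /= cats0 subrr.
  by rewrite jets // form_poly_center ?subn_gt0 // subrr.
have -> : (fun t => f (p0 + t *: y t) / t ^+ l) =
    (fun t => g (p0 + t *: y t) / t ^+ l + h (p0 + t *: y t) / t ^+ l).
  by apply/funext => t; rewrite -mulrDl /g mulN1r subrK.
rewrite -[X in _ --> X]add0r; apply: cvgD.
  apply/cvgr0Pnorm_le => e e0; pose M := `|y0| + 1.
  have M0 : 0 < M by rewrite ltr_wpDl.
  have e'0 : 0 < e / M ^+ l by rewrite divr_gt0 // exprn_gt0.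
  have [r r0 Hr] := small_jets oV Vp Hg jg e'0.
  near=> t.
  have t0 : t != 0 by near: t; exact: nbhs_dnbhs_neq.
  have yM : `|y t| <= M.
    near: t; have /cvgrPdist_lt/(_ 1 ltr01) := yy0; apply: filterS => t H.
    by rewrite -(subrK y0 (y t)) (le_trans (ler_normD _ _)) // addrC lerD2l distrC ltW.
  have tM : `|t| < r / M by near: t; apply: dnbhs0_lt; rewrite divr_gt0.
  have nt : nball p0 r (p0 + t *: y t).
    rewrite /nball /= addrAC subrr add0r normrZ; apply: le_lt_trans (_ : _ <= `|t| * M) _.
      by rewrite ler_wpM2l.
    by rewrite -ltr_pdivlMr.
  have tl0 : 0 < `|t| ^+ l by rewrite exprn_gt0 // normr_gt0.
  rewrite normrM normfV normrX ler_pdivrMr //; apply: le_trans (Hr _ nt) _.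
  rewrite addrAC subrr add0r normrZ exprMn mulrCA mulrC ler_wpM2r ?(ltW tl0) //.
  rewrite -[leRHS](divfK (lt0r_neq0 (exprn_gt0 l M0))) ler_wpM2l ?(ltW e'0) //.
  by apply: lerXn2r => //; rewrite nnegrE // ltW.
have : h (p0 + y t) @[t --> 0^'] --> h (p0 + y0).
  have ch : {for (p0 + y0), continuous h} by apply: (Cka_continuous (Hh _ openT)).
  have cy : p0 + y t @[t --> 0^'] --> p0 + y0 by apply: cvgD => //; exact: cvg_cst.
  exact: (cvg_comp _ _ cy ch).
apply: cvg_trans; apply: near_eq_cvg; near=> t.
have t0 : t != 0 by near: t; exact: nbhs_dnbhs_neq.
by rewrite /h form_poly_homogeneous mulrC mulKf ?expf_neq0.
Unshelve. all: by end_near. Qed.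

End Taylor.

Lemma tens_complexify_Re (R : realType) (p q : nat) (B : 'I_p -> 'I_q -> R) s (T : seq 'I_q -> R[i]) :
  complex.Re (tens (fun i j => (B i j)%:C%C) s T) = tens B s (fun u => complex.Re (T u)).
Proof.
elim: s T => [//|i s IH] T /=; rewrite (big_morph (@complex.Re R) (id1 := 0) (op1 := +%R)) //; last by case=> ? ? [].
by apply: eq_bigr => j _; rewrite -IH; case: (tens _ _ _) => a b /=; rewrite mul0r subr0.
Qed.

Lemma tens_complexify_Im (R : realType) (p q : nat) (B : 'I_p -> 'I_q -> R) s (T : seq 'I_q -> R[i]) :
  complex.Im (tens (fun i j => (B i j)%:C%C) s T) = tens B s (fun u => complex.Im (T u)).
Proof.
elim: s T => [//|i s IH] T /=; rewrite (big_morph (@complex.Im R) (id1 := 0) (op1 := +%R)) //; last by case=> ? ? [].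
by apply: eq_bigr => j _; rewrite -IH; case: (tens _ _ _) => a b /=; rewrite mul0r addr0.
Qed.

Lemma tens_complexify (R : realType) (p : nat) (A : 'M[R]_p) s (T : seq 'I_p -> R[i]) :
  tens (complexify A) s T = tens (fun i j => (A i j)%:C%C) s T.
Proof.
elim: s T => [//|i s IH] T /=; apply: eq_bigr => j _.
by rewrite IH mxE.
Qed.

Section LeadingJet.
Variables (R : realType) (p : nat).

Definition cCka k a (V : set 'rV[R]_p) (g : 'rV[R]_p -> R[i]) :=
  Cka k a V (fun x => complex.Re (g x)) /\ Cka k a V (fun x => complex.Im (g x)).

(** Blowing up $g \circ F = \nu g$ at [p0] compares the lowest-order Taylor forms
    of both sides.  Differentiating the equation [l] times is not an option, as [F]
    has only one derivative. *)
Lemma leading_jet V (p0 : 'rV[R]_p) (F : 'rV[R]_p -> 'rV[R]_p) (A : 'M[R]_p)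
    (g : 'rV[R]_p -> R[i]) nu l : open V -> V p0 ->
  (forall v, t^-1 *: (F (p0 + t *: v) - p0) @[t --> 0^'] --> v *m A) ->
  cCka l 0 V g -> (forall s, (size s < l)%N -> cpartial s g p0 = 0) ->
  (\forall x \near p0, g (F x) = nu * g x) ->
  forall s, size s = l ->
    tens (complexify A) s (fun u => cpartial u g p0) = nu * cpartial s g p0.
Proof.
move=> oV Vp dF [Hr Hi] jets Fg.
pose Tr s := partial s (fun x => complex.Re (g x)) p0.
pose Ti s := partial s (fun x => complex.Im (g x)) p0.
have jr s : (size s < l)%N -> partial s (fun x => complex.Re (g x)) p0 = 0.
  by move=> sl; exact: (congr1 (@complex.Re R) (jets s sl)).
have ji s : (size s < l)%N -> partial s (fun x => complex.Im (g x)) p0 = 0.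
  by move=> sl; exact: (congr1 (@complex.Im R) (jets s sl)).
have cv v : (fun=> v) t @[t --> (0 : R)^'] --> (v : 'rV[R]_p) by exact: cvg_cst.
have near_g v : \forall t \near (0 : R)^', g (p0 + t *: (t^-1 *: (F (p0 + t *: v) - p0))) = nu * g (p0 + t *: v).
  have c : p0 + t *: v @[t --> (0 : R)^'] --> p0.
    rewrite -[X in _ --> X]addr0 -(scale0r v); apply: cvgD; first exact: cvg_cst.
    by apply: cvgZ; [exact: nbhs_dnbhs|exact: cvg_cst].
  have := c _ Fg; rewrite nbhs_simpl /= => nFg.
  near=> t; have t0 : t != 0 by near: t; exact: nbhs_dnbhs_neq.
  rewrite scalerA divff // scale1r addrC subrK; near: t; exact: nFg.
have lim_eq (u1 u2 : R -> R) (l1 l2 : R) : (\forall t \near (0 : R)^', u1 t = u2 t) ->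
    u1 t @[t --> 0^'] --> l1 -> u2 t @[t --> 0^'] --> l2 -> l1 = l2.
  move=> E c1 c2; have c1' : u2 t @[t --> 0^'] --> l1.
    by apply: cvg_trans c1; apply: near_eq_cvg.
  exact: etrans (esym (cvg_lim (@Rhausdorff R) c1')) (cvg_lim (@Rhausdorff R) c2).
have [sr si] : symmetric_form l Tr /\ symmetric_form l Ti.
  by split; [exact: symmetric_jet Hr|exact: symmetric_jet Hi].
have symlin (a b : R) T T' : symmetric_form l T -> symmetric_form l T' ->
    symmetric_form l (fun s : seq 'I_p => a * T s + b * T' s).
  by move=> h h' u v i j ul; rewrite h // h'.
have formE T T' : (forall v, form_poly p0 l T (p0 + v *m A) = form_poly p0 l T' (p0 + v)) ->
    symmetric_form l T -> symmetric_form l T' ->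
    forall s, size s = l -> tens A s T = T' s.
  move=> E sT sT' s sl.
  apply: (@form_poly_inj _ _ p0 l (fun s => tens A s T) T' _ sT') => //.
    exact: tens_symmetric.
  move=> x; rewrite -[x](subrK p0) addrC -form_poly_subst; exact: E.
have lr v := scaling_limit oV Vp Hr jr (cv v).
have li v := scaling_limit oV Vp Hi ji (cv v).
move=> s sl; apply/eqP; rewrite eq_complex; apply/andP; split; apply/eqP.
- have -> : complex.Re (nu * cpartial s g p0) = complex.Re nu * Tr s + (- complex.Im nu) * Ti s.
    by case: (nu) => a b; rewrite /cpartial /= mulNr.
  rewrite tens_complexify tens_complexify_Re /=; apply: (formE Tr (fun s => complex.Re nu * Tr s + - complex.Im nu * Ti s)) => //; last exact: symlin.
  move=> v; rewrite form_poly_lin.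
  apply: (lim_eq _ _ _ _ _ (scaling_limit oV Vp Hr jr (dF v))
    (cvgD (cvgM (cvg_cst _) (lr v)) (cvgM (cvg_cst _) (li v)))).
  near=> t; rewrite (near (near_g v) t) //=.
  by case: (nu) => a b; case: (g _) => c d /=; rewrite mulrBl mulNr !mulrA.
- have -> : complex.Im (nu * cpartial s g p0) = complex.Re nu * Ti s + complex.Im nu * Tr s.
    by case: (nu) => a b; rewrite /cpartial /=.
  rewrite tens_complexify tens_complexify_Im /=; apply: (formE Ti (fun s => complex.Re nu * Ti s + complex.Im nu * Tr s)) => //; last exact: symlin.
  move=> v; rewrite form_poly_lin.
  apply: (lim_eq _ _ _ _ _ (scaling_limit oV Vp Hi ji (dF v))
    (cvgD (cvgM (cvg_cst _) (li v)) (cvgM (cvg_cst _) (lr v)))).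
  near=> t; rewrite (near (near_g v) t) //=.
  by case: (nu) => a b; case: (g _) => c d /=; rewrite mulrDl !mulrA.
Unshelve. all: by end_near. Qed.

End LeadingJet.

(** * Weighted bounds at the fixed point *)

Section Weighted.
Variables (R : realType) (n : nat) (p0 : 'rV[R]_n) (k : nat) (a : R).
Hypothesis ha : 0 <= a <= 1.
Implicit Types (g : 'rV[R]_n -> R[i]) (r K : R) (s u : seq 'I_n).

(** Weighted $C^{k,a}$ bounds over a ball: a derivative of order [i] is measured
    against $|x - p_0|^{k + a - i}$.  A map contracting by the factor [m] then
    contracts these bounds by about $m^{k + a}$. *)
Definition weighted r K g :=
  (forall s x, (size s <= k)%N -> nball p0 r x ->
     normc (cpartial s g x) <= K * `|x - p0| `^ ((k - size s)%:R + a)) /\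
  (0 < a -> forall s x y, size s = k -> nball p0 r x -> nball p0 r y ->
     normc (cpartial s g x - cpartial s g y) <= K * `|x - y| `^ a).

Let a0 : 0 <= a. Proof. by case/andP: ha. Qed.
Let a1 : a <= 1. Proof. by case/andP: ha. Qed.

Lemma weighted_le r K r' K' g : r' <= r -> K <= K' -> weighted r K g -> weighted r' K' g.
Proof.
move=> rr KK [h1 h2]; split=> [s x sk xr|a00 s x y sk xr yr].
  by apply: le_trans (h1 s x sk (lt_le_trans xr rr)) _; rewrite ler_wpM2r ?powR_ge0.
apply: le_trans (h2 a00 s x y sk (lt_le_trans xr rr) (lt_le_trans yr rr)) _.
by rewrite ler_wpM2r ?powR_ge0.
Qed.

Lemma weighted_of_jets V g : open V -> V p0 -> cCka k a V g ->
  (forall s, below_order (size s) (Fin k) a -> cpartial s g p0 = 0) ->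
  exists r K, [/\ 0 < r, 0 <= K, nball p0 r `<=` V & weighted r K g].
Proof.
move=> oV Vp [Hr Hi] jets.
have [|r [K [r0 K0 rV h1 h2]]] := real_weights oV Vp ha Hr.
  by move=> s sl; exact: (congr1 (@complex.Re R) (jets s sl)).
have [|r' [K' [r'0 K'0 r'V h1' h2']]] := real_weights oV Vp ha Hi.
  by move=> s sl; exact: (congr1 (@complex.Im R) (jets s sl)).
have mr x : nball p0 (Num.min r r') x -> nball p0 r x /\ nball p0 r' x.
  by rewrite /nball /= lt_min => /andP[].
exists (Num.min r r'), (K + K'); split; rewrite ?lt_min ?r0 ?addr_ge0 //.
  by move=> x /mr[xr _]; exact: rV.
split=> [s x sk /mr[xr xr']|_ s x y sk /mr[xr xr'] /mr[yr yr']];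
  apply: le_trans (normc_le_ReIm _) _; rewrite mulrDl lerD //.
- exact: h1.
- exact: h1'.
- exact: h2.
- exact: h2'.
Qed.

Lemma cpartialD V g g' s x : open V -> (size s <= k)%N -> cCka k a V g -> cCka k a V g' -> V x ->
  cpartial s (fun y => g y + g' y) x = cpartial s g x + cpartial s g' x.
Proof.
move=> oV sk [gr gi] [gr' gi'] Vx; apply/eqP; rewrite eq_complex /=; apply/andP; split; apply/eqP.
  rewrite -(partial_add oV sk gr gr' Vx); congr partial.
  by apply/funext => y; case: (g y); case: (g' y).
rewrite -(partial_add oV sk gi gi' Vx); congr partial.
by apply/funext => y; case: (g y); case: (g' y).
Qed.

Lemma cpartialZ V g c s x : open V -> (size s <= k)%N -> cCka k a V g -> V x ->
  cpartial s (fun y => c * g y) x = c * cpartial s g x.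
Proof.
move=> oV sk [gr gi] Vx; case: c => c d; apply/eqP; rewrite eq_complex /=; apply/andP; split; apply/eqP.
  rewrite -mulNr -(partial_scale c oV sk gr Vx) -(partial_scale (- d) oV sk gi Vx).
  rewrite -(partial_add oV sk (Cka_scale ha c oV gr) (Cka_scale ha (- d) oV gi) Vx).
  by congr partial; apply/funext => y; case: (g y) => ? ? /=; rewrite mulNr.
rewrite -(partial_scale c oV sk gi Vx) -(partial_scale d oV sk gr Vx).
rewrite -(partial_add oV sk (Cka_scale ha c oV gi) (Cka_scale ha d oV gr) Vx).
by congr partial; apply/funext => y; case: (g y) => ? ?.
Qed.

Lemma cCkaD V g g' : open V -> cCka k a V g -> cCka k a V g' -> cCka k a V (fun y => g y + g' y).
Proof.
move=> oV [gr gi] [gr' gi']; split.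
  by apply: Cka_ext (Cka_add oV gr gr') => // x _; case: (g x); case: (g' x).
by apply: Cka_ext (Cka_add oV gi gi') => // x _; case: (g x); case: (g' x).
Qed.

Lemma cCkaZ V g c : open V -> cCka k a V g -> cCka k a V (fun y => c * g y).
Proof.
move=> oV [gr gi]; case: c => c d; split.
  apply: Cka_ext (Cka_add oV (Cka_scale ha c oV gr) (Cka_scale ha (- d) oV gi)) => // x _.
  by case: (g x) => ? ? /=; rewrite mulNr.
apply: Cka_ext (Cka_add oV (Cka_scale ha c oV gi) (Cka_scale ha d oV gr)) => // x _.
by case: (g x).
Qed.

Lemma cpartialB V g g' s x : open V -> (size s <= k)%N -> cCka k a V g -> cCka k a V g' -> V x ->
  cpartial s (fun y => g y - g' y) x = cpartial s g x - cpartial s g' x.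
Proof.
move=> oV sk hg hg' Vx; rewrite -mulN1r -(cpartialZ _ oV sk hg' Vx).
rewrite -(cpartialD oV sk hg (cCkaZ _ oV hg') Vx); congr (cpartial s _ x).
by apply/funext => y; rewrite mulN1r.
Qed.

Lemma cCkaB V g g' : open V -> cCka k a V g -> cCka k a V g' -> cCka k a V (fun y => g y - g' y).
Proof.
move=> oV hg hg'; have := cCkaD oV hg (cCkaZ (-1) oV hg').
by congr cCka; apply/funext => y; rewrite mulN1r.
Qed.

Lemma weightedD r K K' g g' : cCka k a (nball p0 r) g -> cCka k a (nball p0 r) g' ->
  weighted r K g -> weighted r K' g' -> weighted r (K + K') (fun y => g y + g' y).
Proof.
move=> hg hg' [h1 h2] [h1' h2']; have oB := @open_nball R n p0 r.
split=> [s x sk xr|a00 s x y sk xr yr].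
  rewrite (cpartialD oB sk hg hg' xr) mulrDl.
  by apply: le_trans (le_normcD _ _) _; apply: lerD; [exact: h1|exact: h1'].
have sk' : (size s <= k)%N by rewrite sk.
rewrite (cpartialD oB sk' hg hg' xr) (cpartialD oB sk' hg hg' yr) opprD addrACA mulrDl.
by apply: le_trans (le_normcD _ _) _; apply: lerD; [exact: h2|exact: h2'].
Qed.

Lemma weightedZ r K c g : cCka k a (nball p0 r) g ->
  weighted r K g -> weighted r (normc c * K) (fun y => c * g y).
Proof.
move=> hg [h1 h2]; have oB := @open_nball R n p0 r.
split=> [s x sk xr|a00 s x y sk xr yr].
  rewrite (cpartialZ _ oB sk hg xr) normcM -mulrA ler_wpM2l ?normc_ge0 //; exact: h1.
have sk' : (size s <= k)%N by rewrite sk.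
rewrite (cpartialZ _ oB sk' hg xr) (cpartialZ _ oB sk' hg yr) -mulrBr normcM -mulrA.
by rewrite ler_wpM2l ?normc_ge0 //; exact: h2.
Qed.

Lemma cpartial_ext V g g' s x : open V -> (forall y, V y -> g y = g' y) -> V x ->
  cpartial s g x = cpartial s g' x.
Proof.
by move=> oV E Vx; rewrite /cpartial; congr Complex; apply: (partial_ext _ oV _ Vx) => y Vy; rewrite E.
Qed.

Lemma cCka_ext V g g' : open V -> (forall y, V y -> g y = g' y) -> cCka k a V g -> cCka k a V g'.
Proof. by move=> oV E [gr gi]; split; [apply: Cka_ext gr|apply: Cka_ext gi] => // y Vy; rewrite E. Qed.

Lemma cCka_sub V W g : W `<=` V -> cCka k a V g -> cCka k a W g.
Proof. by move=> WV [gr gi]; split; exact: Cka_sub WV _. Qed.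

Lemma weighted_ext r K g g' : (forall y, nball p0 r y -> g y = g' y) -> weighted r K g -> weighted r K g'.
Proof.
move=> E [h1 h2]; have oB := @open_nball R n p0 r.
split=> [s x sk xr|a00 s x y sk xr yr]; first by rewrite -(cpartial_ext _ oB E xr); exact: h1.
by rewrite -(cpartial_ext _ oB E xr) -(cpartial_ext _ oB E yr); exact: h2.
Qed.

(** The factor 2 comes from treating real and imaginary parts separately. *)
Lemma normc_cpartial_mvt g r K s x y : cCka k a (nball p0 r) g -> (size s < k)%N -> 0 <= K ->
  (forall i z, nball p0 r z -> normc (cpartial (i :: s) g z) <= K) ->
  nball p0 r x -> nball p0 r y ->
  normc (cpartial s g x - cpartial s g y) <= 2 * n%:R * K * `|x - y|.
Proof.
move=> [gr gi] sk K0 HK xr yr.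
have inb w : in_box y x w -> nball p0 r w.
  by move/(_ p0) => h; rewrite /nball/=; apply: le_lt_trans h _; rewrite gt_max; apply/andP.
have part (f : 'rV[R]_n -> R) : Cka k a (nball p0 r) f ->
    (forall i z, nball p0 r z -> `|partial (i :: s) f z| <= K) ->
    `|partial s f x - partial s f y| <= n%:R * K * `|x - y|.
  move=> hf hK; have [w j /inb wr|xi [xib ->]] := @mvt_box R n (partial s f) y x.
    exact: Cka_partial_derivable hf wr.
  apply: le_trans (ler_norm_sum _ _ _) _.
  have -> : n%:R * K * `|x - y| = \sum_(j < n) `|x - y| * K.
    by rewrite sumr_const card_ord -[RHS]mulr_natl [`|x - y| * K]mulrC mulrA.
  apply: ler_sum => j _; rewrite normrM; apply: ler_pM => //.
    by have := coord_le_norm (x - y) j; rewrite !mxE.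
  by apply: (hK j); exact: inb.
apply: le_trans (normc_le_ReIm _) _ => /=.
have -> : 2 * n%:R * K * `|x - y| = n%:R * K * `|x - y| + n%:R * K * `|x - y| by ring.
apply: lerD; apply: part => // i z zr; apply: le_trans (HK i z zr).
  exact: le_trans (normc_Re _).
exact: le_trans (normc_Im _).
Qed.

Lemma powR_le_base (d r b c : R) : 0 <= d -> d <= r -> r <= 1 -> 0 <= b -> b <= c -> d `^ c <= r `^ b.
Proof.
move=> d0 dr r1 b0 bc; apply: le_trans (_ : d `^ b <= _); last first.
  by apply: ge0_ler_powR; rewrite ?nnegrE // (le_trans d0).
have [->|dn] := eqVneq d 0.
  have [->|bn] := eqVneq b 0; last first.
    by rewrite !powR0 // gt_eqF // (lt_le_trans _ bc) // lt_neqAle eq_sym bn.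
  by rewrite powRr0; have [->|cn] := eqVneq c 0; rewrite ?powRr0 ?powR0 ?ler01.
by apply: ger_powR => //; rewrite lt_neqAle eq_sym dn d0 /= (le_trans dr).
Qed.

Lemma weighted_sup r K g u y : 0 <= K -> r <= 1 -> weighted r K g -> (size u <= k)%N -> nball p0 r y ->
  normc (cpartial u g y) <= K * r `^ a.
Proof.
move=> K0 r1 [h1 _] uk yr; apply: le_trans (h1 u y uk yr) _; rewrite ler_wpM2l //.
by apply: powR_le_base => //; [exact: ltW|rewrite lerDr].
Qed.

Lemma weighted_lip r K g u y y' : 0 <= K -> r <= 1 -> cCka k a (nball p0 r) g -> weighted r K g ->
  (size u < k)%N -> nball p0 r y -> nball p0 r y' ->
  normc (cpartial u g y - cpartial u g y') <= 2 * n%:R * (K * r `^ a) * `|y - y'|.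
Proof.
move=> K0 r1 hg hw uk yr yr'; apply: (normc_cpartial_mvt hg uk _ _ yr yr').
  by rewrite mulr_ge0 ?powR_ge0.
by move=> i z zr; exact: (@weighted_sup r K g (i :: u) z K0 r1 hw uk zr).
Qed.

End Weighted.

(** The dimension factor [q] in the hypothesis makes [m] a bound for the norm of [B] on
    vectors, hence $m^l$ one for its $l$-th tensor power. *)
Lemma normc_tens (R : realType) (p q : nat) (B : 'I_p -> 'I_q -> R) m K s (T : seq 'I_q -> R[i]) :
  0 <= m -> 0 <= K -> (forall i j, q%:R * `|B i j| <= m) ->
  (forall u, size u = size s -> normc (T u) <= K) ->
  normc (tens (fun i j => (B i j)%:C%C) s T) <= m ^+ size s * K.
Proof.
move=> m0 K0 HB; elim: s T => [|i s IH] T HT /=; first by rewrite expr0 mul1r; exact: HT.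
apply: le_trans (normc_sum _ _ _) _.
have IHj j : normc (tens (fun i j => (B i j)%:C%C) s (fun u => T (j :: u))) <= m ^+ size s * K.
  by apply: IH => u us; apply: HT; rewrite /= us.
case: q B HB T HT IH IHj => [|q] B HB T HT IH IHj.
  by rewrite big_ord0 mulr_ge0 // exprn_ge0.
apply: le_trans (_ : \sum_(j < q.+1) q.+1%:R^-1 * (m ^+ (size s).+1 * K) <= _).
  apply: ler_sum => j _; rewrite normcM normc_realE.
  have -> : q.+1%:R^-1 * (m ^+ (size s).+1 * K) = (q.+1%:R^-1 * m) * (m ^+ size s * K).
    by rewrite exprS !mulrA.
  apply: ler_pM => //; first exact: normc_ge0.
  by rewrite ler_pdivlMl.
by rewrite sumr_const card_ord -[X in X <= _]mulr_natl mulrA mulfV ?mul1r // pnatr_eq0.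
Qed.

Section ChainBounds.
Variables (R : realType) (p n : nat) (k : nat) (a : R).
Hypothesis ha : 0 <= a <= 1.
Variables (V : set 'rV[R]_p) (H : 'rV[R]_p -> 'rV[R]_n).
Hypotheses (oV : open V) (HH : forall j, Cka k a V (fun x => H x 0 j)).

Let a0 : 0 <= a. Proof. by case/andP: ha. Qed.
Let a1 : a <= 1. Proof. by case/andP: ha. Qed.

(** [chain_expansion] for complex-valued functions, with one constant for all
    coefficients. *)
Lemma chain_local s z0 : (size s <= k)%N -> V z0 ->
  exists (I : finType) (co : I -> 'rV[R]_p -> R) (wd : I -> seq 'I_n) rho c,
  [/\ 0 < rho, 0 <= c, nball z0 rho `<=` V &
   [/\ forall i, (size (wd i) <= size s)%N,
      forall W V' g z, open W -> open V' -> V' `<=` V -> (forall x, V' x -> W (H x)) ->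
        cCka k a W g -> V' z ->
        cpartial s (g \o H) z = \sum_i (co i z)%:C%C * cpartial (wd i) g (H z),
      forall z (T : seq 'I_n -> R[i]), V z ->
        \sum_(i | size (wd i) == size s) (co i z)%:C%C * T (wd i) =
          tens (fun i j => (jac H z i j)%:C%C) s T,
      forall i z, nball z0 rho z -> `|co i z| <= c &
      size s = k -> forall i z z', nball z0 rho z -> nball z0 rho z' ->
        `|co i z - co i z'| <= c * `|z - z'| `^ a]].
Proof.
move=> sk Vz0.
have [I [co [wd [szw Hco Hf Ht]]]] := chain_expansion oV ha sk HH.
pose P i r C := (forall z, nball z0 r z -> `|co i z| <= C) /\
  (size s = k -> forall z z', nball z0 r z -> nball z0 r z' ->
     `|co i z - co i z'| <= C * `|z - z'| `^ a).
have [||rho [c [rho0 c0 HP]]] := @fin_uniform R I P.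
- move=> i r r' C C' rr CC [h1 h2]; split=> [z zr|ks z z' zr zr'].
    exact: le_trans (h1 _ (lt_le_trans zr rr)) CC.
  apply: le_trans (h2 ks _ _ (lt_le_trans zr rr) (lt_le_trans zr' rr)) _.
  by rewrite ler_wpM2r ?powR_ge0.
- move=> i; have [r r0 Hr] := continuous_locally_bounded (Cka_continuous (Hco i) Vz0).
  have [ks|ks] := eqVneq (size s) k; last first.
    exists r, (`|co i z0| + 1); split; rewrite ?addr_ge0 //; split => // E.
    by rewrite E eqxx in ks.
  have := Hco i; rewrite ks subnn => -[_ /(_ _ Vz0)[r' r'0 [C C0 HC]]].
  exists (Num.min r r'), (`|co i z0| + 1 + C); split; rewrite ?lt_min ?r0 ?addr_ge0 //.
  split=> [z zr|_ z z' zr zr'].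
    apply: le_trans (Hr _ (lt_le_trans zr _)) _; rewrite ?ge_min ?lexx // lerDl //.
  apply: le_trans (HC _ _ (lt_le_trans zr _) (lt_le_trans zr' _)) _;
    rewrite ?ge_min ?lexx ?orbT // ler_wpM2r ?powR_ge0 // lerDr addr_ge0 //.
have [rV rV0 HrV] := open_norm_ball oV Vz0.
have sub z : nball z0 (Num.min rho rV) z -> nball z0 rho z.
  by move=> zr; apply: lt_le_trans zr _; rewrite ge_min lexx.
exists I, co, wd, (Num.min rho rV), c; split; rewrite ?lt_min ?rho0 //.
  by move=> z zr; apply: HrV; apply: lt_le_trans zr _; rewrite ge_min lexx orbT.
have ReS (F : I -> R[i]) (Q : pred I) : complex.Re (\sum_(i | Q i) F i) = \sum_(i | Q i) complex.Re (F i).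
  by apply: (big_morph (@complex.Re R) (id1 := 0) (op1 := +%R)) => //; case=> ? ? [].
have ImS (F : I -> R[i]) (Q : pred I) : complex.Im (\sum_(i | Q i) F i) = \sum_(i | Q i) complex.Im (F i).
  by apply: (big_morph (@complex.Im R) (id1 := 0) (op1 := +%R)) => //; case=> ? ? [].
split => //.
- move=> W V' g z oW oV' V'V VW [gr gi] Vz.
  have key (f : 'rV[R]_n -> R) : Cka k a W f ->
      partial s (f \o H) z = \sum_i co i z * partial (wd i) f (H z).
    by move=> hf; apply: (Hf W V') => //; exact: Cka0W hf.
  apply/eqP; rewrite eq_complex; apply/andP; split; apply/eqP.
    rewrite ReS [LHS](key _ gr); apply: eq_bigr => i _.
    by rewrite /cpartial /= mul0r subr0.
  rewrite ImS [LHS](key _ gi); apply: eq_bigr => i _.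
  by rewrite /cpartial /= mul0r addr0.
- move=> z T Vz; apply/eqP; rewrite eq_complex; apply/andP; split; apply/eqP.
    rewrite tens_complexify_Re -Ht // ReS; apply: eq_bigr => i _.
    by case: (T _) => ? ? /=; rewrite mul0r subr0.
  rewrite tens_complexify_Im -Ht // ImS; apply: eq_bigr => i _.
  by case: (T _) => ? ? /=; rewrite mul0r addr0.
- by move=> i z /sub zr; have [h _] := HP i; exact: h.
- by move=> ks i z z' /sub zr /sub zr'; have [_ h] := HP i; exact: h.
Qed.

End ChainBounds.

(** * Contraction of weighted bounds *)

Lemma exprM_powR (R : realType) (x b : R) i : 0 <= x -> 0 <= b -> x ^+ i * x `^ b = x `^ (i%:R + b).
Proof.
move=> x0 b0; elim: i => [|i IH]; first by rewrite expr0 mul1r add0r.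
by rewrite exprS -mulrA IH powR_mulS ?addr_ge0 // addrAC natr1.
Qed.

Lemma powR_le_expo (R : realType) (d b c : R) : 0 <= d -> d <= 1 -> 0 <= b -> b <= c -> d `^ c <= d `^ b.
Proof. by move=> d0 d1 b0 bc; exact: powR_le_base. Qed.

Section Contraction.
Variables (R : realType) (n : nat) (p0 : 'rV[R]_n) (k : nat) (a : R).
Hypothesis ha : 0 <= a <= 1.
Variables (V : set 'rV[R]_n) (G : 'rV[R]_n -> 'rV[R]_n) (m r1 : R).
Hypotheses (oV : open V) (k1 : (1 <= k)%N) (HG : forall j, Cka k a V (fun x => G x 0 j)).
Hypotheses (m0 : 0 <= m) (m1 : m <= 1) (r10 : 0 < r1) (r1V : nball p0 r1 `<=` V).
Hypotheses (Gp0 : G p0 = p0).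
Hypothesis jacG : forall x i j, nball p0 r1 x -> n%:R * `|jac G x i j| <= m.

Let a0 : 0 <= a. Proof. by case/andP: ha. Qed.
Let a1 : a <= 1. Proof. by case/andP: ha. Qed.

Lemma nball_contraction x y : nball p0 r1 x -> nball p0 r1 y -> `|G x - G y| <= m * `|x - y|.
Proof.
move=> xr yr; apply: norm_rV_le; first by rewrite mulr_ge0.
have inb w : in_box y x w -> nball p0 r1 w.
  by move/(_ p0) => h; rewrite /nball/=; apply: le_lt_trans h _; rewrite gt_max; apply/andP.
move=> l; rewrite !mxE.
have HC1 := Ck_C1_map k1 oV HG.
have [w j /inb wr|xi [xib ->]] := @mvt_box R n (fun z => G z 0 l) y x.
  by have [_ d _] := HC1 l; apply: d; exact: r1V.
apply: le_trans (ler_norm_sum _ _ _) _.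
apply: le_trans (_ : \sum_(j < n) `|x - y| * (n%:R^-1 * m) <= _).
  have n0 : (0 < n)%N by case: (n) l => // -[].
  apply: ler_sum => j _; rewrite normrM; apply: ler_pM => //.
    by have := coord_le_norm (x - y) j; rewrite !mxE.
  by rewrite ler_pdivlMl ?ltr0n //; apply: (jacG j l); exact: inb.
have n0 : (0 < n)%N by case: (n) l => // -[].
rewrite sumr_const card_ord -[X in X <= _]mulr_natl.
have -> : n%:R * (`|x - y| * (n%:R^-1 * m)) = m * `|x - y| * (n%:R / n%:R) by ring.
by rewrite divff ?mulr1 // pnatr_eq0 -lt0n.
Qed.

Lemma nball_contraction0 x : nball p0 r1 x -> `|G x - p0| <= m * `|x - p0|.
Proof.
move=> xr; rewrite -{1}Gp0; apply: nball_contraction => //.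
by rewrite /nball /= subrr normr0.
Qed.

Lemma nball_stable r x : r <= r1 -> nball p0 r x -> nball p0 r (G x).
Proof.
move=> rr xr; have := nball_contraction0 (lt_le_trans xr rr).
rewrite /nball /= => h; apply: le_lt_trans h _; apply: le_lt_trans xr.
by rewrite ler_piMl.
Qed.

(** The terms of top order in the chain rule contribute exactly $m^{|s|} m^{k + a - |s|}
    = m^{k+a}$. All other terms involve derivatives of [g] of lower order; these are
    smaller by a power of the radius (the first power, or the [a]-th one for the Holder
    bound), so that they fit into $q - m^{k+a}$ on a small ball. *)
Lemma weighted_contraction q : m `^ (k%:R + a) < q ->
  exists r0, [/\ 0 < r0, r0 <= r1 & forall r g K, r <= r0 -> 0 <= K ->
    cCka k a (nball p0 r) g -> weighted p0 k a r K g ->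
    weighted p0 k a r (q * K) (g \o G)].
Proof.
move=> mq.
pose good (s : seq 'I_n) (r0 : R) := forall r g K, r <= r0 -> 0 <= K ->
    cCka k a (nball p0 r) g -> weighted p0 k a r K g ->
  (forall x, nball p0 r x ->
     normc (cpartial s (g \o G) x) <= q * K * `|x - p0| `^ ((k - size s)%:R + a)) /\
  (0 < a -> size s = k -> forall x y, nball p0 r x -> nball p0 r y ->
     normc (cpartial s (g \o G) x - cpartial s (g \o G) y) <= q * K * `|x - y| `^ a).
have Vp0 : V p0 by apply: r1V; rewrite /nball /= subrr normr0.
have e0 : 0 < q - m `^ (k%:R + a) by rewrite subr_gt0.
suff [r0 [C [r00 _ Hr0]]] : exists r0 C : R, [/\ 0 < r0, 0 <= C & forall s : k.-bseq 'I_n, good s r0].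
  exists (Num.min r0 r1); split; rewrite ?lt_min ?r00 ?ge_min ?lexx ?orbT //.
  move=> r g K; rewrite le_min => /andP[rr0 rr1] K0 hg hw; split=> [s x sk xr|apos s x y sk xr yr].
    by have [h _] := Hr0 (Bseq sk) _ _ _ rr0 K0 hg hw; exact: h.
  have sk' : (size s <= k)%N by rewrite sk.
  by have [_ h] := Hr0 (Bseq sk') _ _ _ rr0 K0 hg hw; exact: h.
have [||r0 [C HC]] := @fin_uniform R _ (fun (s : k.-bseq 'I_n) (r0 _ : R) => good s r0); last by exists r0, C.
  by move=> s r r' _ _ rr _ h r2 g K /le_trans/(_ rr); exact: h.
move=> s; have sk := size_bseq s.
have [I [co [wd [rho [c [rho0 c0 rhoV [szw Hf Ht Hc Hch]]]]]]] := chain_local ha oV HG sk Vp0.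
pose N : R := #|I|%:R.
have N0 : 0 <= N by exact: ler0n.
(* D collects the constants of the lower-order terms; on balls of radius t they fit
   into eps *)
pose D := N * c * (2 * n%:R + 1) + 1.
have D0 : 0 < D by rewrite ltr_wpDl // !mulr_ge0 // addr_ge0 // mulr_ge0.
pose eps := q - m `^ (k%:R + a).
have [t [t0 tD]] : exists t, 0 < t /\ (forall r, 0 < r -> r <= t -> D * r <= eps /\ (0 < a -> D * r `^ a <= eps)).
  pose t1 := eps / D; have t10 : 0 < t1 by rewrite divr_gt0.
  have H1 r : r <= t1 -> D * r <= eps by rewrite ler_pdivlMr // mulrC.
  have [apos|an] := ltP 0 a; last first.
    by exists t1; split=> // r _ /H1 h; split => // /lt_le_trans/(_ an); rewrite ltxx.
  exists (Num.min t1 (t1 `^ a^-1)); split; first by rewrite lt_min t10 powR_gt0.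
  move=> r rp; rewrite le_min => /andP[/H1 h1 h2]; split=> // _.
  apply: le_trans (_ : D * t1 <= _); last by rewrite H1.
  rewrite ler_pM2l //; apply: le_trans (_ : (t1 `^ a^-1) `^ a <= _).
    by apply: ge0_ler_powR; rewrite ?nnegrE ?powR_ge0 // ltW.
  by rewrite -powRrM mulVf ?gt_eqF // powRr1 // ltW.
pose r0 := Num.min (Num.min r1 rho) (Num.min t 2^-1).
have r00 : 0 < r0 by rewrite !lt_min r10 rho0 t0 invr_gt0 ltr0n.
exists r0, 0; split => // r g K; rewrite !le_min => /andP[/andP[rr1 rrho] /andP[rt rh]] K0 hg hw.
have oB := @open_nball R n p0 r.
have rV : nball p0 r `<=` V by move=> x xr; apply: r1V; exact: lt_le_trans xr rr1.
have GB x : nball p0 r x -> nball p0 r (G x) by exact: nball_stable.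
have r_le1 : r <= 1 by lra.
have rE x : nball p0 r x -> cpartial s (g \o G) x = \sum_i (co i x)%:C%C * cpartial (wd i) g (G x).
  by move=> xr; apply: (Hf (nball p0 r) (nball p0 r)).
have split_top (F : I -> R[i]) : \sum_i F i =
    \sum_(i | size (wd i) == size s) F i + \sum_(i | size (wd i) != size s) F i.
  by rewrite (bigID (fun i => size (wd i) == size s)).
have [hw1 hw2] := hw.
split=> [x xr|apos sk' x y xr yr].
- have rp : 0 < r := le_lt_trans (normr_ge0 (x - p0)) xr.
  have [Dr _] := tD _ rp rt.
  have xr1 : nball p0 r1 x := lt_le_trans xr rr1.
  set d := `|x - p0|; have d0 : 0 <= d by exact: normr_ge0.
  have dr : d <= r by exact: ltW.
  have Gd : `|G x - p0| <= m * d by exact: nball_contraction0.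
  set e := (k - size s)%:R + a; have ee0 : 0 <= e by rewrite addr_ge0.
  rewrite rE // split_top (Ht x (fun u => cpartial u g (G x))); last exact: rV.
  apply: le_trans (le_normcD _ _) _.
  have -> : q * K * d `^ e = m `^ (k%:R + a) * K * d `^ e + eps * K * d `^ e by rewrite /eps; ring.
  apply: lerD.
    apply: le_trans (@normc_tens R n n (jac G x) m (K * (m * d) `^ e) s _ m0 _ _ _) _.
    + by rewrite mulr_ge0 ?powR_ge0.
    + by move=> i j; exact: jacG.
    + move=> u us; apply: le_trans (hw1 u _ _ (GB _ xr)) _; first by rewrite us.
      by rewrite us ler_wpM2l //; apply: ge0_ler_powR; rewrite ?nnegrE ?mulr_ge0.
    rewrite powRM //.
    have -> : m ^+ size s * (K * (m `^ e * d `^ e)) = (m ^+ size s * m `^ e) * K * d `^ e by ring.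
    by rewrite exprM_powR // /e addrA -natrD subnKC.
  apply: le_trans (normc_sum _ _ _) _.
  apply: le_trans (_ : \sum_(i | size (wd i) != size s) c * (K * (r * d `^ e)) <= _).
    apply: ler_sum => i iw; rewrite normcM normc_realE; apply: ler_pM => //; first exact: normc_ge0.
      by apply: Hc; exact: lt_le_trans xr rrho.
    have ilt : (size (wd i) < size s)%N by rewrite ltn_neqAle iw szw.
    apply: le_trans (hw1 _ _ (leq_trans (szw i) sk) (GB _ xr)) _; rewrite ler_wpM2l //.
    apply: le_trans (_ : d `^ (e + 1) <= _).
      apply: powR_le_base => //.
      + by apply: le_trans Gd _; rewrite ler_piMl.
      + by rewrite (le_trans dr).
      + by rewrite addr_ge0.
      + rewrite /e addrAC lerD2r natr1 ler_nat ltn_sub2l // (leq_trans ilt) //.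
    by rewrite -powR_mulS // ler_wpM2r ?powR_ge0.
  rewrite sumr_const -[X in X <= _]mulr_natl.
  apply: le_trans (_ : N * (c * (K * (r * d `^ e))) <= _).
    by rewrite ler_wpM2r ?mulr_ge0 ?powR_ge0 // ?ler_nat ?max_card // ltW.
  have -> : N * (c * (K * (r * d `^ e))) = (N * c * r) * (K * d `^ e) by ring.
  rewrite -[eps * K * _]mulrA ler_wpM2r ?mulr_ge0 ?powR_ge0 //; apply: le_trans Dr.
  rewrite ler_wpM2r ?(ltW rp) // /D; have : 0 <= N * c * (2 * n%:R) by rewrite !mulr_ge0.
  by lra.
- have rp : 0 < r := le_lt_trans (normr_ge0 (x - p0)) xr.
  have [_ /(_ apos) Dr] := tD _ rp rt.
  have xr1 : nball p0 r1 x := lt_le_trans xr rr1.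
  have yr1 : nball p0 r1 y := lt_le_trans yr rr1.
  set d := `|x - y|; have d0 : 0 <= d by exact: normr_ge0.
  have d1 : d <= 1.
    rewrite /d -(subrKA p0) (le_trans (ler_normD _ _)) // (distrC p0).
    by move: xr yr; rewrite /nball /=; lra.
  have dda : d <= d `^ a.
    by rewrite -[leLHS]powRr1 //; apply: powR_le_expo => //; rewrite ?a1.
  have Gd : `|G x - G y| <= m * d by exact: nball_contraction.
  rewrite rE // rE //.
  pose T i := cpartial (wd i) g (G x) - cpartial (wd i) g (G y).
  have -> : \sum_i (co i x)%:C%C * cpartial (wd i) g (G x) - \sum_i (co i y)%:C%C * cpartial (wd i) g (G y) =
      \sum_i (co i x)%:C%C * T i + \sum_i ((co i x)%:C%C - (co i y)%:C%C) * cpartial (wd i) g (G y).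
    rewrite -sumrB -big_split; apply: eq_bigr => i _; rewrite /T /=; ring.
  rewrite split_top -addrA.
  have -> : q * K * d `^ a = m `^ (k%:R + a) * K * d `^ a + eps * K * d `^ a by rewrite /eps; ring.
  apply: le_trans (le_normcD _ _) _; apply: lerD.
    rewrite (Ht x (fun u => cpartial u g (G x) - cpartial u g (G y))); last exact: rV.
    apply: le_trans (@normc_tens R n n (jac G x) m (K * (m * d) `^ a) s _ m0 _ _ _) _.
    + by rewrite mulr_ge0 ?powR_ge0.
    + by move=> i j; exact: jacG.
    + move=> u us; apply: le_trans (hw2 apos u _ _ _ (GB _ xr) (GB _ yr)) _; first by rewrite us.
      by rewrite ler_wpM2l //; apply: ge0_ler_powR; rewrite ?nnegrE ?mulr_ge0.
    rewrite powRM //.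
    have -> : m ^+ size s * (K * (m `^ a * d `^ a)) = (m ^+ size s * m `^ a) * K * d `^ a by ring.
    by rewrite exprM_powR // sk'.
  apply: le_trans (_ : N * (c * (2 * n%:R * (K * r `^ a) * d `^ a)) + N * (c * (K * r `^ a) * d `^ a) <= _).
    apply: le_trans (le_normcD _ _) _; apply: lerD; apply: le_trans (normc_sum _ _ _) _.
      apply: le_trans (_ : \sum_(i | size (wd i) != size s) c * (2 * n%:R * (K * r `^ a) * d `^ a) <= _).
        apply: ler_sum => i iw; rewrite normcM normc_realE; apply: ler_pM => //; first exact: normc_ge0.
          by apply: Hc; exact: lt_le_trans xr rrho.
        have ilt : (size (wd i) < k)%N by rewrite -sk' ltn_neqAle iw szw.
        apply: le_trans (weighted_lip ha K0 r_le1 hg hw ilt (GB _ xr) (GB _ yr)) _.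
        rewrite ler_wpM2l ?mulr_ge0 ?powR_ge0 //; apply: le_trans Gd _.
        by apply: le_trans dda; rewrite ler_piMl.
      rewrite sumr_const -[X in X <= _]mulr_natl ler_wpM2r ?ler_nat ?max_card //.
      by rewrite !mulr_ge0 ?powR_ge0.
    apply: le_trans (_ : \sum_(i : I) c * (K * r `^ a) * d `^ a <= _); last first.
      by rewrite sumr_const -[X in X <= _]mulr_natl.
    apply: ler_sum => i _; rewrite normcM -rmorphB normc_realE mulrAC; apply: ler_pM => //.
    + exact: normc_ge0.
    + by apply: Hch => //; [exact: lt_le_trans xr rrho|exact: lt_le_trans yr rrho].
    + by apply: (weighted_sup ha K0 r_le1 hw _ (GB _ yr)); apply: leq_trans (szw i) sk.
  have -> : N * (c * (2 * n%:R * (K * r `^ a) * d `^ a)) + N * (c * (K * r `^ a) * d `^ a) =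
     (N * c * (2 * n%:R + 1) * r `^ a) * (K * d `^ a) by ring.
  rewrite -[eps * K * _]mulrA ler_wpM2r ?mulr_ge0 ?powR_ge0 //; apply: le_trans Dr.
  by rewrite ler_wpM2r ?powR_ge0 // lerDl.
Qed.

End Contraction.

(** * Composition and limits of weighted functions *)

Lemma cCka_comp (R : realType) (p n k : nat) (a : R) (V : set 'rV[R]_p) (W : set 'rV[R]_n)
    (H : 'rV[R]_p -> 'rV[R]_n) (g : 'rV[R]_n -> R[i]) :
  (1 <= k)%N -> 0 <= a <= 1 -> open V -> open W -> (forall x, V x -> W (H x)) ->
  (forall j, Cka k a V (fun x => H x 0 j)) -> cCka k a W g -> cCka k a V (g \o H).
Proof.
move=> k1 ha oV oW VW HH [gr gi]; split; first exact: (Cka_comp k1 ha oV oW VW HH gr).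
exact: (Cka_comp k1 ha oV oW VW HH gi).
Qed.

Section CompositionBound.
Variables (R : realType) (p n : nat) (p0 : 'rV[R]_n) (k : nat) (a r : R).
Hypothesis ha : 0 <= a <= 1.
Variables (V : set 'rV[R]_p) (H : 'rV[R]_p -> 'rV[R]_n).
Hypotheses (oV : open V) (k1 : (1 <= k)%N) (HH : forall j, Cka k a V (fun x => H x 0 j)).
Hypotheses (r1 : r <= 1) (Hr : forall z, V z -> nball p0 r (H z)).

Let a0 : 0 <= a. Proof. by case/andP: ha. Qed.

(** On a ball of radius at most 1 all weights are at most 1, so that only the
    coefficients of the chain rule, which do not depend on [g], enter [C]. *)
Lemma composition_bound z0 : V z0 ->
  exists rho C, [/\ 0 < rho, 0 <= C & forall g K, 0 <= K ->
    cCka k a (nball p0 r) g -> weighted p0 k a r K g ->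
    (forall s z, (size s <= k)%N -> nball z0 rho z -> normc (cpartial s (g \o H) z) <= C * K) /\
    (0 < a -> forall s z z', size s = k -> nball z0 rho z -> nball z0 rho z' ->
      normc (cpartial s (g \o H) z - cpartial s (g \o H) z') <= C * K * `|z - z'| `^ a)].
Proof.
move=> Vz0.
pose good (s : seq 'I_p) rho C := forall g K, 0 <= K ->
    cCka k a (nball p0 r) g -> weighted p0 k a r K g ->
    (forall z, nball z0 rho z -> normc (cpartial s (g \o H) z) <= C * K) /\
    (0 < a -> size s = k -> forall z z', nball z0 rho z -> nball z0 rho z' ->
      normc (cpartial s (g \o H) z - cpartial s (g \o H) z') <= C * K * `|z - z'| `^ a).
suff [rho [C [rho0 C0 Hg]]] : exists rho C : R, [/\ 0 < rho, 0 <= C & forall s : k.-bseq 'I_p, good s rho C].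
  exists rho, C; split=> // g K K0 hg hw; split=> [s z sk zr|apos s z z' sk zr zr'].
    by have [h _] := Hg (Bseq sk) _ _ K0 hg hw; exact: h.
  have sk' : (size s <= k)%N by rewrite sk.
  by have [_ h] := Hg (Bseq sk') _ _ K0 hg hw; exact: h.
have [||rho [C HC]] := @fin_uniform R _ (fun (s : k.-bseq 'I_p) rho C => good s rho C); last by exists rho, C.
  move=> s rho rho' C C' rr CC h g K K0 hg hw; have [h1 h2] := h g K K0 hg hw.
  split=> [z zr|apos sk z z' zr zr'].
    by apply: le_trans (h1 _ (lt_le_trans zr rr)) _; rewrite ler_wpM2r.
  apply: le_trans (h2 apos sk _ _ (lt_le_trans zr rr) (lt_le_trans zr' rr)) _.
  by rewrite ler_wpM2r ?powR_ge0 // ler_wpM2r.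
move=> s; have sk := size_bseq s.
have [I [co [wd [rho1 [c [rho10 c0 rhoV [szw Hf _ Hc Hch]]]]]]] := chain_local ha oV HH sk Vz0.
have [rho2 rho20 [L L0 HL]] := C1_map_lipschitz oV (Ck_C1_map k1 oV HH) Vz0.
pose rho := Num.min (Num.min rho1 rho2) 2^-1.
have rhoP z : nball z0 rho z -> [/\ nball z0 rho1 z, nball z0 rho2 z, nball z0 2^-1 z & V z].
  rewrite /nball /= !lt_min => /andP[/andP[h1 h2] h3]; split => //; exact: rhoV.
pose N : R := #|I|%:R.
have N0 : 0 <= N by exact: ler0n.
pose C := N * c * (L `^ a + 2 * n%:R * L + 2).
have C0 : 0 <= C by rewrite !mulr_ge0 // !addr_ge0 ?powR_ge0 // !mulr_ge0.
exists rho, C; split=> //; first by rewrite !lt_min rho10 rho20 invr_gt0 ltr0n.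
move=> g K K0 hg hw.
have oB := @open_nball R n p0 r.
have Kr u y : (size u <= k)%N -> nball p0 r y -> normc (cpartial u g y) <= K.
  move=> uk yr; have r0 : 0 < r := le_lt_trans (normr_ge0 _) yr.
  apply: le_trans (weighted_sup ha K0 r1 hw uk yr) _; rewrite -[leRHS]mulr1 ler_wpM2l //.
  by rewrite -(powRr0 r); apply: powR_le_expo => //; exact: ltW.
have HE z : V z -> cpartial s (g \o H) z = \sum_i (co i z)%:C%C * cpartial (wd i) g (H z).
  by move=> Vz; apply: (Hf (nball p0 r) V).
have ck i : (size (wd i) <= k)%N by exact: leq_trans (szw i) sk.
have D1 : 1 <= L `^ a + 2 * n%:R * L + 2.
  have : 0 <= L `^ a by exact: powR_ge0.
  have : 0 <= 2 * n%:R * L by rewrite !mulr_ge0.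
  lra.
split=> [z /rhoP[z1 z2 z3 Vz]|apos sk' z z' /rhoP[z1 z2 z3 Vz] /rhoP[z'1 z'2 z'3 Vz']].
  rewrite HE //; apply: le_trans (normc_sum _ _ _) _.
  apply: le_trans (_ : \sum_(i : I) c * K <= _).
    apply: ler_sum => i _; rewrite normcM normc_realE; apply: ler_pM => //; first exact: normc_ge0.
      exact: Hc.
    by apply: Kr => //; exact: Hr.
  rewrite sumr_const -[X in X <= _]mulr_natl -/N mulrA ler_wpM2r //.
  by rewrite /C -[X in X <= _]mulr1 ler_wpM2l // mulr_ge0.
set d := `|z - z'|; have d0 : 0 <= d by exact: normr_ge0.
have d1 : d <= 1.
  rewrite /d -(subrKA z0) (le_trans (ler_normD _ _)) // (distrC z0).
  by move: z3 z'3; rewrite /nball /=; lra.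
have dda : d <= d `^ a.
  by rewrite -[leLHS]powRr1 //; apply: powR_le_expo => //; case/andP: ha.
have Hd : `|H z - H z'| <= L * d by exact: HL.
rewrite HE // HE //.
pose T i := cpartial (wd i) g (H z) - cpartial (wd i) g (H z').
have -> : \sum_i (co i z)%:C%C * cpartial (wd i) g (H z) - \sum_i (co i z')%:C%C * cpartial (wd i) g (H z') =
    \sum_i ((co i z)%:C%C * T i + ((co i z)%:C%C - (co i z')%:C%C) * cpartial (wd i) g (H z')).
  rewrite -sumrB; apply: eq_bigr => i _; rewrite /T /=; ring.
apply: le_trans (normc_sum _ _ _) _.
apply: le_trans (_ : \sum_(i : I) c * ((L `^ a + 2 * n%:R * L + 2) * K * d `^ a) <= _); last first.
  rewrite sumr_const -[X in X <= _]mulr_natl -/N /C.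
  by rewrite le_eqVlt; apply/orP; left; apply/eqP; ring.
apply: ler_sum => i _; apply: le_trans (le_normcD _ _) _; rewrite !normcM normc_realE -rmorphB normc_realE.
have -> : c * ((L `^ a + 2 * n%:R * L + 2) * K * d `^ a) =
   c * ((L `^ a + 2 * n%:R * L + 1) * K * d `^ a) + c * d `^ a * K by ring.
apply: lerD; apply: ler_pM => //; try exact: normc_ge0.
- exact: Hc.
- have TL : normc (T i) <= (L `^ a + 2 * n%:R * L) * K * d `^ a.
    have [wk|wk] := eqVneq (size (wd i)) k.
      have [_ hw2] := hw.
      apply: le_trans (hw2 apos _ _ _ wk (Hr Vz) (Hr Vz')) _.
      apply: le_trans (_ : K * (L * d) `^ a <= _).
        by rewrite ler_wpM2l //; apply: ge0_ler_powR; rewrite ?nnegrE ?mulr_ge0.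
      rewrite powRM // mulrA [K * _]mulrC ler_wpM2r ?powR_ge0 // ler_wpM2r // lerDl.
      by rewrite !mulr_ge0.
    have wlt : (size (wd i) < k)%N by rewrite ltn_neqAle wk ck.
    apply: le_trans (normc_cpartial_mvt hg wlt K0 _ (Hr Vz) (Hr Vz')) _.
      by move=> j y yr; exact: Kr.
    apply: le_trans (_ : 2 * n%:R * K * (L * d `^ a) <= _).
      rewrite ler_wpM2l ?mulr_ge0 //; apply: le_trans Hd _; by rewrite ler_wpM2l.
    have -> : 2 * n%:R * K * (L * d `^ a) = (2 * n%:R * L) * K * d `^ a by ring.
    by rewrite ler_wpM2r ?powR_ge0 // ler_wpM2r // lerDr powR_ge0.
  apply: le_trans TL _; rewrite ler_wpM2r ?powR_ge0 // ler_wpM2r // lerDl //.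
- exact: Hch.
- by apply: Kr => //; exact: Hr.
Qed.

End CompositionBound.

Section WeightedLimit.
Variables (R : realType) (n : nat) (p0 : 'rV[R]_n) (k : nat) (a r : R).
Hypotheses (ha : 0 <= a <= 1) (r1 : r <= 1).

(** Let the second index of the Cauchy estimate tend to infinity. *)
Lemma cauchy_rate_cvg (u eps : nat -> R) : eps j @[j --> \oo] --> 0 ->
  (forall i j, (i <= j)%N -> `|u i - u j| <= eps i) ->
  exists l, u j @[j --> \oo] --> l /\ forall i, `|u i - l| <= eps i.
Proof.
move=> e0 H.
have cu : cvgn u.
  apply: cauchy_cvg; apply/cauchyP => e ep.
  have e2 : 0 < e / 2 by rewrite divr_gt0.
  have /cvgrPdist_lt/(_ _ e2)[N _ HN] := e0.
  exists (u N); exists N => // j /= Nj; rewrite -ball_normE /=.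
  apply: le_lt_trans (H _ _ Nj) _; have := HN N (leqnn N); rewrite sub0r normrN.
  by move/(le_lt_trans (ler_norm _)); lra.
exists (limn u); split => // i.
have c1 : `|u i - u j| @[j --> \oo] --> `|u i - limn u|.
  by apply: cvg_norm; apply: cvgB => //; exact: cvg_cst.
apply: (cvgr_to_le c1); exists i => // j /= ij; exact: H.
Qed.

(** By the mean value theorem for the differences of the [f j], their difference
    quotients converge uniformly, so the limits in [j] and in the increment can be
    exchanged. *)
Lemma uniform_limit_derivable V (f : nat -> 'rV[R]_n -> R) (g h : 'rV[R]_n -> R) (eps : nat -> R) i x :
  open V -> V x -> eps j @[j --> \oo] --> 0 ->
  (forall y, V y -> f j y @[j --> \oo] --> g y) ->
  (forall j y, V y -> derivable (f j) y (row_unit i)) ->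
  (forall j y, V y -> `|partial [:: i] (f j) y - h y| <= eps j) ->
  derivable g x (row_unit i) /\ partial [:: i] g x = h x.
Proof.
move=> oV Vx e0 fg df dh; have [rV rV0 HV] := open_norm_ball oV Vx.
suff c : t^-1 *: (g (t *: (row_unit i) + x) - g x) @[t --> (0 : R)^'] --> h x.
  by split; [apply/cvg_ex; exists (h x)|exact: (cvg_lim (@Rhausdorff R) c)].
apply/cvgrPdist_le => e ep.
have e4 : 0 < e / 4 by rewrite divr_gt0.
have [N HN] : exists N, forall j, (N <= j)%N -> eps j <= e / 4.
  have /cvgrPdist_lt/(_ _ e4)[N _ HN] := e0; exists N => j Nj.
  by have := HN j Nj; rewrite sub0r normrN => /(le_lt_trans (ler_norm _))/ltW.
have nu : `|(row_unit i : 'rV[R]_n)| <= 1.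
  by apply: norm_rV_le => // l; rewrite !mxE; case: (_ && _); rewrite ?normr1 ?normr0.
have := df N x Vx => /cvg_ex[l] dl.
have lE : l = partial [:: i] (f N) x by apply/esym; exact: (cvg_lim (@Rhausdorff R) dl).
rewrite {}lE in dl.
have /cvgrPdist_le/(_ _ e4) dl' := dl.
near=> t.
have t0 : t != 0 by near: t; exact: nbhs_dnbhs_neq.
have tr : `|t| < rV by near: t; exact: dnbhs0_lt.
have inV s : `|s| <= `|t| -> V (x + s *: row_unit i).
  move=> st; apply: HV; rewrite addrAC subrr add0r normrZ.
  by apply: le_lt_trans tr; rewrite -[leRHS]mulr1 ler_pM.
have Vt : V (t *: row_unit i + x) by rewrite addrC; exact: inV.
have diff j : (N <= j)%N ->
    `|(f N (t *: row_unit i + x) - f N x) - (f j (t *: row_unit i + x) - f j x)| <= `|t| * (e / 2).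
  move=> Nj; pose F y := f N y - f j y.
  have bt s : Num.min 0 t <= s <= Num.max 0 t -> `|s| <= `|t|.
    case: (leP 0 t) => h0 /andP[s1 s2].
      by rewrite !ger0_norm // (le_trans _ s2).
    by rewrite (ltr0_norm h0) ler_norml opprK s1 (le_trans s2) // oppr_ge0 ltW.
  have dF s : Num.min 0 t <= s <= Num.max 0 t -> derivable F (x + s *: row_unit i) (row_unit i).
    by move=> /bt/inV Vs; apply: derivableB; exact: df.
  have [s [/bt/inV Vs E]] := mvt_coord dF.
  have -> : (f N (t *: row_unit i + x) - f N x) - (f j (t *: row_unit i + x) - f j x) =
    F (x + t *: row_unit i) - F x by rewrite /F [t *: _ + x]addrC; ring.
  rewrite E normrM ler_wpM2l // deriveB; [|exact: df|exact: df].
  have := dh N _ Vs; have := dh j _ Vs; rewrite /partial /=.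
  have := HN _ Nj; have := HN _ (leqnn N).
  move: ('D_(row_unit i) (f N) _) ('D_(row_unit i) (f j) _) (h _) => A B D E1 E2.
  rewrite !ler_norml => /andP[? ?] /andP[? ?]; apply/andP; split; lra.
have diff_lim : `|(f N (t *: row_unit i + x) - f N x) - (g (t *: row_unit i + x) - g x)| <= `|t| * (e / 2).
  have cc : `|(f N (t *: row_unit i + x) - f N x) - (f j (t *: row_unit i + x) - f j x)| @[j --> \oo] -->
      `|(f N (t *: row_unit i + x) - f N x) - (g (t *: row_unit i + x) - g x)|.
    apply: cvg_norm; apply: cvgB; first exact: cvg_cst.
    by apply: cvgB; exact: fg.
  by apply: (cvgr_to_le cc); exists N => // j /= Nj; exact: diff.
have q1 : `|partial [:: i] (f N) x - t^-1 *: (f N (t *: row_unit i + x) - f N x)| <= e / 4.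
  by near: t; exact: dl'.
have q2 : `|t^-1 *: (f N (t *: row_unit i + x) - f N x) - t^-1 *: (g (t *: row_unit i + x) - g x)| <= e / 2.
  by rewrite -scalerBr normrZ normfV ler_pdivrMl ?normr_gt0.
have := dh N x Vx; have := HN N (leqnn N); move: q1 q2.
move: (t^-1 *: _) (t^-1 *: _) (partial _ _ _) (h x) => A B D E.
rewrite !ler_norml => /andP[? ?] /andP[? ?] ? /andP[? ?]; apply/andP; split; lra.
Unshelve. all: by end_near. Qed.

End WeightedLimit.

Section RealLimit.
Variables (R : realType) (n : nat) (k : nat) (a : R) (B : set 'rV[R]_n).
Hypotheses (ha : 0 <= a <= 1) (oB : open B).
Variables (f : nat -> 'rV[R]_n -> R) (eps : nat -> R).
Hypotheses (Hf : forall j, Cka k a B (f j)) (e0 : eps j @[j --> \oo] --> 0).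
Hypothesis Hsup : forall i j s x, (i <= j)%N -> (size s <= k)%N -> B x ->
  `|partial s (f i) x - partial s (f j) x| <= eps i.
Hypothesis Hhol : 0 < a -> forall i j s x y, (i <= j)%N -> size s = k -> B x -> B y ->
  `|(partial s (f i) x - partial s (f j) x) - (partial s (f i) y - partial s (f j) y)|
    <= eps i * `|x - y| `^ a.

(** Completeness of $C^{k,a}$: derivatives pass to the uniform limit word by word, and
    the Holder bound of the differences from [f 0] passes to the limit. *)
Lemma real_limit : exists g, Cka k a B g /\ forall s x, (size s <= k)%N -> B x ->
  partial s (f j) x @[j --> \oo] --> partial s g x.
Proof.
have [a0 a1] := andP ha.
pose gs s x := limn (fun j => partial s (f j) x).
have lim_gs s x : (size s <= k)%N -> B x ->
    partial s (f j) x @[j --> \oo] --> gs s x /\ forall i, `|partial s (f i) x - gs s x| <= eps i.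
  move=> sk Bx; have [|l [cl hl]] := @cauchy_rate_cvg R (fun j => partial s (f j) x) eps e0.
    by move=> i j ij; exact: Hsup.
  by have -> : gs s x = l by exact: (cvg_lim (@Rhausdorff R) cl).
pose g := gs [::].
have gE s : (size s <= k)%N -> forall x, B x -> partial s g x = gs s x.
  elim: s => [//|i s IH] sk x Bx.
  have [_ <-] : derivable (gs s) x (row_unit i) /\ partial [:: i] (gs s) x = gs (i :: s) x.
    apply: (@uniform_limit_derivable R n B (fun j => partial s (f j)) (gs s) (gs (i :: s)) eps) => //.
    - by move=> y By; have [] := lim_gs s y (ltnW sk) By.
    - by move=> j y By; exact: Cka_partial_derivable sk (Hf j) By.
    - by move=> j y By; have [_] := lim_gs (i :: s) y sk By; apply.
  apply: near_eq_derive; apply: (open_near oB Bx) => y; exact: IH (ltnW sk) y.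
have dg s i x : (size s < k)%N -> B x -> derivable (partial s g) x (row_unit i).
  move=> sk Bx.
  have [d _] : derivable (gs s) x (row_unit i) /\ partial [:: i] (gs s) x = gs (i :: s) x.
    apply: (@uniform_limit_derivable R n B (fun j => partial s (f j)) (gs s) (gs (i :: s)) eps) => //.
    - by move=> y By; have [] := lim_gs s y (ltnW sk) By.
    - by move=> j y By; exact: Cka_partial_derivable sk (Hf j) By.
    - by move=> j y By; have [_] := lim_gs (i :: s) y sk By; apply.
  apply: near_eq_derivable d; apply: (open_near oB Bx) => y By.
  by rewrite gE // ltnW.
have cg s x : (size s <= k)%N -> B x -> {for x, continuous (partial s g)}.
  move=> sk Bx; apply: norm_ball_continuousR => e ep.
  have e3 : 0 < e / 3 by rewrite divr_gt0.
  have /cvgrPdist_lt/(_ _ e3)[N _ HN] := e0.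
  have eN : eps N <= e / 3.
    by have := HN N (leqnn N); rewrite sub0r normrN => /(le_lt_trans (ler_norm _))/ltW.
  have [r r0 Hr] := continuous_norm_ballR (Cka_continuous (Cka_partial sk (Hf N)) Bx) e3.
  have [r' r'0 HB] := open_norm_ball oB Bx.
  exists (Num.min r r'); first by rewrite lt_min r0.
  move=> y; rewrite lt_min => /andP[/Hr/ltW h1 /HB By].
  rewrite !gE //; have [_ /(_ N) h2] := lim_gs s x sk Bx; have [_ /(_ N) h3] := lim_gs s y sk By.
  move: h1 h2 h3; move: (partial s (f N) y) (partial s (f N) x) (gs s y) (gs s x) => A1 A2 A3 A4.
  rewrite !ler_norml => /andP[? ?] /andP[? ?] /andP[? ?]; apply/andP; split; lra.
exists g; split; last by move=> s x sk Bx; rewrite gE //; have [] := lim_gs s x sk Bx.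
apply/CkaP; split=> [s|s sk x Bx].
  by split=> [sk x Bx|sk x i Bx]; [exact: cg|exact: dg].
have sk' : (size s <= k)%N by rewrite sk.
have [_ /(_ s sk x Bx)[r r0 [C C0 HC]]] := (CkaP k a B (f 0%N)).1 (Hf 0%N).
have [r' r'0 HB] := open_norm_ball oB Bx.
have ep0 : 0 <= eps 0%N by apply: le_trans (Hsup (leqnn 0) sk' Bx); exact: normr_ge0.
exists (Num.min r r'); first by rewrite lt_min r0.
exists (C + 2 * eps 0%N); first by rewrite addr_ge0 // mulr_ge0.
move=> y z; rewrite !lt_min => /andP[yr /HB By] /andP[zr /HB Bz].
have [cy hy] := lim_gs s y sk' By; have [cz hz] := lim_gs s z sk' Bz.
rewrite !gE //.
have -> : gs s y - gs s z = (partial s (f 0%N) y - partial s (f 0%N) z) -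
    ((partial s (f 0%N) y - gs s y) - (partial s (f 0%N) z - gs s z)) by ring.
apply: le_trans (ler_normB _ _) _; rewrite mulrDl; apply: lerD; first exact: HC.
have [apos|an] := ltP 0 a; last first.
  have -> : a = 0 by apply/eqP; rewrite eq_le an a0.
  rewrite powRr0 mulr1; apply: le_trans (ler_normB _ _) _.
  by have := hy 0%N; have := hz 0%N; lra.
apply: le_trans (_ : eps 0%N * `|y - z| `^ a <= _); last first.
  by rewrite ler_wpM2r ?powR_ge0 //; lra.
have cc : `|(partial s (f 0%N) y - partial s (f j) y) - (partial s (f 0%N) z - partial s (f j) z)| @[j --> \oo] -->
    `|(partial s (f 0%N) y - gs s y) - (partial s (f 0%N) z - gs s z)|.
  by apply: cvg_norm; apply: cvgB; apply: cvgB => //; exact: cvg_cst.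
by apply: (cvgr_to_le cc); exists 0%N => // j _ /=; exact: Hhol.
Qed.

End RealLimit.

Lemma normc_limit_le (R : realType) (u : nat -> R[i]) (z w : R[i]) b :
  complex.Re (u j) @[j --> \oo] --> complex.Re z -> complex.Im (u j) @[j --> \oo] --> complex.Im z ->
  (\forall j \near \oo, normc (w - u j) <= b) -> normc (w - z) <= b.
Proof.
move=> cr ci H; apply/ler_addgt0Pr => e e0.
have e2 : 0 < e / 2 by rewrite divr_gt0.
have /cvgrPdist_le/(_ _ e2) Hr := cr; have /cvgrPdist_le/(_ _ e2) Hi := ci.
near \oo => j.
have h0 : normc (w - u j) <= b by near: j.
have h1 : `|complex.Re z - complex.Re (u j)| <= e / 2 by near: j.
have h2 : `|complex.Im z - complex.Im (u j)| <= e / 2 by near: j.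
rewrite -(subrKA (u j)); apply: le_trans (le_normcD _ _) _; apply: lerD => //.
rewrite normc_dist; apply: le_trans (normc_le_ReIm _) _.
by move: h1 h2; case: (z) => ? ?; case: (u j) => ? ? /=; lra.
Unshelve. all: by end_near. Qed.

Section WeightedLimit.
Variables (R : realType) (n : nat) (p0 : 'rV[R]_n) (k : nat) (a r : R).
Hypotheses (ha : 0 <= a <= 1) (r1 : r <= 1).

(** Completeness for the weighted bounds, with the rate of the Cauchy sequence kept. *)
Lemma weighted_limit (F : nat -> 'rV[R]_n -> R[i]) (eps : nat -> R) :
  (forall j, cCka k a (nball p0 r) (F j)) -> (forall j, 0 <= eps j) ->
  eps j @[j --> \oo] --> 0 ->
  (forall i j, (i <= j)%N -> weighted p0 k a r (eps i) (fun x => F i x - F j x)) ->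
  exists g, cCka k a (nball p0 r) g /\
    forall i, weighted p0 k a r (eps i) (fun x => F i x - g x).
Proof.
move=> HF ep0 e0 Hw; have oB := @open_nball R n p0 r; have a0 : 0 <= a by case/andP: ha.
have sup1 i j s x : (i <= j)%N -> (size s <= k)%N -> nball p0 r x ->
    normc (cpartial s (F i) x - cpartial s (F j) x) <= eps i.
  move=> ij sk xr; rewrite -(cpartialB ha oB sk (HF i) (HF j) xr).
  have [h _] := Hw i j ij; apply: le_trans (h s x sk xr) _.
  rewrite -[leRHS]mulr1 ler_wpM2l // -(powRr0 `|x - p0|); apply: powR_le_expo => //.
    by apply: ltW; apply: lt_le_trans xr r1.
  by rewrite addr_ge0.
have hol1 i j s x y : 0 < a -> (i <= j)%N -> size s = k -> nball p0 r x -> nball p0 r y ->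
    normc ((cpartial s (F i) x - cpartial s (F j) x) - (cpartial s (F i) y - cpartial s (F j) y))
      <= eps i * `|x - y| `^ a.
  move=> apos ij sk xr yr; have sk' : (size s <= k)%N by rewrite sk.
  rewrite -(cpartialB ha oB sk' (HF i) (HF j) xr) -(cpartialB ha oB sk' (HF i) (HF j) yr).
  by have [_ h] := Hw i j ij; exact: h.
have [gr [Hgr cr]] : exists g, Cka k a (nball p0 r) g /\ forall s x, (size s <= k)%N -> nball p0 r x ->
    partial s (fun y => complex.Re (F j y)) x @[j --> \oo] --> partial s g x.
  apply: (@real_limit R n k a _ ha oB (fun j y => complex.Re (F j y)) eps) => //.
  - by move=> j; case: (HF j).
  - by move=> i j s x ij sk xr; apply: le_trans (normc_Re _) (sup1 i j s x ij sk xr).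
  - by move=> apos i j s x y ij sk xr yr; apply: le_trans (normc_Re _) (hol1 i j s x y apos ij sk xr yr).
have [gi [Hgi ci]] : exists g, Cka k a (nball p0 r) g /\ forall s x, (size s <= k)%N -> nball p0 r x ->
    partial s (fun y => complex.Im (F j y)) x @[j --> \oo] --> partial s g x.
  apply: (@real_limit R n k a _ ha oB (fun j y => complex.Im (F j y)) eps) => //.
  - by move=> j; case: (HF j).
  - by move=> i j s x ij sk xr; apply: le_trans (normc_Im _) (sup1 i j s x ij sk xr).
  - by move=> apos i j s x y ij sk xr yr; apply: le_trans (normc_Im _) (hol1 i j s x y apos ij sk xr yr).
pose g x := Complex (gr x) (gi x).
have Hg : cCka k a (nball p0 r) g by [].
exists g; split=> // i; split=> [s x sk xr|apos s x y sk xr yr].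
  rewrite (cpartialB ha oB sk (HF i) Hg xr).
  apply: (@normc_limit_le R (fun j => cpartial s (F j) x)); [exact: cr|exact: ci|].
  exists i => // j ij; have [h _] := Hw i j ij.
  by have := h s x sk xr; rewrite (cpartialB ha oB sk (HF i) (HF j) xr).
have sk' : (size s <= k)%N by rewrite sk.
rewrite (cpartialB ha oB sk' (HF i) Hg xr) (cpartialB ha oB sk' (HF i) Hg yr).
have -> : cpartial s (F i) x - cpartial s g x - (cpartial s (F i) y - cpartial s g y) =
  (cpartial s (F i) x - cpartial s (F i) y) - (cpartial s g x - cpartial s g y) by ring.
apply: (@normc_limit_le R (fun j => cpartial s (F j) x - cpartial s (F j) y)).
- by apply: cvgB; exact: cr.
- by apply: cvgB; exact: ci.
exists i => // j ij; have := hol1 i j s x y apos ij sk xr yr.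
by have -> : cpartial s (F i) x - cpartial s (F j) x - (cpartial s (F i) y - cpartial s (F j) y) =
  (cpartial s (F i) x - cpartial s (F i) y) - (cpartial s (F j) x - cpartial s (F j) y) by ring.
Qed.

End WeightedLimit.

(** * Change of charts *)

Section LocalClasses.
Variables (R : realType) (p : nat).
Implicit Types (V : set 'rV[R]_p) (f : 'rV[R]_p -> R) (k : nat) (a : R).

Lemma locally_holder0 V f : (forall x, V x -> {for x, continuous f}) -> locally_holder 0 V f.
Proof.
move=> cf x Vx; have [r r0 H] := continuous_norm_ballR (cf _ Vx) ltr01.
exists r => //; exists 2 => // y z /H yr /H zr.
by rewrite powRr0 mulr1 -(subrKA (f x)) (le_trans (ler_normD _ _)) // (distrC (f x)); lra.
Qed.

Lemma Ck_on_Cka0 k V f : Ck_on k V f -> Cka k 0 V f.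
Proof.
move=> H; apply/CkaP; split=> // s sk; apply: locally_holder0.
by have [h _] := H s; apply: h; rewrite sk.
Qed.

(** Holder continuity with exponent 0 is a local bound, which continuity provides; hence
    the case distinction on [a]. *)
Lemma Ck_holder_Cka k a V f : open V -> 0 <= a -> Ck_on k V f -> (0 < a -> holder_on k a V f) -> Cka k a V f.
Proof.
move=> oV a0 Hf Hh; have [apos|an] := ltP 0 a; last first.
  have -> : a = 0 by apply/eqP; rewrite eq_le an a0.
  exact: Ck_on_Cka0.
apply/CkaP; split=> // s sk x Vx; have [C HC] := Hh apos.
have [r r0 HV] := open_norm_ball oV Vx.
exists r => //; exists (Num.max C 0); first by rewrite le_max lexx orbT.
move=> y z /HV Vy /HV Vz; apply: le_trans (HC _ _ _ sk Vy Vz) _.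
by rewrite ler_wpM2r ?powR_ge0 // le_max lexx.
Qed.

(** A smaller domain is needed for a single Holder constant. *)
Lemma Cka_Ck_holder k a V f x : open V -> V x -> Cka k a V f ->
  exists W, [/\ open W, W x, W `<=` V, Ck_on k W f & holder_on k a W f].
Proof.
move=> oV Vx /CkaP[Hf Hh].
pose P (t : k.-tuple 'I_p) r C := forall y z, nball x r y -> nball x r z ->
  `|partial t f y - partial t f z| <= C * `|y - z| `^ a.
have [||r [C [r0 C0 HP]]] := @fin_uniform R _ P.
- move=> t r r' C C' rr CC H y z yr zr.
  apply: le_trans (H y z (lt_le_trans yr rr) (lt_le_trans zr rr)) _.
  by rewrite ler_wpM2r ?powR_ge0.
- move=> t; have [r r0 [C C0 H]] := Hh t (size_tuple t) _ Vx.
  by exists r, C; split.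
exists (nball x r `&` V); split.
- by apply: openI => //; exact: open_nball.
- by split=> //; rewrite /nball /= subrr normr0.
- by move=> y [].
- move=> s; have [h1 h2] := Hf s; split=> [sk y [_ Vy]|sk y i [_ Vy]]; [exact: h1|exact: h2].
- exists C => s y z /eqP sk [yr _] [zr _]; exact: (HP (Tuple sk)).
Qed.

End LocalClasses.

Lemma open_preimage_on (R : realType) (p : nat) (T : topologicalType) (O : set 'rV[R]_p)
    (U : set T) (phi : 'rV[R]_p -> T) :
  open O -> open U -> (forall v, O v -> {for v, continuous phi}) ->
  open [set v | O v /\ U (phi v)].
Proof.
move=> oO oU cphi; rewrite openE => v [Ov Uv]; rewrite /interior.
have n1 : nbhs v O by exact: open_nbhs_nbhs.
have n2 : nbhs v (phi @^-1` U) by apply: cphi => //; exact: open_nbhs_nbhs.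
exact: (filterI n1 n2).
Qed.

Section Charts.
Variables (R : realType) (n : nat) (Q : smooth_manifold R n).
Implicit Types (c d : chart R n Q).

Lemma chart_img_coord c x : chart_dom c x -> chart_img c (chart_coord c x).
Proof. by exists x. Qed.

Lemma chart_coordK c v : is_chart c -> chart_img c v ->
  chart_dom c (chart_param c v) /\ chart_coord c (chart_param c v) = v.
Proof. by move=> [_ _ pK _ _] [x xc <-]; rewrite pK. Qed.

Lemma atlas_smooth_chart c : atlas c -> smooth_chart c.
Proof.
move=> ac; split; first exact: atlas_chart.
by move=> d ad; split; exact: atlas_smooth.
Qed.

Definition overlap c d : set 'rV[R]_n := [set v | chart_img c v /\ chart_dom d (chart_param c v)].
Definition transition c d (v : 'rV[R]_n) := chart_coord d (chart_param c v).

Lemma open_overlap c d : is_chart c -> is_chart d -> open (overlap c d).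
Proof. by move=> [_ oi _ _ cp] [od _ _ _ _]; exact: open_preimage_on. Qed.

Lemma Cka_transition c d k a j : 0 <= a <= 1 -> is_chart c -> is_chart d -> smooth_transition c d ->
  Cka k a (overlap c d) (fun v => transition c d v 0 j).
Proof.
move=> ha hc hd st; apply: (@CkaSW _ _ k a 0) => //; first exact: open_overlap.
exact/Ck_on_Cka0/st.
Qed.

Lemma transition_param c d v : is_chart d -> overlap c d v ->
  chart_param d (transition c d v) = chart_param c v.
Proof. by move=> [_ _ pK _ _] [_ dv]; exact: pK. Qed.

Lemma transition_continuous c d v : is_chart c -> is_chart d -> smooth_transition c d ->
  overlap c d v -> {for v, continuous (transition c d)}.
Proof.
move=> hc hd st ov; apply: continuous_coords => j.
by apply: (Cka_continuous (k := 0) (a := 0)) ov; apply: Cka_transition => //; rewrite lexx ler01.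
Qed.

Lemma Ck_change_chart k a c d (f : Q -> R[i]) V : (1 <= k)%N -> 0 <= a <= 1 ->
  is_chart c -> is_chart d -> smooth_transition c d -> open V ->
  cCka k a V (f \o chart_param d) ->
  let W := [set v | overlap c d v /\ V (transition c d v)] in
  open W /\ cCka k a W (f \o chart_param c).
Proof.
move=> k1 ha hc hd st oV Hf W.
have oW : open W.
  apply: (open_preimage_on _ oV); first exact: open_overlap.
  by move=> v; exact: transition_continuous.
split=> //; apply: (@cCka_ext _ _ _ _ _ ((f \o chart_param d) \o transition c d)) => //.
  by move=> v [ov _] /=; rewrite transition_param.
apply: (cCka_comp (W := V)) => //; first by move=> v [].
by move=> j; apply: Cka_sub (Cka_transition k j ha hc hd st) => v [].
Qed.

(** The regularity class is defined through some charts of the atlas; by composition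
    with transitions it holds in every smooth chart. *)
Lemma Ckalpha_fun_chart k a (f : Q -> R[i]) c : (1 <= k)%N -> 0 <= a <= 1 ->
  smooth_chart c -> Ckalpha_fun (Fin k) a f -> cCka k a (chart_img c) (f \o chart_param c).
Proof.
move=> k1 ha [hc sc] Hf; have a0 : 0 <= a by case/andP: ha.
suff H v : chart_img c v -> exists W, [/\ open W, W v & cCka k a W (f \o chart_param c)].
  by split; apply: Cka_local => v /H[W [oW Wv [h1 h2]]]; exists W; split.
move=> iv; have [dv cv] := chart_coordK hc iv.
have [c' [d' [V [[ac' ad' dc' [oV Vx]] [Vi _ Hj]]]]] := Hf (chart_param c v).
have ic' := atlas_chart ac'; have [st _] := sc _ ac'.
have HV : cCka k a V (f \o chart_param c').
  move: ad' Hj => -> Hj; split.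
    have [h1 h2] := Hj 0; apply: (Cka_ext oV _ (Ck_holder_Cka oV a0 h1 h2)) => y _.
    by rewrite /= mxE.
  have [h1 h2] := Hj 1; apply: (Cka_ext oV _ (Ck_holder_Cka oV a0 h1 h2)) => y _.
  by rewrite /= mxE.
have [oW HW] := Ck_change_chart k1 ha hc ic' st oV HV.
by eexists; split; [exact: oW|split|exact: HW].
Qed.

Lemma Ckalpha_fun_of_local k a (f : Q -> R[i]) : (1 <= k)%N -> 0 <= a <= 1 ->
  (forall x, exists c V, [/\ smooth_chart c, chart_dom c x, open V, V (chart_coord c x) &
     cCka k a V (f \o chart_param c)]) ->
  Ckalpha_fun (Fin k) a f.
Proof.
move=> k1 ha H x; have [c [V [[hc sc] dc oV Vx HV]]] := H x.
have [c' ac' dc'] := atlas_cover x; have ic' := atlas_chart ac'; have [_ st] := sc _ ac'.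
have [oW [Wr Wi]] := Ck_change_chart k1 ha ic' hc st oV HV.
set W := [set v | _] in oW Wr Wi.
have pc' : chart_param c' (chart_coord c' x) = x by case: ic' => _ _ -> .
have Wx : W (chart_coord c' x).
  by split; [split; [exact: chart_img_coord|rewrite pc']|rewrite /transition pc'].
have [W1 [oW1 W1x W1W Ck1 H1]] := Cka_Ck_holder oW Wx Wr.
have [W2 [oW2 W2x W2W Ck2 H2]] := Cka_Ck_holder oW Wx Wi.
have Ck_sub (A B : set 'rV[R]_n) (g : 'rV[R]_n -> R) : A `<=` B -> Ck_on k B g -> Ck_on k A g.
  by move=> AB h s; have [h1 h2] := h s; split=> [sk y /AB|sk y i /AB]; [exact: h1|exact: h2].
have ho_sub (A B : set 'rV[R]_n) (g : 'rV[R]_n -> R) : A `<=` B -> holder_on k a B g -> holder_on k a A g.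
  by move=> AB [C h]; exists C => s y z sk /AB Ay /AB Az; exact: h.
exists c', (complex_chart R), (W1 `&` W2); split.
  by split => //; split; [exact: openI|split].
split=> [v [/W1W[[iv _] _] _] //|//|j g].
have gE : g = (fun v => (if j == 0 then complex.Re (f (chart_param c' v)) else complex.Im (f (chart_param c' v)))).
  by apply/funext => v; rewrite /g /= mxE.
have sub1 : W1 `&` W2 `<=` W1 by move=> ? [].
have sub2 : W1 `&` W2 `<=` W2 by move=> ? [].
rewrite {}gE; case: (j == 0); split.
- exact: Ck_sub sub1 Ck1.
- by move=> _; exact: ho_sub sub1 H1.
- exact: Ck_sub sub2 Ck2.
- by move=> _; exact: ho_sub sub2 H2.
Qed.

Lemma Ckalpha_fin_pred (k : nat) (f : Q -> R[i]) :
  Ckalpha_fun (Fin k.+1) (0 : R) f -> Ckalpha_fun (Fin k) (0 : R) f.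
Proof.
move=> H x; have [c [d [V [h1 [h2 h3 h4]]]]] := H x.
exists c, d, V; split=> //; split=> // j; have [Ck _] := h4 j; split; last by rewrite ltxx.
by move=> s; have [a1 a2] := Ck s; split=> sk; [apply: a1; exact: leqW|apply: a2; exact: leqW].
Qed.

End Charts.

(** * The flow in charts *)

Section Flow.
Variables (R : realType) (n : nat) (Q : smooth_manifold R n) (tk : time_kind).
Variables (Phi : Q -> time R tk -> Q).
Implicit Types (c d : chart R n Q) (k : nat) (a : R) (e : chart R (time_dim tk) (time R tk)).

Local Notation vec := 'rV[R]_(n + time_dim tk).

Definition flow_coord c e d (z : vec) : 'rV[R]_n :=
  chart_coord d (Phi (chart_param c (lsubmx z)) (chart_param e (rsubmx z))).

Lemma Cka_lsubmx k a (V : set vec) j : 0 <= a <= 1 -> Cka k a V (fun z => lsubmx z 0 j).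
Proof.
move=> ha; rewrite (_ : (fun z : vec => _) = (fun z : vec => z 0 (lshift (time_dim tk) j))).
  exact: Cka_coord.
by apply/funext => z; rewrite mxE.
Qed.

Lemma time_paramK e t : @time_atlas R tk e -> chart_dom e t -> chart_param e (chart_coord e t) = t.
Proof. by case: tk e t => e t; [case=> z -> ->|move=> -> _; rewrite /= mxE]. Qed.

(** Joint regularity in space and time, transported to arbitrary smooth charts of the
    phase space. The chart of time is not free: for discrete time it depends on [t]. *)
Lemma flow_local k a c d x t : (1 <= k)%N -> 0 <= a <= 1 ->
  smooth_chart c -> smooth_chart d -> Ckalpha_flow (Fin k) a Phi ->
  chart_dom c x -> chart_dom d (Phi x t) ->
  exists e, [/\ @time_atlas R tk e, chart_dom e t & exists V, [/\ open V,
    V (row_mx (chart_coord c x) (chart_coord e t)),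
    forall z, V z -> chart_img c (lsubmx z) /\
      chart_dom d (Phi (chart_param c (lsubmx z)) (chart_param e (rsubmx z))) &
    forall j, Cka k a V (fun z => flow_coord c e d z 0 j)]].
Proof.
move=> k1 ha [hc sc] [hd sd] HPhi xc xd; have a0 : 0 <= a by case/andP: ha.
have [pc [d' [V' [[[c' [e [ac' ae ->]]] ad' [/= xc' te] [oV' V'x]] [V'i V'd Hj]]]]] := HPhi (x, t).
have ic' := atlas_chart ac'; have id' := atlas_chart ad'.
have [stc _] := sc _ ac'; have [_ std] := sd _ ad'.
have H' j : Cka k a V' (fun v => flow_coord c' e d' v 0 j).
  by have [h1 h2] := Hj j; exact: (Ck_holder_Cka oV' a0 h1 h2).
exists e; split=> //.
have px : chart_param c (chart_coord c x) = x by case: hc => _ _ -> .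
have px' : chart_param c' (chart_coord c' x) = x by case: ic' => _ _ -> .
have pt : chart_param e (chart_coord e t) = t by exact: time_paramK.
(* change of the phase-space chart at the source *)
pose O1 : set vec := [set z | setT z /\ overlap c c' (lsubmx z)].
have clsub (z : vec) : {for z, continuous (@lsubmx R 1 n (time_dim tk))}.
  by apply: continuous_coords => j; exact: (Cka_continuous (@Cka_lsubmx 0 a setT j ha)).
have oO1 : open O1.
  by apply: open_preimage_on => //; [exact: openT|exact: open_overlap].
pose tau (z : vec) : vec := row_mx (transition c c' (lsubmx z)) (rsubmx z).
have Htau j : Cka k a O1 (fun z => tau z 0 j).
  case: (splitP j) => [j1 jE|j2 jE].
    have -> : j = lshift _ j1 by apply/val_inj; rewrite /= jE.
    rewrite (_ : (fun z => _) = (fun w => transition c c' w 0 j1) \o lsubmx); last first.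
      by apply/funext => z; rewrite /tau row_mxEl.
    apply: (Cka_comp k1 ha oO1 (open_overlap hc ic')); first by move=> z [].
      by move=> l; exact: Cka_lsubmx.
    exact: Cka_transition.
  have -> : j = rshift n j2 by apply/val_inj; rewrite /= jE.
  rewrite (_ : (fun z : vec => _) = (fun z : vec => z 0 (rshift n j2))); last first.
    by apply/funext => z; rewrite /tau row_mxEr mxE.
  exact: Cka_coord.
have ctau z : O1 z -> {for z, continuous tau}.
  by move=> Oz; apply: continuous_coords => j; exact: Cka_continuous (Htau j) Oz.
pose V1 := [set z | O1 z /\ V' (tau z)].
have oV1 : open V1 by exact: open_preimage_on.
have E1 z : V1 z -> flow_coord c' e d' (tau z) = flow_coord c e d' z.
  by move=> [[_ oz] _]; rewrite /flow_coord row_mxKl row_mxKr transition_param.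
have H1 j : Cka k a V1 (fun z => flow_coord c e d' z 0 j).
  apply: (@Cka_ext _ _ _ _ _ ((fun v => flow_coord c' e d' v 0 j) \o tau)) => //.
    by move=> z Vz /=; rewrite E1.
  apply: (Cka_comp k1 ha oV1 oV') (H' j); first by move=> z [].
  by move=> l; apply: Cka_sub (Htau l) => z [].
have c1 z : V1 z -> {for z, continuous (flow_coord c e d')}.
  by move=> Oz; apply: continuous_coords => j; exact: Cka_continuous (H1 j) Oz.
(* change of chart at the target *)
pose V2 := [set z | V1 z /\ overlap d' d (flow_coord c e d' z)].
have oV2 : open V2 by apply: open_preimage_on => //; exact: open_overlap.
have D2 z : V1 z -> chart_dom d' (Phi (chart_param c (lsubmx z)) (chart_param e (rsubmx z))).
  move=> [[_ oz] Vz]; have := V'd _ Vz; rewrite /= /tau row_mxKl row_mxKr transition_param //.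
have E2 z : V1 z -> chart_param d' (flow_coord c e d' z) = Phi (chart_param c (lsubmx z)) (chart_param e (rsubmx z)).
  by move=> /D2; case: id' => _ _ pK _ _; exact: pK.
exists V2; split=> //.
- have V1x : V1 (row_mx (chart_coord c x) (chart_coord e t)).
    split; first by split=> //; rewrite row_mxKl; split; [exact: chart_img_coord|rewrite px].
    by rewrite /tau row_mxKl row_mxKr /transition px.
  split=> //; split; last by rewrite E2 // row_mxKl row_mxKr px pt.
  by rewrite /flow_coord row_mxKl row_mxKr px pt; apply: chart_img_coord; have := D2 _ V1x; rewrite row_mxKl row_mxKr px pt.
- move=> z [V1z [_ dz]]; rewrite E2 // in dz; split=> //.
  by case: V1z => -[_ []].
- move=> j; apply: (@Cka_ext _ _ _ _ _ ((fun v => transition d' d v 0 j) \o flow_coord c e d')) => //.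
    by move=> z [V1z _] /=; rewrite /transition E2.
  apply: (Cka_comp k1 ha oV2 (open_overlap id' hd)); first by move=> z [].
    by move=> l; apply: Cka_sub (H1 l) => z [].
  exact: Cka_transition.
Qed.

(** Regularity at a fixed time, by restricting to a slice of the joint chart. *)
Lemma flow_slice k a c d x t : (1 <= k)%N -> 0 <= a <= 1 ->
  smooth_chart c -> smooth_chart d -> Ckalpha_flow (Fin k) a Phi ->
  chart_dom c x -> chart_dom d (Phi x t) ->
  exists V, [/\ open V, V (chart_coord c x),
    forall v, V v -> chart_img c v /\ chart_dom d (Phi (chart_param c v) t) &
    forall j, Cka k a V (fun v => chart_coord d (Phi (chart_param c v) t) 0 j)].
Proof.
move=> k1 ha hc hd HPhi xc xd.
have [e [ae te [V [oV Vx Vd HV]]]] := flow_local k1 ha hc hd HPhi xc xd.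
pose iota (v : 'rV[R]_n) : vec := row_mx v (chart_coord e t).
have Hi j (O : set 'rV[R]_n) : Cka k a O (fun v => iota v 0 j).
  case: (splitP j) => [j1 jE|j2 jE].
    have -> : j = lshift _ j1 by apply/val_inj; rewrite /= jE.
    rewrite (_ : (fun v => _) = (fun v : 'rV[R]_n => v 0 j1)); first exact: Cka_coord.
    by apply/funext => z; rewrite /iota row_mxEl.
  have -> : j = rshift n j2 by apply/val_inj; rewrite /= jE.
  rewrite (_ : (fun v => _) = cst (chart_coord e t 0 j2)); first exact: Cka_cst.
  by apply/funext => z; rewrite /iota row_mxEr.
have ci v : {for v, continuous iota}.
  by apply: continuous_coords => j; exact: (Cka_continuous (Hi j setT)).
have pt : chart_param e (chart_coord e t) = t by exact: time_paramK.
pose V1 := [set v | [set: 'rV[R]_n] v /\ V (iota v)].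
have oV1 : open V1 by apply: open_preimage_on => //; exact: openT.
exists V1; split=> //.
- by move=> v [_ /Vd]; rewrite /iota row_mxKl row_mxKr pt.
- move=> j; apply: (@Cka_ext _ _ _ _ _ ((fun z => flow_coord c e d z 0 j) \o iota)) => //.
    by move=> v _; rewrite /= /flow_coord /iota row_mxKl row_mxKr pt.
  by apply: (Cka_comp k1 ha oV1 oV) (HV j) => [v []|l] //; exact: Hi.
Qed.

Lemma flow_near c v t (U : set Q) : smooth_chart c -> Ckalpha_flow (Fin 1) 0 Phi ->
  chart_img c v -> nbhs (Phi (chart_param c v) t) U ->
  \forall w \near v, chart_img c w /\ U (Phi (chart_param c w) t).
Proof.
move=> hc HPhi iv nU; have [ic _] := hc; have [dv cv] := chart_coordK ic iv.
have [d ad dd] := atlas_cover (Phi (chart_param c v) t).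
have ha : (0 : R) <= (0 : R) <= (1 : R) by rewrite lexx ler01.
have [V [oV Vx Vd HV]] := flow_slice (isT : (1 <= 1)%N) ha hc (atlas_smooth_chart ad) HPhi dv dd.
rewrite cv in Vx; have [_ _ pK _ cp] := atlas_chart ad.
pose phi w := chart_coord d (Phi (chart_param c w) t).
have cphi : {for v, continuous phi}.
  by apply: continuous_coords => j; exact: Cka_continuous (HV j) Vx.
have n1 : nbhs (phi v) (chart_param d @^-1` U).
  by apply: cp; [exact: chart_img_coord|rewrite pK].
have n2 : nbhs v (phi @^-1` (chart_param d @^-1` U)) by exact: cphi.
have n3 : nbhs v V by exact: open_nbhs_nbhs.
apply: filterS (filterI n2 n3) => w [h1 /Vd[h2 h3]]; split=> //.
by move: h1; rewrite /= /phi pK.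
Qed.

End Flow.

(** * Dynamics near the fixed point, and uniqueness *)

Lemma jacobianE (R : realType) (m n : nat) (F : 'rV[R]_m -> 'rV[R]_n) p i j :
  differentiable F p -> jacobian F p i j = jac F p i j.
Proof.
move=> dF; rewrite /jacobian /lin1_mx mxE -(deriveE _ dF) derive_mx; last exact: diff_derivable.
by rewrite mxE.
Qed.

Lemma jac_comp (R : realType) (m n l : nat) (F : 'rV[R]_m -> 'rV[R]_n) (H : 'rV[R]_n -> 'rV[R]_l) p i j :
  differentiable F p -> differentiable H (F p) ->
  jac (H \o F) p i j = \sum_h jac F p i h * jac H (F p) h j.
Proof.
move=> dF dH; rewrite /jac.
have dHj : differentiable (fun y => H y 0 j) (F p).
  apply: (@differentiable_comp _ _ _ _ H (fun M : 'rV[R]_l => M 0 j)) => //.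
  exact: differentiable_coord.
exact: (derive_comp_coord (g := fun y => H y 0 j) (row_unit i) dF dHj).
Qed.

Lemma jac_near (R : realType) (m n : nat) (F H : 'rV[R]_m -> 'rV[R]_n) p i j :
  (\forall x \near p, F x = H x) -> jac F p i j = jac H p i j.
Proof. by move=> E; apply: near_eq_derive; apply: filterS E => x ->. Qed.

Section TimeAxis.
Variables (R : realType) (tk : time_kind).

Lemma time_natural_bound (M : time R tk) : exists J : nat, M <= J%:R.
Proof.
case: tk M => M /=.
  by exists `|M|%N; rewrite natz; exact: lez_abs.
by exists (Num.truncn M).+1; rewrite ltW // truncnS_gt.
Qed.

Lemma time_val_nat (J : nat) : time_val (J%:R : time R tk) = J%:R.
Proof. by case: tk => //=; rewrite natz. Qed.

Lemma time_infty_nat (X : set (time R tk)) : @time_infty R tk X ->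
  exists J0 : nat, forall J, (J0 <= J)%N -> X J%:R.
Proof.
move=> [M HM]; have [J0 HJ0] := time_natural_bound M; exists J0 => J J0J.
by apply: HM; apply: le_trans HJ0 _; rewrite ler_nat.
Qed.

End TimeAxis.

Section ComplexExponential.
Variable R : realType.
Implicit Types z w : R[i].

Lemma cexpD z w : cexp (z + w) = cexp z * cexp w.
Proof.
case: z w => a b [c d]; rewrite /cexp /=; apply/eqP; rewrite eq_complex /= expRD cosD sinD.
by apply/andP; split; apply/eqP; ring.
Qed.

Lemma cexp0 : cexp (0 : R[i]) = 1.
Proof. by rewrite /cexp /= expR0 cos0 sin0 mulr1 mulr0. Qed.

Lemma cexp_neq0 z : cexp z != 0.
Proof.
apply/negP => /eqP z0; have := cexpD z (- z); rewrite subrr cexp0 z0 mul0r => /eqP.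
by rewrite oner_eq0.
Qed.

Lemma cexpN z : cexp (- z) = (cexp z)^-1.
Proof.
apply: (mulfI (cexp_neq0 z)); rewrite -cexpD subrr cexp0 divff //; exact: cexp_neq0.
Qed.

Lemma cexp_nat z (J : nat) : cexp (z * J%:R) = cexp z ^+ J.
Proof.
elim: J => [|J IH]; first by rewrite mulr0 cexp0.
by rewrite -natr1 mulrDr mulr1 cexpD IH exprSr.
Qed.

Lemma cexp_sum (I : finType) (F : I -> R[i]) : cexp (\sum_i F i) = \prod_i cexp (F i).
Proof. by apply: (big_morph (@cexp R)); [exact: cexpD|exact: cexp0]. Qed.

Lemma normc_cexp z : normc (cexp z) = expR (complex.Re z).
Proof.
case: z => a b; rewrite /cexp /normc /= !exprMn -mulrDr cos2Dsin2 mulr1 sqrtr_sqr.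
by rewrite ger0_norm // expR_ge0.
Qed.

End ComplexExponential.

Section LocalDynamics.
Variables (R : realType) (n' : nat).
Local Notation n := n'.+1.
Variables (Q : smooth_manifold R n) (tk : time_kind) (Phi : Q -> time R tk -> Q).
Variables (x0 : Q) (c : chart R n Q).
Hypotheses (hc : smooth_chart c) (hx0 : chart_dom c x0).
Hypotheses (hPhi : dynamical_system Phi) (hPhi1 : Ckalpha_flow (Fin 1) 0 Phi).
Hypothesis fix0 : forall t, Phi x0 t = x0.

Let p0 := chart_coord c x0.

Let ha0 : (0 : R) <= (0 : R) <= (1 : R). Proof. by rewrite lexx ler01. Qed.

Definition flow_map t (v : 'rV[R]_n) := chart_coord c (Phi (chart_param c v) t).

Lemma param_p0 : chart_param c p0 = x0.
Proof. by have [[_ _ pK _ _] _] := hc; exact: pK. Qed.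

Lemma flow_map_fixed t : flow_map t p0 = p0.
Proof. by rewrite /flow_map param_p0 fix0. Qed.

Lemma flow_map_local k a t : (1 <= k)%N -> 0 <= a <= 1 -> Ckalpha_flow (Fin k) a Phi ->
  exists V, [/\ open V, V p0,
    forall v, V v -> chart_img c v /\ chart_dom c (Phi (chart_param c v) t) &
    forall j, Cka k a V (fun v => flow_map t v 0 j)].
Proof. by move=> k1 ha H; apply: (flow_slice k1 ha hc hc H hx0); rewrite fix0. Qed.

Lemma flow_map_differentiable t : differentiable (flow_map t) p0.
Proof.
have [V [oV Vp _ HV]] := flow_map_local t (isT : (1 <= 1)%N) ha0 hPhi1.
exact: C1_map_differentiable HV Vp.
Qed.

Lemma chart_jacobianE t i j : chart_jacobian c (Phi ^~ t) x0 i j = jac (flow_map t) p0 i j.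
Proof. exact: (jacobianE i j (flow_map_differentiable t)). Qed.

Lemma flow_mapD t s : \forall v \near p0, flow_map (t + s) v = flow_map t (flow_map s v).
Proof.
have [V [oV Vp Vd _]] := flow_map_local s (isT : (1 <= 1)%N) ha0 hPhi1.
apply: (open_near oV Vp) => v /Vd[_ dv]; rewrite /flow_map hPhi.2; congr (chart_coord c (Phi _ t)).
by have [[_ _ pK _ _] _] := hc; rewrite pK.
Qed.

Local Notation A := (chart_jacobian c (Phi ^~ 1) x0).

Lemma jac_flow_map_nat (N : nat) i j : jac (flow_map N%:R) p0 i j = (A ^+ N) i j.
Proof.
elim: N i j => [|N IH] i j.
  have E : \forall v \near p0, flow_map 0 v = v.
    have [V [oV Vp Vd _]] := flow_map_local 0 (isT : (1 <= 1)%N) ha0 hPhi1.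
    apply: (open_near oV Vp) => v /Vd[[x xc <-] _].
    by rewrite /flow_map hPhi.1; have [[_ _ pK _ _] _] := hc; rewrite pK.
  by rewrite (jac_near i j E) expr0 mxE /jac partial_coord.
rewrite -natr1 addrC (jac_near i j (flow_mapD 1 N%:R)).
have dN := flow_map_differentiable N%:R; have d1 := flow_map_differentiable 1.
rewrite -[flow_map N%:R]/(flow_map N%:R) (jac_comp (F := flow_map N%:R) (H := flow_map 1) i j dN); last first.
  by rewrite flow_map_fixed.
rewrite exprSr mxE; apply: eq_bigr => h _; rewrite IH flow_map_fixed chart_jacobianE //.
Qed.

(** The derivative of an iterate at the fixed point is a power of [A], small by
    [small_powers]; by continuity of the derivative the bound persists nearby.  A
    single step need not contract the maximum norm of the given chart. *)
Lemma local_contraction k a th : (1 <= k)%N -> 0 <= a <= 1 -> Ckalpha_flow (Fin k) a Phi ->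
  0 < th -> spectral_radius A < th ->
  exists N V r1, [/\ (0 < N)%N, open V, 0 < r1, nball p0 r1 `<=` V &
   [/\ forall v, V v -> chart_img c v /\ chart_dom c (Phi (chart_param c v) N%:R),
       forall j, Cka k a V (fun v => flow_map N%:R v 0 j) &
       forall x i j, nball p0 r1 x -> n%:R * `|jac (flow_map N%:R) x i j| <= th ^+ N]].
Proof.
move=> k1 ha Hk th0 hth.
have [sigma sA] := eigenvalues_of_exists A.
have [|N N0 HN] := small_powers sA th0.
  move=> i; apply: le_lt_trans hth; apply: eigenvalue_le_radius.
  by apply/(eigenvalues_ofP _ sA); exists i.
have [V [oV Vp Vd HV]] := flow_map_local N%:R k1 ha Hk.
have [rV rV0 rVV] := open_norm_ball oV Vp.
pose P (ij : 'I_n * 'I_n) r (_ : R) := forall x, nball p0 r x ->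
  n%:R * `|jac (flow_map N%:R) x ij.1 ij.2| <= th ^+ N.
have [||r [C [r0 _ HP]]] := @fin_uniform R _ P.
- by move=> ij r r' C C' rr _ H x xr; apply: H; exact: lt_le_trans xr rr.
- move=> [i j].
  have cj : {for p0, continuous (partial [:: i] (fun v => flow_map N%:R v 0 j))}.
    have HC := Ck_C1_map k1 oV HV j.
    by case: HC => _ _ /(_ i)[h _]; exact: h.
  have e0 : 0 < (th ^+ N - n%:R * `|(A ^+ N) i j|) / n%:R by rewrite divr_gt0 // subr_gt0.
  have [r r0 Hr] := continuous_norm_ballR cj e0.
  exists r, 0; split=> // x xr /=; rewrite -ler_pdivlMl ?ltr0n // mulrC.
  have := Hr x xr; rewrite -/(jac _ _ _ _) -/(jac (flow_map N%:R) p0 i j) jac_flow_map_nat.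
  move=> /ltW h; rewrite -[jac _ x i j](subrK ((A ^+ N) i j)); apply: le_trans (ler_normD _ _) _.
  apply: le_trans (lerD h (lexx _)) _; rewrite mulrBl.
  by rewrite [n%:R * _ / _]mulrAC divff ?pnatr_eq0 // mul1r subrK.
exists N, V, (Num.min r rV); split=> //; first by rewrite lt_min r0.
  by move=> x xr; apply: rVV; apply: lt_le_trans xr _; rewrite ge_min lexx orbT.
split=> // x i j xr; apply: (HP (i, j)); apply: lt_le_trans xr _; by rewrite ge_min lexx.
Qed.

Lemma flow_map_velocity (v : 'rV[R]_n) :
  t^-1 *: (flow_map 1 (p0 + t *: v) - p0) @[t --> (0 : R)^'] --> v *m A.
Proof.
have d1 := flow_map_differentiable 1.
have /cvg_ex[l dl] : derivable (flow_map 1) p0 v by exact: diff_derivable.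
have lE : 'D_v (flow_map 1) p0 = l by exact: (cvg_lim (@norm_hausdorff _ _) dl).
rewrite deriveEjacobian // in lE.
rewrite -[A]/(jacobian (flow_map 1) p0) lE.
apply: cvg_trans dl; apply: near_eq_cvg; near=> t.
by rewrite /= flow_map_fixed [t *: v + p0]addrC.
Unshelve. all: by end_near. Qed.

Lemma eigen_iterate (f : Q -> R[i]) nu : (forall x, f (Phi x 1) = nu * f x) ->
  forall (J : nat) x, f (Phi x J%:R) = nu ^+ J * f x.
Proof.
move=> Hf; elim=> [|J IH] x; first by rewrite hPhi.1 mul1r.
by rewrite -natr1 addrC hPhi.2 Hf IH exprS mulrA.
Qed.

Lemma below_order_leq i k (a : R) : 0 <= a <= 1 -> below_order i (Fin k) a -> (i <= k)%N.
Proof.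
move=> /andP[_ a1] /= h; have : i%:R < k.+1%:R :> R.
  by apply: lt_le_trans h _; rewrite -natr1 lerD2l.
by rewrite ltr_nat ltnS.
Qed.

(** Induction on the order: once all lower jets vanish, [leading_jet] makes the
    next one an eigenform of a tensor power of [A]. *)
Lemma jets_vanish k a nu (f : Q -> R[i]) sigma : (1 <= k)%N -> 0 <= a <= 1 ->
  Ckalpha_fun (Fin k) a f -> (forall x, f (Phi x 1) = nu * f x) ->
  eigenvalues_of A sigma ->
  (forall i, (i <= k)%N ->
    (forall s, size s = i -> cpartial s (f \o chart_param c) p0 = 0) \/
    ~ (exists m : 'I_n -> nat, (\sum_j m j)%N = i /\ nu = \prod_j sigma j ^+ m j)) ->
  forall s, (size s <= k)%N -> cpartial s (f \o chart_param c) p0 = 0.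
Proof.
move=> k1 ha Hf fE sA alt.
have [Hr Hi] := Ckalpha_fun_chart k1 ha hc Hf.
have [[_ oi _ _ _] _] := hc.
have ip : chart_img c p0 by exact: chart_img_coord.
suff H i : (i <= k)%N -> forall s, (size s <= i)%N -> cpartial s (f \o chart_param c) p0 = 0.
  by move=> s; exact: (H k).
elim: i => [|i IH] ik s.
  rewrite leqn0 => /eqP s0; have [h|nres] := alt 0%N (leq0n _); first exact: h.
  move: (size0nil s0) => ->; apply/eqP/negP => /negP f0; apply: nres.
  exists (fun=> 0%N); split; first by rewrite big1.
  rewrite big1 => [|j _]; last by rewrite expr0.
  have := fE x0; rewrite fix0 -{1}[f x0]mul1r => /esym/mulIf; apply.
  by move: f0; rewrite /cpartial /= param_p0; case: (f x0).
rewrite leq_eqVlt => /orP[/eqP si|si]; last exact: IH (ltnW ik) s si.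
have [h|nres] := alt i.+1 ik; first exact: h.
apply/eqP/negP => /negP Ts; apply: nres.
apply: (@tens_eigenvalue _ _ (complexify A) sigma i.+1 (fun u => cpartial u (f \o chart_param c) p0)) => //.
  by exists s.
apply: (leading_jet oi ip flow_map_velocity).
- by split; apply: (Cka_le oi ha0 ik); [exact: Cka0W Hr|exact: Cka0W Hi].
- by move=> u ui; exact: IH (ltnW ik) u ui.
have [V [oV Vp Vd _]] := flow_map_local 1 (isT : (1 <= 1)%N) ha0 hPhi1.
apply: (open_near oV Vp) => v /Vd[_ dv]; rewrite /flow_map /= -fE.
by have [[_ _ pK _ _] _] := hc; rewrite pK.
Qed.

(** Flatness gives $f = O(|x|^{k+a})$ at the fixed point, whereas along the flow
    [f] can only decay like $\nu^t$, and $|\nu|$ exceeds the $(k+a)$-th power of the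
    contraction rate.  Hence [f] vanishes near the fixed point, where every orbit
    ends up. *)
Lemma flat_eigenfunction_zero k a th nu (f : Q -> R[i]) : (1 <= k)%N -> 0 <= a <= 1 ->
  (forall x, Phi x @ @time_infty R tk --> x0) ->
  0 < th -> spectral_radius A < th -> th < 1 -> th `^ (k%:R + a) < normc nu ->
  Ckalpha_fun (Fin k) a f -> (forall x, f (Phi x 1) = nu * f x) ->
  (forall s, below_order (size s) (Fin k) a -> cpartial s (f \o chart_param c) p0 = 0) ->
  forall x, f x = 0.
Proof.
move=> k1 ha basin th0 rth th1 hnu Hf fE jets.
have a0 : 0 <= a by case/andP: ha.
have nu0 : nu != 0.
  by apply/eqP => nu0; move: hnu; rewrite nu0 normc0 ltNge powR_ge0.
have [[_ oi pK cK _] _] := hc.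
have ip : chart_img c p0 by exact: chart_img_coord.
have [r [K [r0 K0 _ [hw _]]]] := weighted_of_jets ha oi ip (Ckalpha_fun_chart k1 ha hc Hf) jets.
have [N [V [r1 [N0 oV r10 r1V [Vd HV HJ]]]]] := local_contraction (isT : (1 <= 1)%N) ha0 hPhi1 th0 rth.
set m := th ^+ N in HJ.
have m0 : 0 <= m by rewrite exprn_ge0 // ltW.
have m1 : m <= 1 by rewrite exprn_ile1 // ltW.
(* each contracting step multiplies the bound K |v - p0|^(k + a) by q < 1 *)
pose q := (normc nu ^+ N)^-1 * m `^ (k%:R + a).
have nN0 : 0 < normc nu ^+ N by rewrite exprn_gt0 // normc_gt0.
have q0 : 0 <= q by rewrite mulr_ge0 ?powR_ge0 // invr_ge0 ltW.
have q1 : q < 1.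
  rewrite /q mulrC ltr_pdivrMr // mul1r /m -powR_mulrn ?(ltW th0) // powRAC powR_mulrn ?powR_ge0 //.
  by rewrite ltrXn2r ?powR_ge0 ?normc_ge0 // -lt0n N0.
pose r2 := Num.min r r1.
have stable x : nball p0 r2 x -> nball p0 r2 (flow_map N%:R x).
  by apply: (nball_stable (k := 1) (a := 0) oV _ HV m0 m1 r10 r1V (flow_map_fixed _) HJ) => //; rewrite ge_min lexx orbT.
have gE v : nball p0 r2 v -> normc (f (chart_param c v)) =
    (normc nu ^+ N)^-1 * normc (f (chart_param c (flow_map N%:R v))).
  move=> vr; have /r1V/Vd[_ dv] : nball p0 r1 v by apply: lt_le_trans vr _; rewrite ge_min lexx orbT.
  rewrite /flow_map pK // (eigen_iterate fE) normcM.
  by have -> : normc (nu ^+ N) = normc nu ^+ N; [elim: (N) => [|l IH]; rewrite ?normc1 // !exprS normcM IH|rewrite mulKf ?gt_eqF].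
have bound J v : nball p0 r2 v ->
    normc (f (chart_param c v)) <= K * q ^+ J * `|v - p0| `^ (k%:R + a).
  elim: J v => [|J IH] v vr.
    rewrite mulr1; have /(_ [::] v isT) := hw; rewrite subn0; move/(_ (lt_le_trans vr _)).
    rewrite ge_min lexx => /(_ isT); by rewrite /cpartial /=; case: (f _).
  rewrite gE //; have := IH _ (stable _ vr) => h.
  apply: le_trans (ler_wpM2l _ h) _; first by rewrite invr_ge0 ltW.
  have vr1 : nball p0 r1 v by apply: lt_le_trans vr _; rewrite ge_min lexx orbT.
  have h2 : `|flow_map N%:R v - p0| <= m * `|v - p0|.
    exact: (nball_contraction0 (k := 1) (a := 0) oV _ HV m0 r10 r1V (flow_map_fixed _) HJ).
  have -> : K * q ^+ J.+1 * `|v - p0| `^ (k%:R + a) =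
    (normc nu ^+ N)^-1 * (K * q ^+ J * (m * `|v - p0|) `^ (k%:R + a)).
    by rewrite exprS powRM // /q; ring.
  rewrite ler_wpM2l ?invr_ge0 ?(ltW nN0) // ler_wpM2l ?mulr_ge0 ?exprn_ge0 //.
  by apply: ge0_ler_powR; rewrite ?nnegrE ?addr_ge0 ?mulr_ge0.
have zero v : nball p0 r2 v -> f (chart_param c v) = 0.
  move=> vr; apply: eq0_normc; apply/eqP; rewrite eq_le normc_ge0 andbT.
  have cq : K * q ^+ J * `|v - p0| `^ (k%:R + a) @[J --> \oo] --> K * 0 * `|v - p0| `^ (k%:R + a).
    apply: cvgM; last exact: cvg_cst.
    apply: cvgM; first exact: cvg_cst.
    by apply: cvg_expr; rewrite ger0_norm.
  rewrite mulr0 mul0r in cq.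
  by apply: (cvgr_to_ge cq); exists 0%N => // J _; exact: bound.
move=> x.
have r20 : 0 < r2 by rewrite lt_min r0.
have nx0 : nbhs x0 [set y | chart_dom c y /\ nball p0 r2 (chart_coord c y)].
  have [[od _ _ _ _] _] := hc.
  have n1 : nbhs x0 (chart_dom c) by exact: open_nbhs_nbhs.
  have n2 : nbhs x0 (chart_coord c @^-1` nball p0 r2) by apply: cK => //; exact: nbhs_nball.
  exact: (filterI n1 n2).
have [J0 HJ0] := time_infty_nat (basin x _ nx0).
have [dJ bJ] := HJ0 J0 (leqnn _).
have := zero _ bJ; rewrite pK // (eigen_iterate fE) => /eqP.
by rewrite mulf_eq0 expf_eq0 (negbTE nu0) andbF => /eqP.
Qed.

End LocalDynamics.

(** * Formal eigenfunctions *)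

Lemma cpartial_nil (R : realType) (p : nat) (g : 'rV[R]_p -> R[i]) x : cpartial [::] g x = g x.
Proof. by rewrite /cpartial /=; case: (g x). Qed.

(** Adjacent transpositions indexed by their position, so that they act on words
    of any length and commute with [tens]. *)
Fixpoint swap_letters (T : Type) (a : nat) (s : seq T) : seq T :=
  match a, s with
  | 0%N, [:: i, j & v] => [:: j, i & v]
  | a'.+1, i :: v => i :: swap_letters a' v
  | _, _ => s
  end.

Lemma swap_letters_cat (T : Type) (u v : seq T) i j :
  swap_letters (size u) (u ++ [:: i, j & v]) = u ++ [:: j, i & v].
Proof. by elim: u => //= x u ->. Qed.

Lemma size_swap_letters (T : Type) a (s : seq T) : size (swap_letters a s) = size s.
Proof. by elim: a s => [|a IH] [|i [|j v]] //=; rewrite IH. Qed.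

Lemma tens_swap (K : comNzRingType) (p q : nat) (B : 'I_p -> 'I_q -> K) a s (T : seq 'I_q -> K) :
  tens B s (fun u => T (swap_letters a u)) = tens B (swap_letters a s) T.
Proof.
elim: a s T => [|a IH] [|i s] T //=; last first.
  by apply: eq_bigr => j _; rewrite -IH.
case: s => [|j s] //=.
under eq_bigr do rewrite mulr_sumr.
under [RHS]eq_bigr do rewrite mulr_sumr.
by rewrite exchange_big; apply: eq_bigr => b _; apply: eq_bigr => c _; rewrite mulrCA.
Qed.

Lemma tens0 (K : comNzRingType) (p q : nat) (B : 'I_p -> 'I_q -> K) s : tens B s (fun=> 0) = 0.
Proof. by elim: s => //= i s IH; rewrite big1 // => j _; rewrite IH mulr0. Qed.

(** Away from resonances the tensor equation is uniquely solvable; uniqueness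
    makes the solution inherit the symmetry of the right-hand side. *)
Lemma tens_solve_symmetric (K : fieldType) (n : nat) (A : 'M[K]_n.+1) (sigma : 'I_n.+1 -> K) l z
    (Y : seq 'I_n.+1 -> K) :
  char_poly A = \prod_i ('X - (sigma i)%:P) ->
  ~ (exists m : 'I_n.+1 -> nat, (\sum_i m i)%N = l /\ z = \prod_i sigma i ^+ m i) ->
  symmetric_form l Y ->
  exists T, symmetric_form l T /\ forall s, size s = l -> tens A s T - z * T s = Y s.
Proof.
move=> chA nres sY.
have inj T : (forall s, size s = l -> tens A s T = z * T s) -> forall s, size s = l -> T s = 0.
  move=> HT s sl; apply/eqP/negP => /negP Ts; apply: nres.
  by apply: (@tens_eigenvalue _ _ A sigma l T z chA _ HT); exists s.
have [T HT] := tens_solve inj Y.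
exists T; split=> // u v i j ul.
set a := size u.
suff H s : size s = l -> T s + -1 * T (swap_letters a s) = 0.
  by have := H _ ul; rewrite swap_letters_cat mulN1r => /eqP; rewrite subr_eq0 => /eqP.
apply: (inj (fun s => T s + -1 * T (swap_letters a s))) => {}s sl.
(* T and its transpose solve the same equation, so their difference is an eigenform *)
have Ysw : Y (swap_letters a s) = Y s.
  have [asl|asl] := leqP (a + 2) (size s).
    have [u' [i' [j' [v' [sE us']]]]] : exists u' i' j' v', s = u' ++ [:: i', j' & v'] /\ size u' = a.
      exists (take a s), (nth i s a), (nth i s a.+1), (drop a.+2 s); split; last first.
        by rewrite size_takel // (leq_trans _ asl) // leq_addr.
      have a1 : (a < size s)%N by rewrite (leq_trans _ asl) // addn2 ltnS leqnSn.
      have a2 : (a.+1 < size s)%N by rewrite (leq_trans _ asl) // addn2.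
      by rewrite -(drop_nth i a2) -(drop_nth i a1) cat_take_drop.
    by rewrite sE -us' swap_letters_cat; apply/esym/sY; rewrite -sE.
  by move: asl; rewrite sl -ul size_cat /= /a !addnS !addn0 !ltnS ltnNge leq_addr.
have swl : size (swap_letters a s) = l by rewrite size_swap_letters.
rewrite tens_add tens_scale tens_swap.
have := HT s sl; have := HT _ swl; rewrite Ysw => /eqP; rewrite subr_eq => /eqP ->.
by move=> /eqP; rewrite subr_eq => /eqP ->; ring.
Qed.

Section ComplexForm.
Variables (R : realType) (p : nat) (p0 : 'rV[R]_p).
Implicit Types (T : seq 'I_p -> R[i]) (V : set 'rV[R]_p).

(** Complex-valued forms, through the real polynomials of their two parts. *)
Definition cform l T (x : 'rV[R]_p) : R[i] :=
  Complex (form_poly p0 l (fun u => complex.Re (T u)) x) (form_poly p0 l (fun u => complex.Im (T u)) x).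

Lemma cCka_cform k a V l T : 0 <= a <= 1 -> open V -> cCka k a V (cform l T).
Proof. by move=> ha oV; split; exact: Cka_form_poly. Qed.

Lemma cpartial_cform_lt l T s : symmetric_form l T -> (size s < l)%N -> cpartial s (cform l T) p0 = 0.
Proof.
move=> sT sl; rewrite /cpartial /cform /= !partial_form_poly ?(ltnW sl) //.
- by rewrite !form_poly_center ?subn_gt0.
- by move=> u v i j ul; rewrite sT.
- by move=> u v i j ul; rewrite sT.
Qed.

Lemma cpartial_cform l T s : symmetric_form l T -> size s = l -> cpartial s (cform l T) p0 = T s.
Proof.
move=> sT sl; rewrite /cpartial /cform /= !partial_form_poly ?sl // ?subnn /= ?cats0.
- by case: (T s).
- by move=> u v i j ul; rewrite sT.
- by move=> u v i j ul; rewrite sT.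
Qed.

End ComplexForm.

Section ChainJets.
Variables (R : realType) (n : nat) (k : nat) (V : set 'rV[R]_n) (p0 : 'rV[R]_n) (F : 'rV[R]_n -> 'rV[R]_n).
Hypotheses (oV : open V) (Vp : V p0) (HF : forall j, Cka k 0 V (fun x => F x 0 j)) (Fp : F p0 = p0).
Hypothesis k1 : (1 <= k)%N.

Let ha0 : (0 : R) <= (0 : R) <= (1 : R). Proof. by rewrite lexx ler01. Qed.

(** When all jets of lower order vanish, only the top-order part of the chain rule is
    left. *)
Lemma chain_jets W (g : 'rV[R]_n -> R[i]) s : open W -> W p0 -> cCka k 0 W g -> (size s <= k)%N ->
  (forall u, (size u < size s)%N -> cpartial u g p0 = 0) ->
  cpartial s (g \o F) p0 = tens (fun i j => (jac F p0 i j)%:C%C) s (fun u => cpartial u g p0).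
Proof.
move=> oW Wp hg sk jets.
have [I [co [wd [rho [c [rho0 c0 rhoV [szw Hf Ht _ _]]]]]]] := chain_local ha0 oV HF sk Vp.
pose V' := [set v | V v /\ W (F v)].
have oV' : open V'.
  apply: (open_preimage_on oV oW) => v Vv.
  by apply: C1_map_continuous Vv; exact: Ck_C1_map k1 oV HF.
rewrite (Hf W V' g p0 oW oV') //; last 3 first.
- by move=> v [].
- by move=> v [].
- by split=> //; rewrite Fp.
rewrite Fp (bigID (fun i => size (wd i) == size s)) /= (Ht p0 (fun u => cpartial u g p0)) //.
rewrite [X in _ + X]big1 ?addr0 // => i wi.
by rewrite jets ?mulr0 // ltn_neqAle wi szw.
Qed.

Lemma chain_jets0 W (g : 'rV[R]_n -> R[i]) s : open W -> W p0 -> cCka k 0 W g -> (size s <= k)%N ->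
  (forall u, (size u <= size s)%N -> cpartial u g p0 = 0) -> cpartial s (g \o F) p0 = 0.
Proof.
move=> oW Wp hg sk jets; rewrite (chain_jets oW Wp hg sk) => [|u us]; last exact/jets/ltnW.
rewrite (tens_ext _ (T' := fun=> 0)) ?tens0 // => u us.
by apply: jets; rewrite us.
Qed.

End ChainJets.

Section FormalEigenfunction.
Variables (R : realType) (n' : nat).
Local Notation n := n'.+1.
Variables (k : nat) (V : set 'rV[R]_n) (p0 : 'rV[R]_n) (F : 'rV[R]_n -> 'rV[R]_n).
Hypotheses (oV : open V) (Vp : V p0) (HF : forall j, Cka k 0 V (fun x => F x 0 j)) (Fp : F p0 = p0).
Hypothesis k1 : (1 <= k)%N.
Variables (A : 'M[R]_n) (sigma : 'I_n -> R[i]) (nu : R[i]) (w : 'cV[R[i]]_n).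
Hypotheses (AF : forall i j, jac F p0 i j = A i j) (sA : eigenvalues_of A sigma).
Hypothesis Aw : complexify A *m w = nu *: w.
Hypothesis nres : forall m : 'I_n -> nat, (2 <= \sum_j m j)%N -> (\sum_j m j <= k)%N ->
  nu <> \prod_j sigma j ^+ m j.

Let ha0 : (0 : R) <= (0 : R) <= (1 : R). Proof. by rewrite lexx ler01. Qed.

(** The formal solution, degree by degree: in degree [i + 1] the error is a
    symmetric form, removed by adding a homogeneous polynomial. *)
Lemma formal_eigenfunction i : (1 <= i)%N -> (i <= k)%N ->
  exists P : 'rV[R]_n -> R[i],
    [/\ forall l a W, 0 <= a <= 1 -> open W -> cCka l a W P, P p0 = 0,
        forall j, cpartial [:: j] P p0 = w j 0 &
        forall s, (size s <= i)%N -> cpartial s (fun v => P (F v) - nu * P v) p0 = 0].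
Proof.
have tA s T : tens (fun i j => (jac F p0 i j)%:C%C) s T = tens (complexify A) s T.
  by rewrite tens_complexify; elim: s T => //= j s IH T; apply: eq_bigr => l _; rewrite IH AF.
have oT : open [set: 'rV[R]_n] by exact: openT.
have HPF (P : 'rV[R]_n -> R[i]) : cCka k 0 setT P -> cCka k 0 V (P \o F).
  by move=> hP; apply: (cCka_comp k1 ha0 oV oT).
have split_jet P s : cCka k 0 setT P -> (size s <= k)%N ->
    cpartial s (fun v => P (F v) - nu * P v) p0 = cpartial s (P \o F) p0 - nu * cpartial s P p0.
  move=> hP sk; have hPV : cCka k 0 V P by apply: cCka_sub hP.
  rewrite (cpartialB ha0 oV sk (HPF P hP) (cCkaZ ha0 nu oV hPV) Vp).
  by rewrite (cpartialZ ha0 nu oV sk hPV Vp).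
elim: i => // i IH _ ik; case: i IH ik => [|i] IH ik.
  pose T (u : seq 'I_n) := if u is [:: j] then w j 0 else 0.
  have sT : symmetric_form 1 T by move=> u v a b; rewrite size_cat /= !addnS.
  have hP l a W : 0 <= a <= 1 -> open W -> cCka l a W (cform p0 1 T) by move=> ? ?; exact: cCka_cform.
  exists (cform p0 1 T); split=> //.
  - by have := @cpartial_cform_lt R n p0 1 T [::] sT isT; rewrite cpartial_nil.
  - by move=> j; rewrite (cpartial_cform p0 sT).
  move=> s s1; have sk := leq_trans s1 ik.
  rewrite split_jet //; last exact: hP.
  have low u : (size u < size s)%N -> cpartial u (cform p0 1 T) p0 = 0.
    by move=> us; apply: cpartial_cform_lt => //; exact: leq_trans us s1.
  rewrite (chain_jets oV Vp HF Fp k1 oT) // ?tA; last exact: hP.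
  case: s s1 sk low => [|j [|//]] s1 sk low.
    have z := @cpartial_cform_lt R n p0 1 T [::] sT isT.
    by rewrite z -[tens _ _ _]/(cpartial [::] (cform p0 1 T) p0) z mulr0 subrr.
  rewrite (cpartial_cform p0 sT) // (tens_ext _ (T' := T)) /=; last first.
    by move=> u us; rewrite (cpartial_cform p0 sT) // us.
  by have /matrixP/(_ j 0) := Aw; rewrite !mxE => ->; rewrite subrr.
have [P [hP P0 Pw Pj]] := IH isT (ltnW ik).
pose E v := P (F v) - nu * P v.
have hPT : cCka k 0 setT P by exact: hP.
have hE : cCka k 0 V E.
  apply: cCkaB => //; [exact: HPF|].
  by apply: cCkaZ => //; exact: hP.
have nres' : ~ (exists m : 'I_n -> nat, (\sum_j m j)%N = i.+2 /\ nu = \prod_j sigma j ^+ m j).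
  by move=> [m [ms mE]]; apply: (nres (m := m)) mE; rewrite ms.
have sE : symmetric_form i.+2 (fun u => - cpartial u E p0).
  move=> u v a b ul; congr (- _); rewrite /cpartial; congr Complex.
    by apply: (@partial_swap _ _ V k 0) Vp => //; [rewrite ul|case: hE].
  by apply: (@partial_swap _ _ V k 0) Vp => //; [rewrite ul|case: hE].
have [T [sT HT]] := tens_solve_symmetric sA nres' sE.
pose H := cform p0 i.+2 T.
have hH l a W : 0 <= a <= 1 -> open W -> cCka l a W H by move=> ? ?; exact: cCka_cform.
have hHT : cCka k 0 setT H by exact: hH.
exists (fun v => P v + H v); split.
- by move=> l a W ha oW; apply: cCkaD => //; [exact: hP|exact: hH].
- by rewrite P0 add0r; have := @cpartial_cform_lt R n p0 i.+2 T [::] sT isT; rewrite cpartial_nil.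
- move=> j; have j1 : (size [:: j] <= 1)%N by [].
  rewrite (cpartialD (k := 1) (a := 0) oT j1 _ _ I); [|exact: hP|exact: hH].
  by rewrite Pw (cpartial_cform_lt p0 sT) ?addr0.
move=> s si; have sk := leq_trans si ik.
have -> : (fun v => P (F v) + H (F v) - nu * (P v + H v)) =
    (fun v => E v + (H (F v) - nu * H v)).
  by apply/funext => v; rewrite /E; ring.
have hEH : cCka k 0 V (fun v => H (F v) - nu * H v).
  by apply: cCkaB => //; [exact: HPF|apply: cCkaZ => //; exact: hH].
rewrite (cpartialD oV sk hE hEH Vp) split_jet //.
have low u : (size u < size s)%N -> cpartial u H p0 = 0.
  by move=> us; apply: cpartial_cform_lt => //; exact: leq_trans us si.
rewrite (chain_jets oV Vp HF Fp k1 oT I hHT sk low) tA.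
move: si; rewrite leq_eqVlt => /orP[/eqP si|si].
  rewrite (cpartial_cform p0 sT si) (tens_ext _ (T' := T)) ?HT ?subrr ?addrN //.
  by move=> u us; rewrite (cpartial_cform p0 sT) // us.
rewrite Pj // add0r (cpartial_cform_lt p0 sT si) mulr0 subr0.
rewrite (tens_ext _ (T' := fun=> 0)) ?tens0 // => u us.
by apply: cpartial_cform_lt => //; rewrite us.
Qed.

End FormalEigenfunction.

(** * The limit eigenfunction *)

Lemma normcX (R : realType) (z : R[i]) (J : nat) : normc (z ^+ J) = normc z ^+ J.
Proof. by elim: J => [|J IH]; rewrite ?normc1 // !exprS normcM IH. Qed.

Lemma cpartial_zero (R : realType) (p : nat) s (x : 'rV[R]_p) : cpartial s (fun=> 0 : R[i]) x = 0.
Proof.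
have z : partial s (fun=> 0 : R) = (fun=> 0 : R) :> ('rV[R]_p -> R).
  elim: s => [//|i s IH]; rewrite -[partial _ _]/(partial [:: i] (partial s (fun=> 0))) IH.
  by apply/funext => y; exact: derive_cst.
by rewrite /cpartial /= z.
Qed.

Lemma cvg_geometric_bound (R : realType) (K b e : R) : 0 <= b -> b < 1 -> 0 < e ->
  exists J0 : nat, forall J, (J0 <= J)%N -> K * b ^+ J <= e.
Proof.
move=> b0 b1 e0.
have c : K * b ^+ J @[J --> \oo] --> K * 0.
  by apply: cvgM; [exact: cvg_cst|apply: cvg_expr; rewrite ger0_norm].
rewrite mulr0 in c; have /cvgrPdist_le/(_ _ e0)[J0 _ H] := c.
exists J0 => J JJ; have := H J JJ; rewrite sub0r normrN; exact: le_trans (ler_norm _).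
Qed.

Section EigenfunctionLimit.
Variables (R : realType) (n' : nat).
Local Notation n := n'.+1.
Variables (Q : smooth_manifold R n) (tk : time_kind) (Phi : Q -> time R tk -> Q).
Variables (x0 : Q) (c : chart R n Q).
Hypotheses (hc : smooth_chart c) (hx0 : chart_dom c x0).
Hypotheses (hPhi : dynamical_system Phi) (hPhi1 : Ckalpha_flow (Fin 1) 0 Phi).
Hypothesis fix0 : forall t, Phi x0 t = x0.
Hypothesis basin : forall x, Phi x @ @time_infty R tk --> x0.
Variables (k : nat) (a th : R) (nu : R[i]) (P : Q -> R[i]) (W : set 'rV[R]_n).
Hypotheses (k1 : (1 <= k)%N) (ha : 0 <= a <= 1) (hPhik : Ckalpha_flow (Fin k) a Phi).

Let p0 := chart_coord c x0.
Local Notation A := (chart_jacobian c (Phi ^~ 1) x0).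
Local Notation param := (chart_param c).
Local Notation fmap := (flow_map Phi c).

Hypotheses (th0 : 0 < th) (hth : spectral_radius A < th) (th1 : th < 1).
Hypothesis hnu : th `^ (k%:R + a) < normc nu.
Hypotheses (oW : open W) (Wp : W p0) (Wi : W `<=` chart_img c) (hP : cCka k a W (P \o param)).
Hypothesis jets : forall s, below_order (size s) (Fin k) a ->
  cpartial s ((fun x => P (Phi x 1) - nu * P x) \o param) p0 = 0.

Let a0 : 0 <= a. Proof. by case/andP: ha. Qed.
Let nu0 : nu != 0.
Proof. by apply/eqP => nu0; move: hnu; rewrite nu0 normc0 ltNge powR_ge0. Qed.

Let defect (N : nat) x := P (Phi x N%:R) - nu ^+ N * P x.

Lemma chart_paramK v : chart_dom c v -> param (chart_coord c v) = v.
Proof. by have [[_ _ pK _ _] _] := hc; exact: pK. Qed.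

Lemma defect_regular N : exists O, [/\ open O, O p0, O `<=` W & cCka k a O (defect N \o param)].
Proof.
have [V [oV Vp Vd HV]] := flow_map_local hc hx0 fix0 N%:R k1 ha hPhik.
pose O1 := [set v | V v /\ W (fmap N%:R v)].
have cf v : V v -> {for v, continuous (fmap N%:R)}.
  by apply: C1_map_continuous; exact: Ck_C1_map k1 oV HV.
have oO1 : open O1 by exact: open_preimage_on.
pose O := O1 `&` W; have oO : open O by exact: openI.
exists O; split=> //.
- by split=> //; split=> //; rewrite flow_map_fixed.
- by move=> v [].
apply: (@cCka_ext _ _ k a O (fun v => (P \o param) (fmap N%:R v) - nu ^+ N * (P \o param) v)) => //.
  by move=> v [[/Vd[_ dv] _] _]; rewrite /defect /= /flow_map chart_paramK.
apply: cCkaB => //.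
  apply: (cCka_comp (W := W) (H := fmap N%:R)) => //; first by move=> v [[]].
  by move=> j; apply: Cka_sub (HV j) => v [[]].
by apply: cCkaZ => //; apply: cCka_sub hP => v [].
Qed.

(** Flatness of the defect passes from time 1 to time [N], since $P \circ \Phi^{N+1} -
    \nu^{N+1} P = (P \circ \Phi^N - \nu^N P) \circ \Phi^1 + \nu^N (P \circ \Phi^1 - \nu
    P)$ and $\Phi^1$ fixes the point. *)
Lemma defect_jets N s : below_order (size s) (Fin k) a -> cpartial s (defect N \o param) p0 = 0.
Proof.
have ha0 : (0 : R) <= (0 : R) <= (1 : R) by rewrite lexx ler01.
elim: N s => [|N IH] s sb.
  rewrite (_ : _ \o _ = fun=> 0) ?cpartial_zero //; apply/funext => v /=.
  by rewrite /defect hPhi.1 expr0 mul1r subrr.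
have sk : (size s <= k)%N by exact: below_order_leq ha sb.
have [V [oV Vp Vd HV]] := flow_map_local hc hx0 fix0 1 k1 ha hPhik.
have [ O [oO Op OW HO]] := defect_regular N.
have [ O1 [oO1 O1p O1W HO1]] := defect_regular 1.
have cf v : V v -> {for v, continuous (fmap 1)}.
  by apply: C1_map_continuous; exact: Ck_C1_map k1 oV HV.
pose D1 := [set v | V v /\ O (fmap 1 v)].
have oD1 : open D1 by exact: open_preimage_on.
pose D := D1 `&` O1; have oD : open D by exact: openI.
have Dp : D p0 by split=> //; split=> //; rewrite flow_map_fixed.
have reg1 : cCka k a D ((defect N \o param) \o fmap 1).
  apply: (cCka_comp (W := O)) => //; first by move=> v [[]].
  by move=> j; apply: Cka_sub (HV j) => v [[]].
have reg2 : cCka k a D (defect 1 \o param) by apply: cCka_sub HO1 => v [].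
rewrite (@cpartial_ext _ _ D _ (fun v => ((defect N \o param) \o fmap 1) v + nu ^+ N * (defect 1 \o param) v)) //.
  rewrite (cpartialD oD sk reg1 (cCkaZ ha _ oD reg2) Dp) (cpartialZ ha _ oD sk reg2 Dp).
  have -> : cpartial s (defect 1 \o param) p0 = 0.
    exact: jets sb.
  rewrite mulr0 addr0.
  apply: (@chain_jets0 R n k V p0 (fmap 1) oV Vp _ _ k1 O) => //.
  - by move=> j; exact: Cka0W (HV j).
  - by rewrite flow_map_fixed.
  - by case: HO => h1 h2; split; [exact: Cka0W h1|exact: Cka0W h2].
  - move=> u us; apply: IH; move: sb => /=; apply: le_lt_trans; by rewrite ler_nat.
move=> v [[/Vd[_ dv] _] _]; rewrite /defect /= /flow_map chart_paramK // -natr1 hPhi.2 exprSr.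
by ring.
Qed.

(** The functions $F_J = \nu^{-NJ} P \circ \Phi^{NJ}$ differ in consecutive steps by
    $\nu^{-N(J+1)} D \circ \Phi^{NJ}$, with $D$ the defect for time [N]. As $D$ has
    weight $k + a$, these differences decay geometrically, at the rate $b = q / |\nu|^N$
    where $\theta^{N(k+a)} < q < |\nu|^N$. So $F_J$ converges near the fixed point;
    since every orbit gets there, the limit exists everywhere and is locally
    $\nu^{-NJ_1}$ times the local limit composed with $\Phi^{N J_1}$, whence its
    regularity. *)
Lemma eigenfunction_limit : exists psi N r b C,
  [/\ [/\ (0 < N)%N, 0 < r, r <= 2^-1, 0 <= b < 1 & 0 <= C],
      nball p0 r `<=` chart_img c,
      Ckalpha_fun (Fin k) a psi,
      forall x, psi (Phi x 1) = nu * psi x &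
      forall J, let d v := (nu ^+ (N * J))^-1 * P (Phi (param v) (N * J)%:R) - psi (param v) in
        cCka k a (nball p0 r) d /\ weighted p0 k a r (C * b ^+ J) d].
Proof.
have ha0 : (0 : R) <= (0 : R) <= (1 : R) by rewrite lexx ler01.
have [N [V [r1 [N0 oV r10 r1V [Vd HV HJ]]]]] := local_contraction hc hx0 hPhi hPhi1 fix0 k1 ha hPhik th0 hth.
set m := th ^+ N in HJ; pose nuN := nu ^+ N; pose L := normc nuN.
have nuN0 : nuN != 0 by rewrite expf_neq0.
have L0 : 0 < L by exact: normc_gt0.
have m0 : 0 <= m by rewrite exprn_ge0 // ltW.
have m1 : m <= 1 by rewrite exprn_ile1 // ltW.
have mL : m `^ (k%:R + a) < L.
  rewrite /m /L normcX -powR_mulrn ?(ltW th0) // powRAC powR_mulrn ?powR_ge0 //.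
  by rewrite ltrXn2r ?powR_ge0 ?normc_ge0 // -lt0n N0.
pose q := (m `^ (k%:R + a) + L) / 2.
have mq : m `^ (k%:R + a) < q by rewrite /q; lra.
have qL : q < L by rewrite /q; lra.
have q0 : 0 <= q by apply: le_trans (ltW mq); exact: powR_ge0.
pose b := q / L.
have b0 : 0 <= b by rewrite divr_ge0 // ltW.
have b1 : b < 1 by rewrite ltr_pdivrMr // mul1r.
have [r0 [r00 r0r1 Hcontr]] := weighted_contraction ha oV k1 HV m0 m1 r10 r1V (flow_map_fixed hc hx0 fix0 _) HJ mq.
have [ O [oO Op OW HO]] := defect_regular N.
have [ O1 [oO1 O1p O1W HO1]] := defect_regular 1.
have [rN [KN [rN0 KN0 rNO HwN]]] := weighted_of_jets ha oO Op HO (@defect_jets N).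
have [rE [KE [rE0 KE0 rEO HwE]]] := weighted_of_jets ha oO1 O1p HO1 (@defect_jets 1).
pose r := Num.min (Num.min r0 rN) (Num.min rE 2^-1).
have r_gt0 : 0 < r by rewrite !lt_min r00 rN0 rE0 invr_gt0 ltr0n.
have rr0 : r <= r0 by rewrite !ge_min lexx.
have rrN : r <= rN by rewrite !ge_min lexx orbT.
have rrE : r <= rE by rewrite !ge_min lexx !orbT.
have rh : r <= 2^-1 by rewrite !ge_min lexx !orbT.
have r_le1 : r <= 1 by lra.
pose B := nball p0 r; have oB : open B by exact: open_nball.
have BV : B `<=` V by move=> v vr; apply: r1V; apply: lt_le_trans vr _; exact: le_trans rr0 r0r1.
have BW : B `<=` W by move=> v vr; apply/OW/rNO; exact: lt_le_trans vr rrN.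
have Bi : B `<=` chart_img c by move=> v /BW/Wi.
pose G := fmap N%:R.
have GB v : B v -> B (G v).
  by apply: (nball_stable oV k1 HV m0 m1 r10 r1V (flow_map_fixed hc hx0 fix0 _) HJ); exact: le_trans r0r1.
have HG j : Cka k a B (fun v => G v 0 j) by exact: Cka_sub BV (HV j).
have PhiS v (J : nat) : B v -> Phi (param v) (N * J.+1)%:R = Phi (param (G v)) (N * J)%:R.
  move=> /BV/Vd[_ dv]; rewrite mulnS natrD addrC hPhi.2 /G /flow_map chart_paramK //.
(* the rate b applies to every function of weight k + a: to both defects *)
have iterate (X : Q -> R[i]) K : 0 <= K -> cCka k a B (X \o param) -> weighted p0 k a r K (X \o param) ->
    forall J, let h v := (nuN ^+ J)^-1 * X (Phi (param v) (N * J)%:R) in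
      cCka k a B h /\ weighted p0 k a r (K * b ^+ J) h.
  move=> K0 hX wX; elim=> [|J [IH1 IH2]] h.
    have hE : X \o param = h.
      by apply/funext => v; rewrite /h /= expr0 invr1 mul1r muln0 hPhi.1.
    by rewrite -hE expr0 mulr1.
  set hJ := (fun v => _) in IH1 IH2.
  have hE v : B v -> nuN^-1 * (hJ \o G) v = h v.
    by move=> Bv; rewrite /h /hJ /= PhiS // exprS invfM mulrA.
  have hJG : cCka k a B (hJ \o G) by apply: (cCka_comp (W := B)).
  split; first by apply: cCka_ext hE _ => //; exact: cCkaZ.
  apply: weighted_ext hE _.
  have KJ0 : 0 <= K * b ^+ J by rewrite mulr_ge0 // exprn_ge0.
  have := weightedZ ha nuN^-1 hJG (Hcontr r hJ _ rr0 KJ0 IH1 IH2).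
  by rewrite normcV -/L exprS; congr weighted; rewrite /b; ring.
have hXN : cCka k a B (defect N \o param) by apply: cCka_sub HO => v vr; apply: rNO; exact: lt_le_trans vr rrN.
have hXE : cCka k a B (defect 1 \o param) by apply: cCka_sub HO1 => v vr; apply: rEO; exact: lt_le_trans vr rrE.
have itN := iterate _ _ KN0 hXN (weighted_le rrN (lexx _) HwN).
have itE := iterate _ _ KE0 hXE (weighted_le rrE (lexx _) HwE).
pose F J v := (nuN ^+ J)^-1 * P (Phi (param v) (N * J)%:R).
pose e J v := nuN^-1 * ((nuN ^+ J)^-1 * defect N (Phi (param v) (N * J)%:R)).
have FS J v : F J.+1 v = F J v + e J v.
  have PN x : P (Phi x N%:R) = defect N x + nuN * P x by rewrite /defect -/nuN; ring.
  by rewrite /F /e mulnS natrD hPhi.2 PN exprS; field; rewrite nuN0 expf_neq0.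
have F0 : F 0%N = P \o param.
  by apply/funext => v; rewrite /F /= expr0 invr1 mul1r muln0 hPhi.1.
pose K := L^-1 * KN; have K0 : 0 <= K by rewrite mulr_ge0 // invr_ge0 ltW.
have He J : cCka k a B (e J) /\ weighted p0 k a r (K * b ^+ J) (e J).
  have [h1 h2] := itN J; split; first exact: cCkaZ.
  by have := weightedZ ha nuN^-1 h1 h2; rewrite normcV -/L mulrA.
have HF J : cCka k a B (F J).
  elim: J => [|J IH]; first by rewrite F0; exact: cCka_sub hP.
  have -> : F J.+1 = (fun v => F J v + e J v) by apply/funext => v; exact: FS.
  by apply: cCkaD => //; case: (He J).
have d0 : 0 < 1 - b by rewrite subr_gt0.
pose C := K / (1 - b); have C0 : 0 <= C by rewrite divr_ge0 // ltW.
pose eps J := C * b ^+ J.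
have telescope i d : weighted p0 k a r (C * b ^+ i * (1 - b ^+ d)) (fun v => F i v - F (i + d)%N v).
  elim: d => [|d IHd].
    have -> : (fun v => F i v - F (i + 0)%N v) = (fun v => 0 * F i v).
      by apply/funext => v; rewrite addn0 subrr mul0r.
    rewrite expr0 subrr mulr0.
    split=> [s x sk xr|_ s x y sk xr yr].
      by rewrite (cpartialZ ha 0 oB sk (HF i) xr) mul0r normc0 mul0r.
    have sk' : (size s <= k)%N by rewrite sk.
    by rewrite (cpartialZ ha 0 oB sk' (HF i) xr) (cpartialZ ha 0 oB sk' (HF i) yr) !mul0r subrr normc0.
  have [h1 h2] := He (i + d)%N.
  have h3 := weightedZ ha (-1) h1 h2; rewrite normcN normc1 mul1r in h3.
  have := weightedD (cCkaB ha oB (HF i) (HF (i + d)%N)) (cCkaZ ha (-1) oB h1) IHd h3.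
  have -> : C * b ^+ i * (1 - b ^+ d) + K * b ^+ (i + d) = C * b ^+ i * (1 - b ^+ d.+1).
    by rewrite /C exprD exprS; field; rewrite gt_eqF.
  by apply: weighted_ext => v _; rewrite addnS FS; ring.
have wF i j : (i <= j)%N -> weighted p0 k a r (eps i) (fun v => F i v - F j v).
  move=> ij; rewrite -(subnKC ij); apply: weighted_le (lexx _) _ (telescope i _).
  by apply: ler_piMr; [rewrite mulr_ge0 ?exprn_ge0|rewrite gerBl exprn_ge0].
have eps0 J : 0 <= eps J by rewrite mulr_ge0 ?exprn_ge0.
have epsc : eps J @[J --> \oo] --> 0.
  rewrite -(mulr0 C); apply: cvgM; first exact: cvg_cst.
  by apply: cvg_expr; rewrite ger0_norm.
have [g [Hg wg]] := weighted_limit ha r_le1 HF eps0 epsc wF.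
have weighted_value X K1 v : 0 <= K1 -> weighted p0 k a r K1 X -> B v -> normc (X v) <= K1.
  move=> K10 [h _] Bv; have := h [::] v isT Bv; rewrite cpartial_nil subn0 => /le_trans; apply.
  rewrite -[leRHS]mulr1 ler_wpM2l // -(powRr0 `|v - p0|); apply: powR_le_expo => //.
    by apply: ltW; apply: lt_le_trans Bv _.
  by rewrite addr_ge0.
(* away from the fixed point only pointwise limits are used; uD reduces them to B *)
pose u J x := (nuN ^+ J)^-1 * P (Phi x (N * J)%:R).
pose limit_of x z := forall e, 0 < e -> exists J0 : nat, forall J, (J0 <= J)%N -> normc (u J x - z) <= e.
have limit_uniq x z z' : limit_of x z -> limit_of x z' -> z = z'.
  move=> h h'; apply/eqP; rewrite -subr_eq0; apply/eqP/eq0_normc/eqP.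
  rewrite eq_le normc_ge0 andbT; apply/ler_addgt0Pl => e1 e10; rewrite addr0.
  have e2 : 0 < e1 / 2 by rewrite divr_gt0.
  have [J1 H1] := h _ e2; have [J2 H2] := h' _ e2.
  rewrite -(subrKA (u (maxn J1 J2) x)); apply: le_trans (le_normcD _ _) _.
  rewrite normc_dist; have := H1 _ (leq_maxl J1 J2); have := H2 _ (leq_maxr J1 J2); lra.
pose D := [set y | chart_dom c y /\ B (chart_coord c y)].
have uD (J1 J : nat) x : D (Phi x (N * J1)%:R) ->
    u (J1 + J)%N x = (nuN ^+ J1)^-1 * F J (chart_coord c (Phi x (N * J1)%:R)).
  move=> [dy By]; rewrite /u /F chart_paramK // mulnDr natrD addrC hPhi.2 exprD invfM mulrA //.
have limD (J1 : nat) x : D (Phi x (N * J1)%:R) ->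
    limit_of x ((nuN ^+ J1)^-1 * g (chart_coord c (Phi x (N * J1)%:R))).
  move=> Dy e1 e10; pose M := normc (nuN ^+ J1)^-1.
  have [J0 HJ0] := cvg_geometric_bound (M * C) b0 b1 e10.
  exists (J1 + J0)%N => J JJ; have J1J : (J1 <= J)%N by apply: leq_trans JJ; exact: leq_addr.
  rewrite -(subnKC J1J) uD // -mulrBr normcM.
  apply: le_trans (_ : M * eps (J - J1)%N <= _).
    rewrite ler_wpM2l ?normc_ge0 //; case: (Dy) => _ By.
    exact: (weighted_value (fun v => F (J - J1)%N v - g v)).
  by rewrite mulrA; apply: HJ0; rewrite leq_subRL.
have [[od oi pK cK cp] _] := hc.
have nD : nbhs x0 D.
  have n1 : nbhs x0 (chart_dom c) by exact: open_nbhs_nbhs.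
  have n2 : nbhs x0 (chart_coord c @^-1` B) by apply: cK => //; exact: nbhs_nball.
  exact: (filterI n1 n2).
have reach x : exists J1, D (Phi x (N * J1)%:R).
  have [J0 HJ0] := time_infty_nat (@basin x _ nD); exists J0; apply: HJ0.
  by rewrite leq_pmull.
have lim_ex x : exists z, limit_of x z by have [J1 /limD h] := reach x; eexists; exact: h.
have [psi Hpsi] := choice lim_ex.
have psiD (J1 : nat) x : D (Phi x (N * J1)%:R) ->
    psi x = (nuN ^+ J1)^-1 * g (chart_coord c (Phi x (N * J1)%:R)).
  by move=> /limD h; exact: limit_uniq (Hpsi x) h.
have psig v : B v -> psi (param v) = g v.
  move=> Bv; have [dv cv] := chart_coordK (hc.1) (Bi _ Bv).
  have Dv : D (Phi (param v) (N * 0)%:R) by rewrite muln0 hPhi.1; split=> //; rewrite cv.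
  by rewrite (psiD _ _ Dv) expr0 invr1 mul1r muln0 hPhi.1 cv.
exists psi, N, r, b, C; split=> //; first by rewrite b0 b1.
- apply: Ckalpha_fun_of_local => // x.
  have [J1 Dx] := reach x; case: (Dx) => dx Bx.
  have [d ad dd] := atlas_cover x.
  have hd := atlas_smooth_chart ad.
  have [ O2 [oO2 O2x O2d HO2]] := flow_slice k1 ha hd hc hPhik dd dx.
  pose H v := chart_coord c (Phi (chart_param d v) (N * J1)%:R).
  have cH v : O2 v -> {for v, continuous H}.
    by apply: C1_map_continuous; exact: Ck_C1_map k1 oO2 HO2.
  pose O3 := [set v | O2 v /\ B (H v)].
  have oO3 : open O3 by exact: open_preimage_on.
  have px : chart_param d (chart_coord d x) = x by have [[_ _ pd _ _] _] := hd; exact: pd.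
  exists d, O3; split=> //; first by split=> //; rewrite /H px.
  apply: (@cCka_ext _ _ k a O3 (fun v => (nuN ^+ J1)^-1 * (g \o H) v)) => //.
    by move=> v [/O2d[_ dv] Bv]; rewrite /= (psiD J1).
  apply: cCkaZ => //; apply: (cCka_comp (W := B)) => //; first by move=> v [].
  by move=> j; apply: Cka_sub (HO2 j) => v [].
- move=> x; apply: (limit_uniq (Phi x 1)); first exact: Hpsi.
  have [J1 Dx] := reach x; case: (Dx) => dx Bx.
  (* N is only one of the iterates: the equation at time 1 comes from the time-1 defect
     *)
  have nuu J : u J (Phi x 1) = nu * u J x + (nuN ^+ J)^-1 * defect 1 (Phi x (N * J)%:R).
    rewrite /u /defect expr1 -!hPhi.2 [_ + 1]addrC; ring.
  pose M := normc (nuN ^+ J1)^-1.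
  move=> e1 e10; have e2 : 0 < e1 / 2 by rewrite divr_gt0.
  have nup : 0 < normc nu by exact: normc_gt0.
  have e3 : 0 < e1 / 2 / normc nu by rewrite divr_gt0.
  have [J2 HJ2] := Hpsi x _ e3.
  have [J0 HJ0] := cvg_geometric_bound (M * KE) b0 b1 e2.
  exists (maxn J2 (J1 + J0)) => J; rewrite geq_max => /andP[JJ2 JJ].
  have J1J : (J1 <= J)%N by apply: leq_trans JJ; exact: leq_addr.
  rewrite nuu addrAC -mulrBr; apply: le_trans (le_normcD _ _) _.
  have -> : e1 = e1 / 2 + e1 / 2 by rewrite -splitr.
  apply: lerD.
    by rewrite normcM mulrC -ler_pdivlMr //; exact: HJ2.
  have [_ wE] := itE (J - J1)%N.
  have := weighted_value _ _ _ _ wE Bx; rewrite chart_paramK // => h.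
  rewrite -(subnKC J1J) mulnDr natrD addrC hPhi.2 exprD invfM -mulrA normcM.
  apply: le_trans (ler_wpM2l (normc_ge0 _) (h _)) _; first by rewrite mulr_ge0 ?exprn_ge0.
  by rewrite mulrA; apply: HJ0; rewrite leq_subRL.
- move=> J d.
  have dE v : B v -> F J v - g v = d v.
    by move=> Bv; rewrite /d /F psig // /nuN -exprM.
  split; last exact: weighted_ext dE (wg J).
  by apply: cCka_ext dE _ => //; exact: cCkaB.
Qed.

End EigenfunctionLimit.

(** * Uniformity over compact sets and bounded times *)

Lemma norm_row_mx_lt (R : realType) (m n : nat) (u : 'rV[R]_m) (w : 'rV[R]_n) e : 0 < e ->
  `|u| < e -> `|w| < e -> `|row_mx u w| < e.
Proof.
move=> e0 ue we; apply: norm_rV_ltP => // j; case: (splitP j) => [j1 jE|j2 jE].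
  have -> : j = lshift n j1 by apply/val_inj; rewrite /= jE.
  by rewrite row_mxEl; apply: le_lt_trans (coord_le_norm _ _) ue.
have -> : j = rshift m j2 by apply/val_inj; rewrite /= jE.
by rewrite row_mxEr; apply: le_lt_trans (coord_le_norm _ _) we.
Qed.

Lemma norm_row_mx0 (R : realType) (m n : nat) (u : 'rV[R]_m) : `|row_mx u (0 : 'rV[R]_n)| <= `|u|.
Proof.
apply: norm_rV_le => // j; case: (splitP j) => [j1 jE|j2 jE].
  have -> : j = lshift n j1 by apply/val_inj; rewrite /= jE.
  by rewrite row_mxEl coord_le_norm.
have -> : j = rshift m j2 by apply/val_inj; rewrite /= jE.
by rewrite row_mxEr mxE normr0.
Qed.

(** Used to derive bounds at a fixed time from the flow, a map of space and time
    jointly. *)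
Lemma partial_slice (R : realType) (m n : nat) (g : 'rV[R]_(m + n) -> R) (t : 'rV[R]_n) s v :
  partial s (fun v => g (row_mx v t)) v = partial (map (lshift n) s) g (row_mx v t).
Proof.
elim: s v => [//|i s IH] v.
change ('D_(delta_mx 0 i) (partial s (fun v => g (row_mx v t))) v =
  'D_(delta_mx 0 (lshift n i)) (partial (map (lshift n) s) g) (row_mx v t)).
have -> : partial s (fun v => g (row_mx v t)) = fun v => partial (map (lshift n) s) g (row_mx v t).
  exact/funext.
have E (h : R) : row_mx (h *: delta_mx 0 i + v) t = h *: delta_mx 0 (lshift n i) + row_mx v t.
  apply/rowP => j; case: (splitP j) => [j1 jE|j2 jE].
    have -> : j = lshift n j1 by apply/val_inj; rewrite /= jE.
    by rewrite row_mxEl [RHS]mxE row_mxEl !mxE (inj_eq (@lshift_inj _ _)).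
  have -> : j = rshift m j2 by apply/val_inj; rewrite /= jE.
  by rewrite row_mxEr [RHS]mxE row_mxEr !mxE eq_rlshift andbF mulr0 add0r.
rewrite /derive /=.
have -> // : (fun h : R => h^-1 *: (partial (map (lshift n) s) g (row_mx (h *: delta_mx 0 i + v) t) -
    partial (map (lshift n) s) g (row_mx v t))) =
  (fun h : R => h^-1 *: (partial (map (lshift n) s) g (h *: delta_mx 0 (lshift n i) + row_mx v t) -
    partial (map (lshift n) s) g (row_mx v t))) by apply/funext => h; rewrite E.
Qed.

Lemma cpartial_slice (R : realType) (m n : nat) (g : 'rV[R]_(m + n) -> R[i]) (t : 'rV[R]_n) s v :
  cpartial s (fun v => g (row_mx v t)) v = cpartial (map (lshift n) s) g (row_mx v t).
Proof.
by congr Complex; [exact: (partial_slice (fun z => complex.Re (g z)))|exact: (partial_slice (fun z => complex.Im (g z)))].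
Qed.

Section TimeWindow.
Variables (R : realType) (tk : time_kind).
Implicit Types (e : chart R (time_dim tk) (time R tk)) (T : nat).

(** Any late time is a multiple of [N] plus a time in a fixed window; the window is
    where compactness is used, the multiple where geometric decay is used. *)
Lemma time_decompose T N (t : time R tk) : (0 < N)%N -> T%:R <= t ->
  exists J (t' : time R tk), [/\ T%:R <= t', t' <= (T + N)%:R & t = t' + (N * J)%:R].
Proof.
move=> N0; have [B tB] := time_natural_bound t.
have {tB} : t <= (T + N * B)%:R.
  by apply: le_trans tB _; rewrite ler_nat (leq_trans (leq_pmull B N0)) // leq_addl.
elim: B t => [|B IH] t tB Tt.
  exists 0%N, t; split=> //; last by rewrite muln0 addr0.
  by apply: le_trans tB _; rewrite ler_nat muln0 addn0 leq_addr.
have [tN|tN] := leP t (T + N)%:R; first by exists 0%N, t; split; rewrite // muln0 addr0.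
have [||J [t' [h1 h2 h3]]] := IH (t - N%:R).
- by rewrite lerBlDr -natrD -addnA -mulnSr.
- by rewrite lerBrDr -natrD ltW.
exists J.+1, t'; split=> //.
by rewrite mulnS natrD addrCA -h3 addrC subrK.
Qed.

(** Bounded intervals of times are finite or compact, so that locally uniform
    bounds are uniform on them. *)
Lemma time_window_uniform (X : nat -> time R tk -> Prop) T0 T :
  (forall M M' t, (M <= M')%N -> X M t -> X M' t) ->
  (forall t : time R tk, T0%:R <= t -> t <= T%:R -> exists e, [/\ @time_atlas R tk e, chart_dom e t &
     exists M, \forall tau \near chart_coord e t, X M (chart_param e tau)]) ->
  exists M, forall t : time R tk, T0%:R <= t -> t <= T%:R -> X M t.
Proof.
case: tk X => X mono H.
  have H' (j : 'I_T.+1) : exists M, (T0 <= j)%N -> X M (Posz j).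
    have [T0j|] := leqP T0 j; last by exists 0%N.
    have [||e [[z ->] zj [M HM]]] := H (Posz j).
    - by rewrite natz lez_nat.
    - by rewrite natz lez_nat -ltnS.
    by exists M => _; have := nbhs_singleton HM; rewrite /= in zj *; rewrite zj.
  have [M HM] := choice H'.
  exists (\max_j M j) => -[j|j]; rewrite !natz // !lez_nat => T0j; rewrite -ltnS => jT.
  by apply: mono (HM (Ordinal jT) T0j); exact: (leq_bigmax (Ordinal jT)).
have cK : compact `[(T0%:R : R), T%:R] by exact: segment_compact.
have [|M0 _ HM] := (compact_near_coveringP _).1 cK nat \oo (fun M t => X M t) _.
  move=> t; rewrite /= in_itv /= => /andP[t0 tT].
  have [e [-> _ [M HM]]] := H t t0 tT.
  have [r /= r0 rV] := (nbhs_ballP _ _).1 HM.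
  exists (ball t r, [set M' | (M <= M')%N]) => /=; last first.
    move=> [t' M'] /= [tt' MM']; apply: mono MM' _.
    have := rV (const_mx t'); rewrite mxE; apply.
    rewrite -ball_normE /=; apply: norm_rV_ltP => // j; rewrite !mxE.
    by move: tt'; rewrite -ball_normE.
  by split; [exact: nbhsx_ballx|exists M].
exists M0 => t t0 tT; apply: (HM M0 (leqnn M0)).
by rewrite /= in_itv /= t0.
Qed.

End TimeWindow.

Section Convergence.
Variables (R : realType) (n' : nat).
Local Notation n := n'.+1.
Variables (Q : smooth_manifold R n) (tk : time_kind) (Phi : Q -> time R tk -> Q).
Variables (x0 : Q) (c : chart R n Q).
Hypotheses (hc : smooth_chart c) (hx0 : chart_dom c x0).
Hypotheses (hPhi : dynamical_system Phi) (hPhi1 : Ckalpha_flow (Fin 1) 0 Phi).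
Hypothesis stable : asymptotically_stable Phi x0.
Hypothesis basin : forall x, Phi x @ @time_infty R tk --> x0.
Variables (k : nat) (a r : R).
Hypotheses (k1 : (1 <= k)%N) (ha : 0 <= a <= 1) (hPhik : Ckalpha_flow (Fin k) a Phi).
Hypotheses (r0 : 0 < r) (r1 : r <= 1).

Let p0 := chart_coord c x0.
Local Notation param := (chart_param c).
Let a0 : 0 <= a. Proof. by case/andP: ha. Qed.

Let near_x0 := [set y : Q | chart_dom c y /\ nball p0 r (chart_coord c y)].

Lemma nbhs_near_x0 : nbhs x0 near_x0.
Proof.
have [[od oi pK cK cp] _] := hc.
have n1 : nbhs x0 (chart_dom c) by exact: open_nbhs_nbhs.
have n2 : nbhs x0 (chart_coord c @^-1` nball p0 r) by apply: cK => //; exact: nbhs_nball.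
exact: (filterI n1 n2).
Qed.

(** Compact sets are absorbed uniformly: stability turns pointwise convergence
    into convergence that is uniform near each point. *)
Lemma compact_absorbed (h : chart R n Q) (K : set 'rV[R]_n) : smooth_chart h -> compact K ->
  K `<=` chart_img h ->
  exists T : nat, forall t : time R tk, T%:R <= t -> forall v, K v -> near_x0 (Phi (chart_param h v) t).
Proof.
move=> hh cK Ki; have [X nX HX] := stable.1 _ nbhs_near_x0.
have [|T _ HT] := (compact_near_coveringP _).1 cK nat \oo
   (fun J v => forall t : time R tk, J%:R <= t -> near_x0 (Phi (chart_param h v) t)) _; last first.
  by exists T => t tT v Kv; exact: (HT T (leqnn T)).
move=> v Kv; have [J0 HJ] := time_infty_nat (@basin (chart_param h v) _ (nbhs_interior nX)).
have nX0 : nbhs (Phi (chart_param h v) J0%:R) X°.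
  by apply: open_nbhs_nbhs; split; [exact: open_interior|exact: HJ].
have nv := flow_near hh hPhi1 (Ki _ Kv) nX0.
exists ([set w | chart_img h w /\ X° (Phi (chart_param h w) J0%:R)], [set J | (J0 <= J)%N]) => /=.
  by split=> //=; exists J0.
move=> [w J] /= [[_ Xw] J0J] t Jt.
rewrite -(subrK J0%:R t) (hPhi.2) ; apply: HX; first exact: interior_subset.
by rewrite subr_ge0 (le_trans _ Jt) // ler_nat.
Qed.

End Convergence.

Lemma time_chart_exists (R : realType) tk (t : time R tk) :
  exists2 e, @time_atlas R tk e & chart_dom e t.
Proof.
case: tk t => t /=; last by eexists; [reflexivity|].
by eexists; [exists t; reflexivity|].
Qed.

(** Makes the chart of time independent of the point of the compact set. *)
Lemma time_chart_unique (R : realType) tk (t : time R tk) e e' :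
  @time_atlas R tk e -> @time_atlas R tk e' -> chart_dom e t -> chart_dom e' t -> e = e'.
Proof. by case: tk t e e' => t e e' /=; [case=> z -> [z' ->] /= <- <-|move=> -> ->]. Qed.

Section WindowBounds.
Variables (R : realType) (n : nat).
Variables (Q : smooth_manifold R n) (tk : time_kind) (Phi : Q -> time R tk -> Q).
Variables (c h : chart R n Q) (p0 : 'rV[R]_n).
Hypotheses (hc : smooth_chart c) (hh : smooth_chart h).
Variables (k : nat) (a r : R).
Hypotheses (k1 : (1 <= k)%N) (ha : 0 <= a <= 1) (hPhik : Ckalpha_flow (Fin k) a Phi).
Hypotheses (r0 : 0 < r) (r1 : r <= 1).
Implicit Types (t : time R tk) (v : 'rV[R]_n) (M : nat).

Let near_x0 := [set y : Q | chart_dom c y /\ nball p0 r (chart_coord c y)].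

(** The operator $g \mapsto g \circ \Phi^t$, from weighted functions near the fixed
    point to plain $C^{k,a}$ functions at [v], has norm at most [M]. The Holder part is
    limited to points at a distance less than $1 / (M + 1)$, so that one number [M]
    records both the bound and its range and the statement weakens as [M] grows. *)
Definition window_bound M t v := forall g K, 0 <= K ->
  cCka k a (nball p0 r) g -> weighted p0 k a r K g ->
  let D w := g (chart_coord c (Phi (chart_param h w) t)) in
  (forall s, (size s <= k)%N -> normc (cpartial s D v) <= M%:R * K) /\
  (0 < a -> forall s v', size s = k -> `|v' - v| < M.+1%:R^-1 ->
     normc (cpartial s D v - cpartial s D v') <= M%:R * K * `|v - v'| `^ a).

Lemma window_bound_le M M' t v : (M <= M')%N -> window_bound M t v -> window_bound M' t v.
Proof.
move=> MM' H g K K0 hg hw; have [H1 H2] := H g K K0 hg hw; split=> [s sk|apos s v' sk vv'].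
  by apply: le_trans (H1 s sk) _; rewrite ler_wpM2r // ler_nat.
apply: le_trans (H2 apos s v' sk _) _.
  by apply: lt_le_trans vv' _; rewrite lef_pV2 ?posrE ?ltr0n // ler_nat.
by rewrite ler_wpM2r ?powR_ge0 // ler_wpM2r // ler_nat.
Qed.

(** [composition_bound] for the flow as a function of space and time jointly gives a
    bound uniform in nearby times as well. *)
Lemma window_bound_local t v : chart_img h v -> near_x0 (Phi (chart_param h v) t) ->
  exists e, [/\ @time_atlas R tk e, chart_dom e t & exists M d, 0 < d /\
    forall v' tau, `|v' - v| < d -> `|tau - chart_coord e t| < d ->
      window_bound M (chart_param e tau) v'].
Proof.
move=> iv [dv bv]; have [ih _] := hh; have [hv kv] := chart_coordK ih iv.
have [e [ae te [V [oV Vz Vi HV]]]] := flow_local k1 ha hh hc hPhik hv dv.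
exists e; split=> //; rewrite kv in Vz.
pose H := flow_coord Phi h e c; pose z0 := row_mx v (chart_coord e t).
pose V' := [set z | V z /\ nball p0 r (H z)].
have oV' : open V'.
  apply: (open_preimage_on oV (@open_nball _ _ _ _)) => z Vz'.
  by apply: continuous_coords => j; exact: Cka_continuous (HV j) Vz'.
have HV' j : Cka k a V' (fun z => H z 0 j) by apply: Cka_sub (HV j) => z [].
have V'z0 : V' z0.
  by split=> //; rewrite /H /flow_coord row_mxKl row_mxKr (time_paramK ae te).
have [rho [C [rho0 C0 HC]]] := composition_bound ha oV' k1 HV' r1 (fun z => @proj2 _ _) V'z0.
have [M1 HM1] : exists M : nat, C <= M%:R by exists (Num.truncn C).+1; rewrite ltW // truncnS_gt.
have [M2 HM2] : exists M : nat, 2 / rho <= M%:R.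
  by exists (Num.truncn (2 / rho)).+1; rewrite ltW // truncnS_gt.
have rho2 : 0 < rho / 2 by rewrite divr_gt0.
exists (M1 + M2)%N, (rho / 2); split=> // v' tau vv' tt g K K0 hg hw D.
have DE : D = fun w => (g \o H) (row_mx w tau).
  by apply/funext => w; rewrite /D /H /= /flow_coord row_mxKl row_mxKr.
have CM : C * K <= (M1 + M2)%:R * K.
  by rewrite ler_wpM2r // (le_trans HM1) // ler_nat leq_addr.
have zr : nball z0 (rho / 2) (row_mx v' tau).
  by rewrite /nball /= opp_row_mx add_row_mx; exact: norm_row_mx_lt.
have zr1 : nball z0 rho (row_mx v' tau).
  by apply: lt_trans zr _; rewrite gtr_pMr // invf_lt1 // ltr1n.
have [H1 H2] := HC g K K0 hg hw; split=> [s sk|apos s w sk ww].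
  rewrite DE cpartial_slice; apply: le_trans CM; apply: H1 => //; by rewrite size_map.
have dE : row_mx w tau - row_mx v' tau = row_mx (w - v') 0 by rewrite opp_row_mx add_row_mx subrr.
have wr : nball z0 rho (row_mx w tau).
  rewrite /nball /= -(subrK (row_mx v' tau) (row_mx w tau)) -addrA.
  apply: le_lt_trans (ler_normD _ _) _; rewrite [ltRHS]splitr; apply: ltrD => //.
  rewrite dE; apply: le_lt_trans (norm_row_mx0 _ _) _.
  apply: lt_le_trans ww _; rewrite -[leRHS]invrK lef_pV2 ?posrE ?invr_gt0 ?ltr0n // invf_div.
  by apply: le_trans HM2 _; rewrite ler_nat leqW // leq_addl.
rewrite DE !cpartial_slice; apply: le_trans (H2 apos _ _ _ _ zr1 wr) _; first by rewrite size_map.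
apply: ler_pM; rewrite ?powR_ge0 ?mulr_ge0 //.
apply: ge0_ler_powR; rewrite ?nnegrE ?normr_ge0 ?(ltW apos) //.
by rewrite distrC dE [leRHS]distrC; exact: norm_row_mx0.
Qed.

(** The bounds hold at one time near every point of a compact set, hence with a
    common constant on the whole set, and then over a bounded window of times. *)
Lemma window_bound_uniform K T0 N : compact K -> K `<=` chart_img h ->
  (forall t, T0%:R <= t -> forall v, K v -> near_x0 (Phi (chart_param h v) t)) ->
  exists M, forall t, T0%:R <= t -> t <= (T0 + N)%:R -> forall v, K v -> window_bound M t v.
Proof.
move=> cK Ki near_K.
apply: (@time_window_uniform _ _ (fun M t => forall v, K v -> window_bound M t v)).
  by move=> M M' t MM' H v /H; exact: window_bound_le.
move=> t tT0 _; have [e ae te] := time_chart_exists t; exists e; split=> //.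
have := (compact_near_coveringP _).1 cK (nat * 'rV[R]_(time_dim tk))%type
   (filter_prod \oo (nbhs (chart_coord e t)))
   (fun Mt v => window_bound Mt.1 (chart_param e Mt.2) v) _ => [].
case=> [v Kv|[A B] /= [[M0 _ HM0] nB] HAB].
  have [e' [ae' te' [M [d [d0 Hd]]]]] := window_bound_local (Ki _ Kv) (near_K t tT0 v Kv).
  rewrite -(time_chart_unique ae ae' te te') in Hd.
  exists (nball v d, [set Mt : nat * 'rV[R]_(time_dim tk) | (M <= Mt.1)%N /\ nball (chart_coord e t) d Mt.2]).
    split => /=; first exact: nbhs_nball.
    exists ([set M' | (M <= M')%N], nball (chart_coord e t) d) => /=; last by move=> [? ?] [].
    by split; [exists M|exact: nbhs_nball].
  by move=> [v' [M' tau]] /= [vv' [MM' tt]]; apply: window_bound_le MM' _; exact: Hd.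
exists M0; apply: filterS nB => tau Btau v Kv.
by apply: (HAB (M0, tau) _ v Kv); split=> //; exact: (HM0 M0 (leqnn M0)).
Qed.

End WindowBounds.

(** * Convergence in the norm of $C^{k,a}$ *)

(** The norm is a sum of [k + 2] suprema, each nonnegative because its index set is
    nonempty: here $n \ge 1$ and the openness of [U] are needed. *)
Lemma Ckalpha_norm_bound (R : realType) (n' k : nat) (a K : R) (U : set 'rV[R]_n'.+1) G :
  open U -> U !=set0 -> 0 <= K ->
  (forall s x, (size s <= k)%N -> U x -> normc (cpartial s G x) <= K) ->
  (0 < a -> forall s x y, size s = k -> U x -> U y -> x != y ->
     normc (cpartial s G x - cpartial s G y) <= K * `|x - y| `^ a) ->
  exists2 N : R, Ckalpha_norm k a U G = N%:E & 0 <= N <= k.+2%:R * K.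
Proof.
move=> oU [u Uu] K0 H1 H2.
have sup_bound (A : set (\bar R)) : A !=set0 -> (forall e, A e -> 0 <= e /\ e <= K%:E)%E ->
    (0 <= ereal_sup A)%E /\ (ereal_sup A <= K%:E)%E.
  move=> [e Ae] HA; split; last by apply: ge_ereal_sup => x /HA[].
  by apply: le_trans (ereal_sup_ubound Ae); have [] := HA e Ae.
have S1 (i : 'I_k.+1) : (0 <= ereal_sup [set e | exists (s : seq 'I_n'.+1) x,
       [/\ size s = i, U x & e = (normc (cpartial s G x))%:E]])%E /\
   (ereal_sup [set e | exists (s : seq 'I_n'.+1) x,
       [/\ size s = i, U x & e = (normc (cpartial s G x))%:E]] <= K%:E)%E.
  apply: sup_bound.
    exists (normc (cpartial (nseq i ord0) G u))%:E, (nseq i ord0), u.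
    by split=> //; rewrite size_nseq.
  move=> e [s [x [si Ux ->]]]; rewrite !lee_fin normc_ge0; split=> //.
  by apply: H1 => //; rewrite si -ltnS.
have S2 : (0 <= (if (0 < a)%R then
     ereal_sup [set e | exists (s : seq 'I_n'.+1) (x y : 'rV[R]_n'.+1),
       [/\ size s = k, U x, U y, x != y &
           e = (normc (cpartial s G x - cpartial s G y) /
                `|x - y| `^ a)%:E]] else 0))%E /\
   ((if (0 < a)%R then
     ereal_sup [set e | exists (s : seq 'I_n'.+1) (x y : 'rV[R]_n'.+1),
       [/\ size s = k, U x, U y, x != y &
           e = (normc (cpartial s G x - cpartial s G y) /
                `|x - y| `^ a)%:E]] else 0) <= K%:E)%E.
  case: ifP => [apos|_]; last by rewrite lee_fin.
  apply: sup_bound; last first.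
    move=> e [s [x [y [sk Ux Uy xy ->]]]].
    have d0 : 0 < `|x - y| `^ a by rewrite powR_gt0 // normr_gt0 subr_eq0.
    rewrite !lee_fin; split; first by rewrite divr_ge0 ?normc_ge0 // ltW.
    by rewrite ler_pdivrMr //; exact: H2.
  have [d /= d0 dU] := (nbhs_ballP _ _).1 (open_nbhs_nbhs (conj oU Uu)).
  have Uy : U (u + (d / 2) *: row_unit (@ord0 n')).
    apply: dU; rewrite -ball_normE /= opprD addrA subrr add0r normrN.
    apply: norm_rV_ltP => // j; rewrite !mxE normrM ger0_norm ?divr_ge0 ?(ltW d0) //.
    by case: (_ && _); rewrite ?normr1 ?normr0 ?mulr1 ?mulr0 //; lra.
  eexists; exists (nseq k ord0), u, (u + (d / 2) *: row_unit (@ord0 n')); split=> //.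
    by rewrite size_nseq.
  apply/eqP => /(congr1 (fun z : 'rV[R]_n'.+1 => z 0 ord0)); rewrite !mxE !eqxx /= mulr1 => h.
  by have hd : d / 2 = 0; [apply: (addrI (u 0 ord0)); rewrite addr0 -h|lra].
have L0 : (0 <= Ckalpha_norm k a U G)%E.
  by apply: adde_ge0; [apply: sume_ge0 => i _; exact: (S1 i).1|exact: S2.1].
have L1 : (Ckalpha_norm k a U G <= (k.+2%:R * K)%:E)%E.
  rewrite mulrSr mulrDl mul1r EFinD; apply: leeD; last exact: S2.2.
  apply: (@le_trans _ _ (\sum_(i < k.+1) K%:E)%E); first by apply: lee_sum => i _; exact: (S1 i).2.
  by rewrite sumEFin sumr_const card_ord mulr_natl.
case: (Ckalpha_norm k a U G) L0 L1 => [N| |] //.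
by rewrite !lee_fin => N0 N1; exists N => //; rewrite N0.
Qed.

Section Convergence.
Variables (R : realType) (n' : nat).
Local Notation n := n'.+1.
Variables (Q : smooth_manifold R n) (tk : time_kind) (Phi : Q -> time R tk -> Q).
Variables (x0 : Q) (c : chart R n Q).
Hypotheses (hc : smooth_chart c) (hx0 : chart_dom c x0).
Hypotheses (hPhi : dynamical_system Phi) (hPhi1 : Ckalpha_flow (Fin 1) 0 Phi).
Hypothesis stable : asymptotically_stable Phi x0.
Hypothesis basin : forall x, Phi x @ @time_infty R tk --> x0.
Variables (k : nat) (a r b C : R) (N : nat) (mu : R[i]) (P psi : Q -> R[i]).
Hypotheses (k1 : (1 <= k)%N) (ha : 0 <= a <= 1) (hPhik : Ckalpha_flow (Fin k) a Phi).
Hypotheses (N0 : (0 < N)%N) (r0 : 0 < r) (r1 : r <= 1) (b01 : 0 <= b < 1) (C0 : 0 <= C).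
Hypothesis koopman : forall t x, psi (Phi x t) = cexp (mu * (time_val t)%:C%C) * psi x.

Let p0 := chart_coord c x0.
Local Notation param := (chart_param c).
Let a0 : 0 <= a. Proof. by case/andP: ha. Qed.
Let a1 : a <= 1. Proof. by case/andP: ha. Qed.

Hypothesis defect : forall J,
  let d v := (cexp mu ^+ (N * J))^-1 * P (Phi (param v) (N * J)%:R) - psi (param v) in
  cCka k a (nball p0 r) d /\ weighted p0 k a r (C * b ^+ J) d.

Local Notation err h t := (fun v =>
  cexp (- mu * (time_val t)%:C%C) * P (Phi (chart_param h v) t) - psi (chart_param h v)).

Lemma time_valD (t s : time R tk) : time_val (t + s) = time_val t + time_val s.
Proof. by case: tk t s => t s //=; rewrite intrD. Qed.

Lemma time_val_le (t s : time R tk) : t <= s -> time_val t <= time_val s.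
Proof. by case: tk t s => t s //= ts; rewrite ler_int. Qed.

(** With $t = t' + N J$, the error at time $t$ is $e^{-\mu t'}$ times the error $d_J$
    near the fixed point composed with $\Phi^{t'}$, because $\psi$ is an eigenfunction
    for the time $t'$. The window bounds apply to $e^{-\mu t'} d_J$. *)
Lemma uniform_error h (U : set 'rV[R]_n) : smooth_chart h -> open U -> compact (closure U) ->
  closure U `<=` chart_img h ->
  exists (T0 : nat) (B : R), 0 <= B /\ forall J (t : time R tk), T0%:R <= t -> t <= (T0 + N)%:R ->
    let G := err h (t + (N * J)%:R) in
    (forall s v, (size s <= k)%N -> U v -> normc (cpartial s G v) <= B * b ^+ J) /\
    (0 < a -> forall s v w, size s = k -> U v -> U w -> v != w ->
       normc (cpartial s G v - cpartial s G w) <= B * b ^+ J * `|v - w| `^ a).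
Proof.
move=> hh oU cU Ui; have [b0 _] := andP b01.
have [T0 near_K] := compact_absorbed hc hx0 hPhi hPhi1 stable basin r0 hh cU Ui.
have [M HM] := window_bound_uniform hc hh k1 ha hPhik r1 N cU Ui near_K.
pose L := expR (`|complex.Re mu| * (T0 + N)%:R).
pose B := (2 * M%:R * M.+1%:R) * (L * C).
have L0 : 0 <= L by exact: expR_ge0.
have MB : M%:R * (L * C) <= B.
  rewrite ler_wpM2r ?mulr_ge0 // -[leLHS]mulr1 -mulrA mulrCA ler_wpM2l //.
  by rewrite -natrM ler1n muln_gt0.
exists T0, B; split; first by rewrite !mulr_ge0.
move=> J t tT tN G.
pose d v := (cexp mu ^+ (N * J))^-1 * P (Phi (param v) (N * J)%:R) - psi (param v).
have [hd wd] := defect J; rewrite -/d in hd wd.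
pose e := cexp (- mu * (time_val t)%:C%C); pose g z := e * d z.
have oB := @open_nball R n p0 r.
have hg : cCka k a (nball p0 r) g by exact: cCkaZ.
have eL : normc e <= L.
  rewrite normc_cexp ler_expR; case: (mu) => mr mi /=.
  have t0 : 0 <= time_val t.
    by rewrite -[0](@time_val_nat R tk 0); apply: time_val_le; apply: le_trans tT.
  have t1 : time_val t <= (T0 + N)%:R by rewrite -(@time_val_nat R tk); exact: time_val_le.
  rewrite mulr0 subr0; apply: (@le_trans _ _ (`|mr| * time_val t)).
    by rewrite ler_wpM2r // -normrN ler_norm.
  by rewrite ler_wpM2l.
pose K := L * (C * b ^+ J).
have K0 : 0 <= K by rewrite !mulr_ge0 // exprn_ge0.
have wg : weighted p0 k a r K g.
  apply: weighted_le (weightedZ ha e hd wd) => //.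
  by rewrite ler_wpM2r // mulr_ge0 // exprn_ge0.
pose D w := g (chart_coord c (Phi (chart_param h w) t)).
have DG w : U w -> D w = G w.
  move=> Uw; have [dw _] := near_K t tT w (subset_closure Uw).
  have [[_ _ pK _ _] _] := hc.
  rewrite /D /g /d /G pK // (addrC t) hPhi.2 koopman mulrBr !mulrA; congr (_ * _ - _).
    rewrite (addrC _ t) time_valD (@time_val_nat R tk) rmorphD mulrDr cexpD; congr (_ * _).
    by rewrite -cexp_nat -cexpN mulNr (rmorph_nat (real_complex R)).
  by rewrite /e -cexpD mulNr addNr cexp0 mul1r.
have KB : M%:R * K <= B * b ^+ J by rewrite /K !mulrA ler_wpM2r ?exprn_ge0 // -mulrA.
split=> [s v sk Uv|apos s v w sk Uv Uw vw].
  rewrite -(cpartial_ext s oU DG Uv); apply: le_trans KB.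
  by have [H1 _] := HM t tT tN v (subset_closure Uv) g K K0 hg wg; exact: H1.
rewrite -(cpartial_ext s oU DG Uv) -(cpartial_ext s oU DG Uw).
have [H1 H2] := HM t tT tN v (subset_closure Uv) g K K0 hg wg.
have [H3 _] := HM t tT tN w (subset_closure Uw) g K K0 hg wg.
have [near|far] := ltP `|w - v| M.+1%:R^-1.
  by apply: le_trans (H2 apos s w sk near) _; rewrite ler_wpM2r ?powR_ge0.
(* distant points: the sup bound suffices, since 1 <= (|v - w| (M + 1))^a *)
have sk' : (size s <= k)%N by rewrite sk.
apply: le_trans (_ : 2 * (M%:R * K) <= _).
  apply: le_trans (le_normcD _ _) _; rewrite normcN mulr_natl mulr2n.
  by apply: lerD; [exact: H1|exact: H3].
have one : 1 <= M.+1%:R * `|v - w| `^ a.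
  have h1 : 1 <= `|v - w| * M.+1%:R by rewrite -ler_pdivrMr ?ltr0n // div1r distrC.
  have h2 : 1 <= (`|v - w| * M.+1%:R) `^ a.
    have one1 : 1 = 1 `^ a :> R by rewrite powR1.
    by rewrite [leLHS]one1; apply: ge0_ler_powR; rewrite ?nnegrE ?ler01 ?mulr_ge0 ?(ltW apos).
  rewrite powRM // in h2; apply: le_trans h2 _; rewrite mulrC ler_wpM2r ?powR_ge0 //.
  by rewrite -[leRHS]powRr1 ?ler0n //; apply: ler_powR; rewrite ?ler1n.
rewrite /B /K.
rewrite -[leLHS]mulr1.
have -> : 2 * M%:R * M.+1%:R * (L * C) * b ^+ J * `|v - w| `^ a =
  2 * (M%:R * (L * (C * b ^+ J))) * (M.+1%:R * `|v - w| `^ a) by ring.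
by rewrite ler_wpM2l // !mulr_ge0 // exprn_ge0.
Qed.

(** Convergence at rate $b^J$, $J$ being about $t / N$; a lower order of
    differentiability $k'$ is allowed for use with $k = \infty$. *)
Lemma koopman_limit k' a' : (k' <= k)%N -> (0 < a' -> k' = k /\ a' = a) ->
  Ckalpha_cvg k' a' (fun t x => cexp (- mu * (time_val t)%:C%C) * P (Phi x t)) psi.
Proof.
move=> kk aa h U hh oU U0 pU Ui; have [b0 b1] := andP b01.
have cU : compact (closure U) by rewrite -precompactE.
have [T0 [B [B0 HB]]] := uniform_error hh oU cU Ui.
have bound J (t : time R tk) : (T0 + N * J + N)%:R <= t ->
    exists2 x : R, Ckalpha_norm k' a' U (err h t) = x%:E & 0 <= x <= k'.+2%:R * (B * b ^+ J).
  move=> Jt; have [|J' [t' [t1 t2 tE]]] := time_decompose (T := T0) (t := t) N0.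
    by apply: le_trans Jt; rewrite ler_nat -addnA leq_addr.
  have JJ' : (J <= J')%N.
    have : (T0 + N * J + N)%:R <= (T0 + N + N * J')%:R :> time R tk.
      by rewrite [leRHS]natrD; apply: le_trans Jt _; rewrite tE lerD2r.
    by rewrite ler_nat addnAC leq_add2l leq_pmul2l.
  rewrite {}tE.
  have [H1 H2] := HB J' t' t1 t2.
  have BJ : B * b ^+ J' <= B * b ^+ J by rewrite ler_wpM2l // ler_wiXn2l // ltW.
  apply: Ckalpha_norm_bound => //.
  - by rewrite mulr_ge0 // exprn_ge0.
  - by move=> s x sk Ux; apply: le_trans BJ; apply: H1 => //; exact: leq_trans sk kk.
  - move=> apos s x y sk Ux Uy xy; have [kE aE] := aa apos.
    rewrite aE in apos *; rewrite kE in sk; apply: le_trans (H2 apos s x y sk Ux Uy xy) _.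
    by rewrite ler_wpM2r ?powR_ge0.
apply/fine_cvgP; split.
  by exists (T0 + N * 0 + N)%:R => t Jt; have [x -> _] := bound 0%N t Jt.
apply/cvgrPdist_lt => e e0.
have bB : (fun J => k'.+2%:R * (B * b ^+ J)) @ \oo --> (0 : R).
  rewrite -[0](mulr0 k'.+2%:R) -[X in _ * X](mulr0 B).
  by apply: cvgMr; apply: cvgMr; apply: cvg_expr; rewrite ger0_norm.
have /cvgrPdist_lt /(_ e e0) [J _ HJ] := bB.
exists (T0 + N * J + N)%:R => t Jt; have [x /= -> /andP[x0' x1]] := bound J t Jt.
rewrite sub0r normrN ger0_norm //; apply: le_lt_trans x1 _.
have := HJ J (leqnn J); rewrite /= sub0r normrN; exact: le_lt_trans (ler_norm _).
Qed.

End Convergence.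

(** * Eigenfunctions at a finite order *)

Section FiniteOrder.
Variables (R : realType) (n' : nat).
Local Notation n := n'.+1.
Variables (Q : smooth_manifold R n).
Implicit Types (c : chart R n Q) (f g : Q -> R[i]).

Lemma Ckalpha_fun_sub_scale k a u f g : (1 <= k)%N -> 0 <= a <= 1 ->
  Ckalpha_fun (Fin k) a f -> Ckalpha_fun (Fin k) a g -> Ckalpha_fun (Fin k) a (fun x => f x - u * g x).
Proof.
move=> k1 ha Hf Hg; apply: Ckalpha_fun_of_local => // x.
have [c ac xc] := atlas_cover x; have hc := atlas_smooth_chart ac.
have oi : open (chart_img c) by have [[]] := hc.
exists c, (chart_img c); split; [exact: hc|exact: xc|exact: oi|exact: chart_img_coord|].
have hf := Ckalpha_fun_chart k1 ha hc Hf; have hg := Ckalpha_fun_chart k1 ha hc Hg.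
exact: (cCkaB ha oi hf (cCkaZ ha u oi hg)).
Qed.

Lemma Ckalpha_fun_Im k a f : (1 <= k)%N -> 0 <= a <= 1 ->
  Ckalpha_fun (Fin k) a f -> Ckalpha_fun (Fin k) a (fun x => (complex.Im (f x))%:C%C).
Proof.
move=> k1 ha Hf; apply: Ckalpha_fun_of_local => // x.
have [c ac xc] := atlas_cover x; have hc := atlas_smooth_chart ac.
have oi : open (chart_img c) by have [[]] := hc.
exists c, (chart_img c); split; [exact: hc|exact: xc|exact: oi|exact: chart_img_coord|].
have [_ hi] := Ckalpha_fun_chart k1 ha hc Hf.
by split; [exact: hi|exact: Cka_cst].
Qed.

Lemma Ckalpha_fun_C1 k a f : (1 <= k)%N -> 0 <= a <= 1 ->
  Ckalpha_fun (Fin k) a f -> Ckalpha_fun (Fin 1) (0 : R) f.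
Proof.
move=> k1 ha Hf; have ha0 : (0 : R) <= (0 : R) <= (1 : R) by rewrite lexx ler01.
apply: Ckalpha_fun_of_local => // x.
have [c ac xc] := atlas_cover x; have hc := atlas_smooth_chart ac.
have oi : open (chart_img c) by have [[]] := hc.
exists c, (chart_img c); split; [exact: hc|exact: xc|exact: oi|exact: chart_img_coord|].
have [hr hi] := Ckalpha_fun_chart k1 ha hc Hf.
by split; apply: (Cka_le oi ha0 k1); [exact: Cka0W hr|exact: Cka0W hi].
Qed.

Variables (tk : time_kind) (Phi : Q -> time R tk -> Q) (x0 : Q) (c : chart R n Q).
Hypotheses (hc : smooth_chart c) (hx0 : chart_dom c x0).
Hypotheses (hPhi : dynamical_system Phi) (hPhi1 : Ckalpha_flow (Fin 1) 0 Phi).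
Hypothesis fix0 : forall t, Phi x0 t = x0.
Hypothesis basin : forall x, Phi x @ @time_infty R tk --> x0.

Let p0 := chart_coord c x0.
Local Notation A := (chart_jacobian c (Phi ^~ 1) x0).
Local Notation param := (chart_param c).
Let ha0 : (0 : R) <= (0 : R) <= (1 : R). Proof. by rewrite lexx ler01. Qed.
Let oi : open (chart_img c). Proof. by have [[]] := hc. Qed.
Let ip : chart_img c p0. Proof. exact: chart_img_coord. Qed.
Let param0 : param p0 = x0. Proof. by have [[_ _ pK _ _] _] := hc; exact: pK. Qed.

Lemma Ckalpha_fun_flow k a t f : (1 <= k)%N -> 0 <= a <= 1 -> Ckalpha_flow (Fin k) a Phi ->
  Ckalpha_fun (Fin k) a f -> Ckalpha_fun (Fin k) a (fun x => f (Phi x t)).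
Proof.
move=> k1 ha hk Hf; apply: Ckalpha_fun_of_local => // x.
have [d ad xd] := atlas_cover x; have [e ae xe] := atlas_cover (Phi x t).
have hd := atlas_smooth_chart ad; have he := atlas_smooth_chart ae.
have [V [oV Vx Vd HV]] := flow_slice k1 ha hd he hk xd xe.
exists d, V; split=> //.
have oe : open (chart_img e) by have [[]] := he.
have hf := Ckalpha_fun_chart k1 ha he Hf.
have := cCka_comp k1 ha oV oe (fun v Vv => chart_img_coord (Vd v Vv).2) HV hf.
apply: cCka_ext => // v /Vd[_ dv] /=.
by have [[_ _ pK _ _] _] := he; rewrite pK.
Qed.

Lemma cderivative_sub_scale u f g i : Ckalpha_fun (Fin 1) (0 : R) f -> Ckalpha_fun (Fin 1) (0 : R) g ->
  cpartial [:: i] ((fun x => f x - u * g x) \o param) p0 =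
  chart_cderivative c f x0 i 0 - u * chart_cderivative c g x0 i 0.
Proof.
move=> Hf Hg; have hf := Ckalpha_fun_chart (isT : (1 <= 1)%N) ha0 hc Hf.
have hg := Ckalpha_fun_chart (isT : (1 <= 1)%N) ha0 hc Hg.
have s1 : (size [:: i] <= 1)%N by [].
have := cpartialB ha0 oi s1 hf (cCkaZ ha0 u oi hg) ip.
by rewrite (cpartialZ ha0 u oi s1 hg ip) !mxE.
Qed.

(** [leading_jet] in degree 1. *)
Lemma derivative_eigenvector nu f : Ckalpha_fun (Fin 1) (0 : R) f -> f x0 = 0 ->
  (forall x, f (Phi x 1) = nu * f x) ->
  complexify A *m chart_cderivative c f x0 = nu *: chart_cderivative c f x0.
Proof.
move=> Hf f0 fE; apply/colP => i; rewrite !mxE.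
have [V [oV Vp Vd _]] := flow_map_local hc hx0 fix0 1 (isT : (1 <= 1)%N) ha0 hPhi1.
have near : \forall v \near p0, (f \o param) (flow_map Phi c 1 v) = nu * (f \o param) v.
  apply: (open_near oV Vp) => v /Vd[_ dv]; rewrite /flow_map /= -fE.
  by have [[_ _ pK _ _] _] := hc; rewrite pK.
have jet0 s : (size s < 1)%N -> cpartial s (f \o param) p0 = 0.
  by case: s => // _; rewrite cpartial_nil /= param0.
have hf := Ckalpha_fun_chart (isT : (1 <= 1)%N) ha0 hc Hf.
have := leading_jet oi ip (@flow_map_velocity _ _ _ _ _ _ _ hc hx0 hPhi1 fix0) hf jet0 near
  (s := [:: i]) erefl.
move=> <- /=.
by apply: eq_bigr => j _; rewrite !mxE.
Qed.

(** [eigenvalue] refers to row vectors; a matrix and its transpose have the same ones.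
    *)
Lemma column_eigenvalue (B : 'M[R[i]]_n) nu (w : 'cV[R[i]]_n) :
  w != 0 -> B *m w = nu *: w -> eigenvalue B nu.
Proof.
move=> w0 Bw; rewrite /eigenvalue /eigenspace kermx_eq0 row_free_unit.
apply: contra w0 => /mulKmx/(_ w); rewrite mulmxBl Bw mul_scalar_mx subrr mulmx0 => /esym ->.
exact: eqxx.
Qed.

Variables (k : nat) (a th : R) (nu : R[i]).
Hypotheses (k1 : (1 <= k)%N) (ha : 0 <= a <= 1).
Hypotheses (th0 : 0 < th) (hth : spectral_radius A < th) (th1 : th < 1).
Hypothesis hnu : th `^ (k%:R + a) < normc nu.

(** If $\nu$ is no product of eigenvalues, all jets vanish and flatness kills the
    function. *)
Lemma eigenfunction_order f sigma : Ckalpha_fun (Fin k) a f -> (forall x, f (Phi x 1) = nu * f x) ->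
  (exists x, f x <> 0) -> eigenvalues_of A sigma ->
  exists m : 'I_n -> nat, nu = \prod_j sigma j ^+ m j.
Proof.
move=> Hf fE [x fx] sA; apply: contrapT => no; apply: fx.
apply: (flat_eigenfunction_zero hc hx0 hPhi hPhi1 fix0 k1 ha basin th0 hth th1 hnu Hf fE) => s bs.
apply: (jets_vanish hc hx0 hPhi1 fix0 k1 ha Hf fE sA) (below_order_leq ha bs) => i _.
by right=> -[m [_ mE]]; apply: no; exists m.
Qed.

Hypothesis nres : nonresonant (Fin k) nu A.

(** Absence of resonances propagates the vanishing of the 1-jet to all orders at
    which the flatness argument applies. *)
Lemma nonresonant_zero f : Ckalpha_fun (Fin k) a f -> (forall x, f (Phi x 1) = nu * f x) ->
  f x0 = 0 -> (forall i, cpartial [:: i] (f \o param) p0 = 0) -> forall x, f x = 0.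
Proof.
move=> Hf fE f0 f1; have [sigma sA] := eigenvalues_of_exists A.
apply: (flat_eigenfunction_zero hc hx0 hPhi hPhi1 fix0 k1 ha basin th0 hth th1 hnu Hf fE) => s bs.
apply: (jets_vanish hc hx0 hPhi1 fix0 k1 ha Hf fE sA) (below_order_leq ha bs) => -[|[|i]] ik.
- by left=> u /size0nil ->; rewrite cpartial_nil /= param0.
- by left=> -[//|j [|//]] _; exact: f1.
right=> -[m [mi mE]]; apply: (nres sA (m := m)) mE; rewrite mi //=.
by rewrite natr1 ltr_nat ltnS.
Qed.

(** The scalar [u] covers both uniqueness, with [u = 1], and proportionality in the
    simple case. *)
Lemma eigenfunction_unique u f g : Ckalpha_fun (Fin k) a f -> Ckalpha_fun (Fin k) a g ->
  (forall x, f (Phi x 1) = nu * f x) -> (forall x, g (Phi x 1) = nu * g x) ->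
  f x0 = 0 -> g x0 = 0 ->
  chart_cderivative c f x0 = u *: chart_cderivative c g x0 -> forall x, f x = u * g x.
Proof.
move=> Hf Hg fE gE f0 g0 dE x; apply/eqP; rewrite -subr_eq0; apply/eqP.
apply: (nonresonant_zero (f := fun x => f x - u * g x)).
- exact: Ckalpha_fun_sub_scale.
- by move=> y; rewrite fE gE mulrBr mulrCA.
- by rewrite f0 g0 mulr0 subrr.
move=> i; rewrite cderivative_sub_scale ?dE; [|exact: Ckalpha_fun_C1 Hf|exact: Ckalpha_fun_C1 Hg].
by rewrite mxE subrr.
Qed.

(** The imaginary part, as a complex-valued function, is an eigenfunction with vanishing
    1-jet. *)
Lemma eigenfunction_real f : Ckalpha_fun (Fin k) a f -> (forall x, f (Phi x 1) = nu * f x) ->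
  f x0 = 0 -> complex.Im nu = 0 -> (forall i, complex.Im (chart_cderivative c f x0 i 0) = 0) ->
  forall x, complex.Im (f x) = 0.
Proof.
move=> Hf fE f0 nuR fR x.
apply: (congr1 (@complex.Re R) (nonresonant_zero (f := fun x => (complex.Im (f x))%:C%C) _ _ _ _ x)).
- exact: Ckalpha_fun_Im.
- move=> y; rewrite fE; case: (nu) nuR => b d /= ->; case: (f y) => e h /=.
  by apply/eqP; rewrite eq_complex /= !mul0r !mulr0 !addr0 subr0 !eqxx.
- by rewrite f0.
move=> i; have := fR i; rewrite mxE /= => fi; rewrite /cpartial /=; congr Complex; first exact: fi.
exact: (congr1 (@complex.Im R) (cpartial_zero [:: i] p0)).
Qed.

End FiniteOrder.

(** * Existence and convergence at a finite order *)

Section Existence.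
Variables (R : realType) (n' : nat).
Local Notation n := n'.+1.
Variables (Q : smooth_manifold R n) (tk : time_kind) (Phi : Q -> time R tk -> Q).
Variables (x0 : Q) (c : chart R n Q).
Hypotheses (hc : smooth_chart c) (hx0 : chart_dom c x0).
Hypotheses (hPhi : dynamical_system Phi) (hPhi1 : Ckalpha_flow (Fin 1) 0 Phi).
Hypothesis fix0 : forall t, Phi x0 t = x0.
Hypothesis stable : asymptotically_stable Phi x0.
Hypothesis basin : forall x, Phi x @ @time_infty R tk --> x0.
Variables (k : nat) (a th : R) (mu : R[i]).
Hypotheses (k1 : (1 <= k)%N) (ha : 0 <= a <= 1) (hPhik : Ckalpha_flow (Fin k) a Phi).

Let p0 := chart_coord c x0.
Local Notation A := (chart_jacobian c (Phi ^~ 1) x0).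
Local Notation param := (chart_param c).
Local Notation nu := (cexp mu).
Let ha0 : (0 : R) <= (0 : R) <= (1 : R). Proof. by rewrite lexx ler01. Qed.
Let oi : open (chart_img c). Proof. by have [[]] := hc. Qed.
Let ip : chart_img c p0. Proof. exact: chart_img_coord. Qed.
Let param0 : param p0 = x0. Proof. by have [[_ _ pK _ _] _] := hc; exact: pK. Qed.
Let a0 : 0 <= a. Proof. by case/andP: ha. Qed.

Hypotheses (th0 : 0 < th) (hth : spectral_radius A < th) (th1 : th < 1).
Hypothesis hnu : th `^ (k%:R + a) < normc nu.
Hypothesis nres : nonresonant (Fin k) nu A.
Variable w : 'cV[R[i]]_n.
Hypotheses (w0 : w != 0) (Aw : complexify A *m w = nu *: w).

Lemma eigenvalue_lt1 : normc nu < 1.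
Proof. exact: le_lt_trans (eigenvalue_le_radius (column_eigenvalue w0 Aw)) (lt_trans hth th1). Qed.

(** With $k + a \le 1$ one would have $|\nu| > \theta^{k+a} \ge \theta > \rho \ge |\nu|$, so
    under these hypotheses the derivative of the limit is always controlled. *)
Lemma order_gt1 : 1 < k%:R + a.
Proof.
rewrite ltNge; apply/negP => h; have nur := eigenvalue_le_radius (column_eigenvalue w0 Aw).
have := lt_trans (lt_le_trans hnu nur) hth; apply/negP; rewrite -leNgt -[leLHS]powRr1 ?(ltW th0) //.
by apply: ger_powR => //; rewrite th0 ltW.
Qed.

(** The limit of $\nu^{-NJ} P \circ \Phi^{NJ}$ has the same 1-jet as $P$, because
    the two differ by a function of weight $k + a > 1$. *)
Lemma limit_one_jet P W : open W -> W p0 -> W `<=` chart_img c -> cCka k a W (P \o param) ->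
  (forall s, below_order (size s) (Fin k) a ->
     cpartial s ((fun x => P (Phi x 1) - nu * P x) \o param) p0 = 0) ->
  exists psi N r b C,
  [/\ [/\ (0 < N)%N, 0 < r, r <= 1, 0 <= b < 1 & 0 <= C],
      [/\ Ckalpha_fun (Fin k) a psi, forall x, psi (Phi x 1) = nu * psi x, psi x0 = 0 &
          forall i, cpartial [:: i] (psi \o param) p0 = cpartial [:: i] (P \o param) p0] &
      forall J, let d v := (nu ^+ (N * J))^-1 * P (Phi (param v) (N * J)%:R) - psi (param v) in
        cCka k a (nball p0 r) d /\ weighted p0 k a r (C * b ^+ J) d].
Proof.
move=> oW Wp Wi hP jets.
have [psi [N [r [b [C [[N0 r0 r2 b01 C0] _ Hpsi psiE HJ]]]]]] :=
  eigenfunction_limit hc hx0 hPhi hPhi1 fix0 basin k1 ha hPhik th0 hth th1 hnu oW Wp Wi hP jets.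
exists psi, N, r, b, C; split=> //; first by split=> //; apply: le_trans r2 _; rewrite invf_le1 // ler1n.
have psi_jet s : (size s <= 1)%N -> cpartial s (psi \o param) p0 = cpartial s (P \o param) p0.
  move=> s1; have [_ [+ _]] := HJ 0%N; set d := (fun v => _) => wd.
  have sk : (size s <= k)%N by exact: leq_trans k1.
  have e0 : (k - size s)%:R + a != 0.
    rewrite gt_eqF // natrB // addrAC subr_gt0; apply: le_lt_trans order_gt1.
    by rewrite (ler_nat R _ 1).
  have := wd s p0 sk; rewrite /nball /= subrr normr0 powR0 // mulr0 => /(_ r0) d0.
  have {d0} : cpartial s d p0 = 0.
    by apply: eq0_normc; apply/eqP; rewrite eq_le d0 normc_ge0.
  have -> : d = fun v => (P \o param) v - (psi \o param) v.
    by apply/funext => v; rewrite /d muln0 expr0 invr1 mul1r hPhi.1.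
  have hpsi : cCka k a W (psi \o param).
    have [h1 h2] := Ckalpha_fun_chart k1 ha hc Hpsi.
    by split; [exact: Cka_sub h1|exact: Cka_sub h2].
  by rewrite (cpartialB ha oW sk hP hpsi Wp) => /subr0_eq.
(* the equation at x0 reads P x0 = nu P x0, and nu <> 1 *)
have P0 : P x0 = 0.
  have := jets [::]; rewrite cpartial_nil /= param0 fix0 => /(_ _)/subr0_eq.
  have -> : (0 : R) < k%:R + a by apply: lt_trans order_gt1.
  move=> /(_ isT) /eqP; rewrite -{1}[P x0]mul1r -subr_eq0 -mulrBl mulf_eq0 => /orP[|/eqP //].
  rewrite subr_eq0 => /eqP nu1; have := eigenvalue_lt1; rewrite -nu1 normc1 ltxx //.
split=> //.
  by have := psi_jet [::] isT; rewrite !cpartial_nil /= param0 P0.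
by move=> i; exact: psi_jet.
Qed.

Section Time.
Hypothesis wt : forall t : time R tk,
  complexify (chart_jacobian c (Phi ^~ t) x0) *m w = cexp (mu * (time_val t)%:C%C) *: w.

(** A time-1 eigenfunction with 1-jet $w$ is one for all times: the function
    $e^{-\mu t} \psi \circ \Phi^t$ is another one with the same 1-jet. *)
Lemma eigenfunction_all_times psi : Ckalpha_fun (Fin k) a psi ->
  (forall x, psi (Phi x 1) = nu * psi x) -> psi x0 = 0 -> chart_cderivative c psi x0 = w ->
  forall t x, psi (Phi x t) = cexp (mu * (time_val t)%:C%C) * psi x.
Proof.
move=> Hpsi psiE psi0 dpsi t.
apply: (eigenfunction_unique hc hx0 hPhi hPhi1 fix0 basin k1 ha th0 hth th1 hnu nres _ Hpsi _ psiE _ psi0).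
- exact: Ckalpha_fun_flow k1 ha hPhik Hpsi.
- by move=> x; rewrite -hPhi.2 addrC hPhi.2 psiE.
- by rewrite fix0.
rewrite dpsi -wt; apply/colP => j; rewrite mxE.
have [V [oV Vp Vd HV]] := flow_map_local hc hx0 fix0 t (isT : (1 <= 1)%N) ha0 hPhi1.
have hpsi := Ckalpha_fun_chart (isT : (1 <= 1)%N) ha0 hc (Ckalpha_fun_C1 k1 ha Hpsi).
have E v : V v -> ((fun x => psi (Phi x t)) \o param) v = ((psi \o param) \o flow_map Phi c t) v.
  by move=> /Vd[_ dv] /=; have [[_ _ pK _ _] _] := hc; rewrite /flow_map pK.
rewrite (cpartial_ext _ oV E Vp).
have s1 : (size [:: j] <= 1)%N by [].
have jet0 u : (size u < size [:: j])%N -> cpartial u (psi \o param) p0 = 0.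
  by case: u => // _; rewrite cpartial_nil /= param0.
rewrite (chain_jets oV Vp HV (flow_map_fixed hc hx0 fix0 t) isT oi ip hpsi s1 jet0) /= mxE.
apply: eq_bigr => l _; rewrite [in RHS]mxE (chart_jacobianE hc hx0 hPhi1 fix0); congr (_ * _).
by rewrite -dpsi mxE.
Qed.

Lemma principal_of_jet psi : Ckalpha_fun (Fin k) a psi ->
  (forall x, psi (Phi x 1) = nu * psi x) -> psi x0 = 0 -> chart_cderivative c psi x0 = w ->
  principal_eigenfunction Phi x0 c mu psi.
Proof.
move=> Hpsi psiE psi0 dpsi; split=> //; last by rewrite dpsi.
  split; last exact: eigenfunction_all_times.
  apply: contrapT => no; move: w0; rewrite -dpsi => /eqP; apply; apply/colP => i; rewrite !mxE.
  rewrite (_ : psi \o param = fun=> 0) ?cpartial_zero //; apply/funext => v /=.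
  by apply: contrapT => h; apply: no; exists (param v).
exact: Ckalpha_fun_C1 Hpsi.
Qed.

Lemma principal_exists : exists psi, [/\ Ckalpha_fun (Fin k) a psi,
  principal_eigenfunction Phi x0 c mu psi & chart_cderivative c psi x0 = w].
Proof.
have [V [oV Vp Vd HV]] := flow_map_local hc hx0 fix0 1 k1 ha hPhik.
have [sigma sA] := eigenvalues_of_exists A.
have nres' m : (2 <= \sum_j m j)%N -> (\sum_j m j <= k)%N -> nu <> \prod_j sigma j ^+ m j.
  by move=> m2 mk; apply: (nres sA m2); rewrite /= natr1 ltr_nat ltnS.
have [Pp [HPp Pp0 Pp1 Pjets]] := formal_eigenfunction oV Vp (fun j => Cka0W (HV j))
  (flow_map_fixed hc hx0 fix0 1) k1 (fun i j => esym (chart_jacobianE hc hx0 hPhi1 fix0 1 i j)) sA Aw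
  nres' k1 (leqnn k).
pose P x := Pp (chart_coord c x).
have PE v : chart_img c v -> Pp v = (P \o param) v.
  by move=> iv; rewrite /P /=; have [_ ->] := chart_coordK (proj1 hc) iv.
have hP : cCka k a (chart_img c) (P \o param) by apply: (cCka_ext oi PE); exact: HPp.
have jets s : below_order (size s) (Fin k) a ->
     cpartial s ((fun x => P (Phi x 1) - nu * P x) \o param) p0 = 0.
  move=> bs; rewrite -(Pjets s (below_order_leq ha bs)); apply: (cpartial_ext _ oV _ Vp) => v Vv /=.
  by rewrite (PE v (Vd v Vv).1).
have [psi [N [r [b [C [_ [Hpsi psiE psi0 psi1] _]]]]]] := limit_one_jet oi ip (@subset_refl _ _) hP jets.
have dpsi : chart_cderivative c psi x0 = w.
  apply/colP => i; rewrite mxE psi1 -Pp1; apply: esym; exact: (cpartial_ext _ oi PE ip).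
by exists psi; split=> //; exact: principal_of_jet.
Qed.

Lemma principal_limit psi P k' a' : Ckalpha_fun (Fin k) a psi ->
  principal_eigenfunction Phi x0 c mu psi -> chart_cderivative c psi x0 = w ->
  Ckalpha_fun (Fin k) a P -> chart_cderivative c P x0 = w ->
  (forall s, below_order (size s) (Fin k) a ->
     cpartial s ((fun x => P (Phi x 1) - nu * P x) \o param) p0 = 0) ->
  (k' <= k)%N -> (0 < a' -> k' = k /\ a' = a) ->
  Ckalpha_cvg k' a' (fun (t : time R tk) x => cexp (- mu * (time_val t)%:C%C) * P (Phi x t)) psi.
Proof.
move=> Hpsi [[_ psiK] _ psi0 _] dpsi HP dP jets kk aa.
have hP := Ckalpha_fun_chart k1 ha hc HP.
have [f [N [r [b [C [[N0 r0 r1 b01 C0] [Hf fE f0 f1] HJ]]]]]] := limit_one_jet oi ip (@subset_refl _ _) hP jets.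
have psiE x : psi (Phi x 1) = nu * psi x.
  by rewrite psiK; congr (cexp _ * _); rewrite (@time_val_nat R tk 1) mulr1.
have fpsi : f = psi.
  apply/funext => x; rewrite -[RHS]mul1r.
  apply: (eigenfunction_unique hc hx0 hPhi hPhi1 fix0 basin k1 ha th0 hth th1 hnu nres Hf Hpsi fE psiE f0 psi0).
  rewrite scale1r dpsi -dP; apply/colP => i; rewrite !mxE; exact: f1.
rewrite fpsi in HJ.
exact: (koopman_limit hc hx0 hPhi hPhi1 stable basin k1 ha hPhik N0 r0 r1 b01 C0 psiK HJ kk aa).
Qed.

End Time.
End Existence.

(** * Reduction to finite orders, and the theorem *)

(** A rate $\theta$ strictly between the spectral radius and 1 that still satisfies the
    strict inequality: the midpoint of $\rho$ and $\min(1, L^{1/e})$. *)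
Lemma choose_theta (R : realType) (rho L e : R) : 0 < rho < 1 -> 0 < e -> rho `^ e < L ->
  exists th, [/\ 0 < th, rho < th, th < 1 & th `^ e < L].
Proof.
move=> /andP[rho0 rho1] e0 rL.
have L0 : 0 < L by apply: le_lt_trans rL; exact: powR_ge0.
have LE : (L `^ e^-1) `^ e = L by rewrite -powRrM mulVf ?gt_eqF // powRr1 // ltW.
have rE : (rho `^ e) `^ e^-1 = rho by rewrite -powRrM mulfV ?gt_eqF // powRr1 // ltW.
have rL' : rho < L `^ e^-1.
  by rewrite -rE; apply: gt0_ltr_powR; rewrite ?invr_gt0 ?nnegrE ?powR_ge0 // ltW.
pose m := Num.min 1 (L `^ e^-1); have rm : rho < m by rewrite lt_min rho1.
have m1 : m <= 1 by rewrite ge_min lexx.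
have mL : m <= L `^ e^-1 by rewrite ge_min lexx orbT.
have [rt tm] := (midf_lt rm).
have t0 : 0 < (rho + m) / 2 by exact: lt_trans rt.
exists ((rho + m) / 2); split=> //; first exact: lt_le_trans tm m1.
by rewrite -LE; apply: gt0_ltr_powR; rewrite ?nnegrE ?powR_ge0 ?(ltW t0) //; exact: lt_le_trans tm mL.
Qed.

Section Orders.
Variable R : realType.
Implicit Types (k : regularity) (alpha a : R) (K : nat).

(** Everything is proved at finite orders.  If $k = \infty$, any order [K] with
    $\rho^K < |e^\mu|$ and no Holder exponent will do; smoothness follows because the
    eigenfunctions obtained at different orders coincide. *)
Definition refines k alpha K a := match k with Fin j => K = j /\ a = alpha | Infty => a = 0 end.

Lemma refine_order k alpha (rho L : R) K0 : regularity_ge1 k -> 0 <= alpha <= 1 -> 0 < rho < 1 ->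
  pow_order rho k alpha < L ->
  exists K a th, [/\ refines k alpha K a, k = Infty -> (K0 <= K)%N, (1 <= K)%N, 0 <= a <= 1 &
    [/\ 0 < th, rho < th, th < 1 & th `^ (K%:R + a) < L]].
Proof.
case: k => [j|] /= k1 ha hrho hL.
  have [|th [h1 h2 h3 h4]] := choose_theta hrho _ hL; last by exists j, alpha, th.
  by case/andP: ha => a0 _; rewrite ltr_wpDr // ltr0n.
have [rho0 rho1] := andP hrho.
have /cvgrPdist_lt /(_ L hL) [N _ HN] : (GRing.exp rho : nat -> R) @ \oo --> (0 : R).
  by apply: cvg_expr; rewrite ger0_norm // ltW.
pose K := (maxn N (maxn K0 1)).
have KN : (N <= K)%N by rewrite leq_maxl.
have KK : (K0 <= K)%N by rewrite !leq_max leqnn orbT.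
have K1 : (1 <= K)%N by rewrite !leq_max leqnn !orbT.
have := HN K KN; rewrite /= sub0r normrN ger0_norm ?exprn_ge0 ?(ltW rho0) // => rL.
have [||th [h1 h2 h3 h4]] := @choose_theta R rho L K%:R hrho; rewrite ?ltr0n //.
  by rewrite powR_mulrn // ltW.
by exists K, 0, th; rewrite addr0 lexx ler01.
Qed.

Lemma refine_below k alpha K a i : refines k alpha K a -> below_order i (Fin K) a -> below_order i k alpha.
Proof. by case: k => [j [-> ->]|]. Qed.

Lemma refine_nonresonant k alpha K a n (A : 'M[R]_n) z : refines k alpha K a ->
  nonresonant k z A -> nonresonant (Fin K) z A.
Proof.
move=> ref nres sigma sA m m2 mK; apply: (nres sigma sA m m2).
by case: k ref {nres} mK => [j [-> _]|].
Qed.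

Lemma refine_flow k alpha K a n (Q : smooth_manifold R n) tk (Phi : Q -> time R tk -> Q) :
  refines k alpha K a -> Ckalpha_flow k alpha Phi -> Ckalpha_flow (Fin K) a Phi.
Proof. by case: k => [j [-> ->]|-> /(_ K)]. Qed.

Lemma refine_fun k alpha K a n (Q : smooth_manifold R n) (f : Q -> R[i]) :
  refines k alpha K a -> Ckalpha_fun k alpha f -> Ckalpha_fun (Fin K) a f.
Proof. by case: k => [j [-> ->]|-> /(_ K)]. Qed.

Lemma Ckalpha_fin_le j K n (Q : smooth_manifold R n) (f : Q -> R[i]) : (j <= K)%N ->
  Ckalpha_fun (Fin K) (0 : R) f -> Ckalpha_fun (Fin j) (0 : R) f.
Proof.
elim: K => [|K IH]; first by rewrite leqn0 => /eqP ->.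
by rewrite leq_eqVlt => /orP[/eqP ->//|jK] /Ckalpha_fin_pred; exact: IH.
Qed.

End Orders.

Theorem proposition6 (R : realType) (n : nat) (hn : (1 <= n)%N)
    (Q : smooth_manifold R n) (tk : time_kind) (Phi : Q -> time R tk -> Q)
    (x0 : Q) (c : chart R n Q) (k : regularity) (alpha : R) (mu : R[i])
    (hc : smooth_chart c) (hx0 : chart_dom c x0)
    (hPhi : dynamical_system Phi) (hPhi1 : Ckalpha_flow (Fin 1) 0 Phi)
    (hbasin : basin_of_hyperbolic Phi x0 c)
    (hk : regularity_ge1 k) (halpha : 0 <= alpha <= 1)
    (hrho : 0 < spectral_radius (chart_jacobian c (Phi ^~ 1) x0) < 1)
    (hmu : pow_order (spectral_radius (chart_jacobian c (Phi ^~ 1) x0)) k alpha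
             < normc (cexp mu)) :
  let A : 'M[R]_n := chart_jacobian c (Phi ^~ 1) x0 in
  (forall psi1 : Q -> R[i],
     koopman_eigenfunction Phi mu psi1 -> Ckalpha_fun k alpha psi1 ->
     (forall lambda : 'I_n -> R[i],
        eigenvalues_of A (fun i => cexp (lambda i)) ->
        exists m : 'I_n -> nat,
          cexp mu = cexp (\sum_(i < n) (m i)%:R * lambda i)) /\
     (principal_eigenfunction Phi x0 c mu psi1 ->
        eigenvalue (complexify A) (cexp mu) /\
        (nonresonant k (cexp mu) A ->
           (forall psi : Q -> R[i],
              principal_eigenfunction Phi x0 c mu psi ->
              Ckalpha_fun k alpha psi ->
              chart_cderivative c psi x0 = chart_cderivative c psi1 x0 -> psi = psi1) /\
           (complex.Im (cexp mu) = 0 ->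
            (forall i, complex.Im (chart_cderivative c psi1 x0 i 0) = 0) ->
            forall x, complex.Im (psi1 x) = 0) /\
           (simple_eigenvalue A (cexp mu) ->
            forall psi2 : Q -> R[i],
              principal_eigenfunction Phi x0 c mu psi2 ->
              Ckalpha_fun k alpha psi2 ->
              exists2 a : R[i], a <> 0 & forall x, psi1 x = a * psi2 x)))) /\
  (Ckalpha_flow k alpha Phi -> nonresonant k (cexp mu) A ->
   forall w : 'cV[R[i]]_n,
     left_eigenvector A (cexp mu) w ->
     (forall t : time R tk,
        complexify (chart_jacobian c (Phi ^~ t) x0) *m w
          = cexp (mu * (time_val t)%:C%C) *: w) ->
     exists psi : Q -> R[i],
       unique (fun f : Q -> R[i] =>
         [/\ Ckalpha_fun k alpha f, principal_eigenfunction Phi x0 c mu f &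
             chart_cderivative c f x0 = w]) psi /\
       forall P E : Q -> R[i],
         Ckalpha_fun k alpha P -> chart_cderivative c P x0 = w ->
         (forall x, P (Phi x 1) = cexp mu * P x + E x) ->
         (forall s : seq 'I_n, below_order (size s) k alpha ->
            cpartial s (E \o chart_param c) (chart_coord c x0) = 0) ->
         Ckalpha_cvg_order k alpha
           (fun t x => cexp (- mu * (time_val t)%:C%C) * P (Phi x t)) psi).
Proof.
case: n hn Q Phi x0 c hc hx0 hPhi hPhi1 hbasin hrho hmu =>
  [//|n'] _ Q Phi x0 c hc hx0 hPhi hPhi1 [fix0 stable basin _] hrho hmu A.
have time1 f : (forall t x, f (Phi x t) = cexp (mu * (time_val t)%:C%C) * f x) ->
    forall x, f (Phi x 1) = cexp mu * f x.
  by move=> fE x; rewrite fE (@time_val_nat R tk 1) mulr1.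
have refine := refine_order _ hk halpha hrho hmu.
have [K [a [th [ref _ K1 ha [th0 hth th1 hnu]]]]] := refine 0%N.
split=> [psi1 [nz1 /time1 E1] /(refine_fun ref) H1|hflow nres w [w0 Aw] wt].
  split=> [lambda sA|[_ C1 z1 d1]].
    have [m ->] := eigenfunction_order hc hx0 hPhi hPhi1 fix0 basin K1 ha th0 hth th1 hnu H1 E1 nz1 sA.
    by exists m; rewrite cexp_sum; apply: eq_bigr => i _; rewrite mulrC cexp_nat.
  have De := derivative_eigenvector hc hx0 hPhi1 fix0 C1 z1 E1.
  split=> [|nres]; first exact: column_eigenvalue d1 De.
  have unique := eigenfunction_unique hc hx0 hPhi hPhi1 fix0 basin K1 ha th0 hth th1 hnu
    (refine_nonresonant ref nres).
  split; [|split].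
  - move=> psi [[_ /time1 E] _ z _] /(refine_fun ref) H dE; apply/funext => x.
    by rewrite -[RHS]mul1r; apply: unique; rewrite ?scale1r.
  - exact: (eigenfunction_real hc hx0 hPhi hPhi1 fix0 basin K1 ha th0 hth th1 hnu
      (refine_nonresonant ref nres) H1 E1 z1).
  move=> simple psi2 [[_ /time1 E2] C2 z2 d2] /(refine_fun ref) H2.
  have De2 := derivative_eigenvector hc hx0 hPhi1 fix0 C2 z2 E2.
  have [u dE] := simple_root_eigenvector simple d2 De2 De.
  exists u; last by move=> x; apply: unique.
  by move=> u0; move: d1; rewrite dE u0 scale0r eqxx.
have flowK := refine_flow ref hflow; have nresK := refine_nonresonant ref nres.
have unique f g : Ckalpha_fun (Fin K) a f -> Ckalpha_fun (Fin K) a g ->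
    principal_eigenfunction Phi x0 c mu f -> principal_eigenfunction Phi x0 c mu g ->
    chart_cderivative c f x0 = w -> chart_cderivative c g x0 = w -> f = g.
  move=> Hf Hg [[_ /time1 fE] _ f0 _] [[_ /time1 gE] _ g0 _] df dg; apply/funext => x.
  rewrite -[RHS]mul1r; apply: (eigenfunction_unique hc hx0 hPhi hPhi1 fix0 basin K1 ha th0 hth th1 hnu nresK) => //.
  by rewrite scale1r df dg.
have [psi [Hpsi ppsi dpsi]] := principal_exists hc hx0 hPhi hPhi1 fix0 basin K1 ha flowK
  th0 hth th1 hnu nresK w0 Aw wt.
(* for k = oo, the eigenfunction found at a larger order equals psi by uniqueness at
   order K *)
have reg : Ckalpha_fun k alpha psi.
  case: (k) ref refine hflow nres => [j|]; first by case=> <- <-.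
  move=> a0 refine' hflow' nres' j; rewrite a0 in Hpsi unique.
  have [K' [a' [th' [ref' K0' K1' ha' [th0' hth' th1' hnu']]]]] := refine' (maxn j K).
  have [f [Hf pf df]] := principal_exists hc hx0 hPhi hPhi1 fix0 basin K1' ha'
    (refine_flow ref' hflow') th0' hth' th1' hnu' (refine_nonresonant ref' nres') w0 Aw wt.
  have := K0' erefl; rewrite geq_max => /andP[jK KK]; rewrite ref' in Hf.
  rewrite -(unique f psi (Ckalpha_fin_le KK Hf) Hpsi pf ppsi df dpsi).
  exact: (Ckalpha_fin_le jK Hf).
exists psi; split.
  split=> // f [/(refine_fun ref) Hf pf df]; exact: unique.
move=> P E HP dP PE jets.
have limit K' a' th' : (1 <= K')%N -> 0 <= a' <= 1 -> refines k alpha K' a' -> 0 < th' ->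
    spectral_radius A < th' -> th' < 1 -> th' `^ (K'%:R + a') < normc (cexp mu) ->
    forall k' b, (k' <= K')%N -> (0 < b -> k' = K' /\ b = a') ->
    Ckalpha_cvg k' b (fun (t : time R tk) x => cexp (- mu * (time_val t)%:C%C) * P (Phi x t)) psi.
  move=> K1' ha' ref' th0' hth' th1' hnu' k' b kk bb.
  apply: (principal_limit hc hx0 hPhi hPhi1 fix0 stable basin K1' ha' (refine_flow ref' hflow)
    th0' hth' th1' hnu' (refine_nonresonant ref' nres) w0 Aw (refine_fun ref' reg) ppsi dpsi
    (refine_fun ref' HP) dP _ kk bb) => s /(refine_below ref') bs.
  rewrite -(jets s bs); congr cpartial; apply/funext => v /=.
  by rewrite PE addrC addKr.
case: (k) ref refine limit => [j [jE aE] _ limit|_ refine' limit k' k1'] /=.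
  by apply: (limit K a th) => //; rewrite ?jE ?aE.
have [K' [a' [th' [ref' K0' K1' ha' [th0' hth' th1' hnu']]]]] := refine' k'.
by apply: (limit K' a' th') => //; rewrite ?ltxx ?K0'.
Qed.
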